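(* Let $n\ge 2$, $G=\mathrm{Spin}(2n,1)$, let $a_1>a_2>\cdots>a_{n-1}>0$ and $a_n>0$ be real numbers, $\vec a=(a_1,\dots,a_n)$, $f=\iota(t'_{\vec a})\in\mathfrak g^*$, $\mathcal O_f=G\cdot f$, and let $q:\mathcal O_f\to\mathfrak p^*$ be the moment map. For any $g\in G$, the reduced space $$q^{-1}(q(g\cdot f))/\mathrm{Stab}_P(q(g\cdot f))$$ is a singleton. The moment map $q$ is weakly proper, but not proper.
   Context: Put $m=2n-1$. $G=\mathrm{Spin}(m+1,1)$ is the two-fold covering of $\mathrm{SO}_e(m+1,1)$, the identity component of $\{X\in M_{m+2}(\mathbb{R}):XI_{m+1,1}X^t=I_{m+1,1}\}$, $I_{m+1,1}=\mathrm{diag}(1,\dots,1,-1)$; $\mathfrak g=\mathfrak{so}(m+1,1)$. $H_0$ has only nonzero entries $1$ at positions $(m+1,m+2),(m+2,m+1)$; $\mathfrak a=\mathbb{R}H_0$; $\mathfrak m=\mathfrak{so}(m)$ (upper-left block); for a row vector $\alpha\in\mathbb{R}^m$, $X_\alpha=\begin{pmatrix}0_{m\times m}&-\alpha^t&\alpha^t\\ \alpha&0&0\\ \alpha&0&0\end{pmatrix}$ and $\mathfrak n=\{X_\alpha\}$. $P=MAN$ is the minimal parabolic subgroup with Lie algebra $\mathfrak p=\mathfrak m+\mathfrak a+\mathfrak n$, $M\cong\mathrm{Spin}(m)$. Put $H'=\begin{pmatrix}0&1\\-1&0\end{pmatrix}$, $H=\begin{pmatrix}0&1\\1&0\end{pmatrix}$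 and $t'_{\vec a}=\mathrm{diag}\{a_1H',\dots,a_{n-1}H',0,a_nH\}\in\mathfrak g$. $\iota:\mathfrak g\to\mathfrak g^*$ is $\iota(X)(Y)=\frac12\mathrm{tr}(XY)$. The moment map $q:\mathcal O_f\to\mathfrak p^*$ is restriction of linear forms to $\mathfrak p$. An element $h\in\mathfrak p^*$ is regular if its coadjoint $P$-orbit has maximal dimension; it is strongly regular if it is regular and $\mathfrak s(h)=\{X\in\mathfrak p(h):\mathrm{ad}(X)\text{ is semisimple}\}$ ($\mathfrak p(h)$ the stabilizer of $h$ in $\mathfrak p$) has maximal dimension among all regular elements. $\Upsilon_{sr}\subset\mathfrak p^*$ is the set of strongly regular elements. $q$ is weakly proper if the preimage of each compact subset contained in $q(\mathcal O_f)\cap\Upsilon_{sr}$ is compact in $\mathcal O_f$. *)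

(* Defs.v *)
From HB Require Import structures.
From mathcomp Require Import all_boot all_order all_algebra.
From mathcomp Require Import all_classical all_reals all_analysis.

Set Implicit Arguments.
Unset Strict Implicit.
Unset Printing Implicit Defensive.

Import Order.TTheory GRing.Theory Num.Theory numFieldNormedType.Exports.

Local Open Scope classical_set_scope.
Local Open Scope ring_scope.

HB.mixin Record Group_isTopologicalGroup G of Group G & Topological G := {
  mulg_continuous : continuous (fun xy : G * G => (xy.1 * xy.2)%g);
  invg_continuous : continuous (fun x : G => (x^-1)%g)
}.

#[short(type="topGroupType")]
HB.structure Definition TopGroup :=
  { G of Group_isTopologicalGroup G & Group G & Topological G }.

(* For p continuous: p restricts to a homeomorphism from the open set V onto W,
   W carrying the subspace topology. *)
Definition homeo_onto (T U : topologicalType) (p : T -> U)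
    (V : set T) (W : set U) : Prop :=
  set_bij V W p /\
  forall A, open A -> A `<=` V -> exists2 B, open B & p @` A = B `&` W.

Definition two_fold_covering (T U : topologicalType) (p : T -> U)
    (S : set U) : Prop :=
  [/\ continuous p,
      range p = S
    & forall y, S y -> exists O : set U, [/\ open O, O y
        & exists V1 V2 : set T,
            [/\ open V1 /\ open V2,
                p @^-1` O = V1 `|` V2,
                V1 `&` V2 = set0,
                homeo_onto p V1 (O `&` S)
              & homeo_onto p V2 (O `&` S)]]].

Section Matrices.
Variable R : realType.

(* The matrix unit at (i, j), indices starting at 0. *)
Definition Emx (k i j : nat) : 'M[R]_k :=
  \matrix_(r < k, s < k) ((r == i :> nat) && (s == j :> nat))%:R.

Definition mexp (k : nat) (X : 'M[R]_k) : 'M[R]_k :=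
  limn (series (fun i : nat => (i`!%:R)^-1 *: X ^+ i)).

Variable m : nat.

(* I_{m+1,1} *)
Definition Iform : 'M[R]_(m + 2) :=
  diag_mx (\row_j (if j == m.+1 :> nat then -1 else 1 : R)).

Definition Opq : set 'M[R]_(m + 2) :=
  [set X | X *m Iform *m X^T = Iform].

Definition SOe : set 'M[R]_(m + 2) := connected_component Opq 1%:M.

Definition H0 : 'M[R]_(m + 2) := Emx _ m m.+1 + Emx _ m.+1 m.

Definition Xn (alpha : 'rV[R]_m) : 'M[R]_(m + 2) :=
  block_mx (0 : 'M[R]_m) (row_mx (- alpha^T) alpha^T)
           (col_mx alpha alpha) (0 : 'M[R]_2).

Definition so_map (X : 'M[R]_(m + 2)) : 'M[R]_(m + 2) :=
  X *m Iform + Iform *m X^T.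

Definition so_alg : {vspace 'M[R]_(m + 2)} := lker (linfun so_map).

Definition sym_map (A : 'M[R]_m) : 'M[R]_m := A + A^T.

Definition ulblock (A : 'M[R]_m) : 'M[R]_(m + 2) :=
  block_mx A 0 0 (0 : 'M[R]_2).

Definition m_alg : {vspace 'M[R]_(m + 2)} :=
  (linfun ulblock @: lker (linfun sym_map))%VS.

Definition a_alg : {vspace 'M[R]_(m + 2)} := <[H0]>%VS.

Definition n_alg : {vspace 'M[R]_(m + 2)} := limg (linfun Xn).

Definition p_alg : {vspace 'M[R]_(m + 2)} := (m_alg + a_alg + n_alg)%VS.

(* The functions passed to [linfun] above are linear. *)

Fact so_map_linear : linear so_map.
Proof.
move=> a A B; rewrite /so_map mulmxDl linearP /= mulmxDr -scalemxAl -scalemxAr.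
by rewrite scalerDr addrACA.
Qed.
HB.instance Definition _ := GRing.isLinear.Build _ _ _ _ so_map so_map_linear.

Fact sym_map_linear : linear sym_map.
Proof. by move=> a A B; rewrite /sym_map linearP /= scalerDr addrACA. Qed.
HB.instance Definition _ := GRing.isLinear.Build _ _ _ _ sym_map sym_map_linear.

Fact ulblock_linear : linear ulblock.
Proof.
by move=> a A B; rewrite /ulblock scale_block_mx add_block_mx !scaler0 !addr0.
Qed.
HB.instance Definition _ := GRing.isLinear.Build _ _ _ _ ulblock ulblock_linear.

Fact Xn_linear : linear Xn.
Proof.
move=> a A B; rewrite /Xn scale_block_mx add_block_mx !scaler0 !addr0.
rewrite (@scale_row_mx _ m 1 1) (@scale_col_mx _ 1 1 m) (@add_row_mx _ m 1 1).
by rewrite (@add_col_mx _ 1 1 m) linearP /= opprD scalerN.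
Qed.
HB.instance Definition _ := GRing.isLinear.Build _ _ _ _ Xn Xn_linear.

Lemma mem_so X : (X \in so_alg) = (X *m Iform + Iform *m X^T == 0).
Proof. by rewrite memv_ker lfunE. Qed.

Lemma mem_m X :
  reflect (exists2 A : 'M[R]_m, A + A^T = 0 & X = ulblock A) (X \in m_alg).
Proof.
apply: (iffP memv_imgP) => [[A]|[A A0 ->]].
  by rewrite memv_ker !lfunE /= => /eqP A0 ->; exists A.
by exists A; rewrite ?lfunE // memv_ker lfunE /= /sym_map A0.
Qed.

Lemma mem_n X : reflect (exists alpha, X = Xn alpha) (X \in n_alg).
Proof.
apply: (iffP memv_imgP) => [[A _ ->]|[A ->]]; exists A; rewrite ?lfunE //.
exact: memvf.
Qed.

End Matrices.

(* Spin(m+1,1), characterised up to isomorphism as the connected two-fold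
   covering group of SO_e(m+1,1). *)
Record spinGroup (R : realType) (m : nat) := SpinGroup {
  spin_sort :> topGroupType;
  cov : spin_sort -> 'M[R]_(m + 2);
  spin_connected : connected [set: spin_sort];
  covM : forall x y : spin_sort, cov (x * y)%g = cov x *m cov y;
  cov_two_fold : two_fold_covering cov (@SOe R m)
}.

Section Orbits.
Variables (R : realType) (m : nat) (G : spinGroup R m).

Local Notation mx := 'M[R]_(m + 2).
Local Notation g := (@so_alg R m).
Local Notation p := (@p_alg R m).

Definition Ad (x : G) (Y : mx) : mx := cov x *m Y *m cov (x^-1)%g.

(* P = MAN, described by its image in SO_e(m+1,1): M = Spin(m) is the full
   inverse image of SO(m), so P contains the kernel of the covering. *)
Definition MAN : set G :=
  [set x | exists (k : 'M[R]_m) (t : R) (alpha : 'rV[R]_m),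
     [/\ k *m k^T = 1%:M, \det k = 1
       & cov x = (block_mx k 0 0 (1%:M : 'M[R]_2) : mx)
                   *m mexp (t *: H0 R m) *m mexp (Xn alpha)]].

Definition dualsp (U : {vspace mx}) := 'Hom(subvs_of U, R^o).

(* The coadjoint action on U^*, for x normalising U (then vsproj U only
   retypes Ad (x^-1) Y, which already lies in U).  It is used for U = g, and
   for U = p and x in P. *)
Definition coad (U : {vspace mx}) (x : G) (h : dualsp U) : dualsp U :=
  linfun (fun Y : subvs_of U => h (vsproj U (Ad (x^-1)%g (vsval Y)))).

Definition iota_form (X : mx) : dualsp g :=
  linfun (fun Y : subvs_of g => (2^-1 * \tr (X *m vsval Y) : R^o)).

Definition coadjoint_orbit (f : dualsp g) : set (dualsp g) :=
  range (fun x : G => coad x f).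

(* Restriction of forms to p; as p is contained in g, vsproj g is a retyping. *)
Definition moment (f : dualsp g) : dualsp p :=
  linfun (fun Y : subvs_of p => f (vsproj g (vsval Y))).

Definition fiber (f : dualsp g) (h : dualsp p) : set (dualsp g) :=
  [set u | coadjoint_orbit f u /\ moment u = h].

Definition StabP (h : dualsp p) : set G := [set x | MAN x /\ coad x h = h].

(* The quotient F / S, as the set of S-orbits of elements of F. *)
Definition orbit_space (S : set G) (F : set (dualsp g)) : set (set (dualsp g)) :=
  [set [set coad x u | x in S] | u in F].

Definition reduced_space (f : dualsp g) (h : dualsp p) : set (set (dualsp g)) :=
  orbit_space (StabP h) (fiber f h).

Definition adp (X : subvs_of p) : 'End(subvs_of p) :=
  linfun (fun Y : subvs_of p =>
    vsproj p (vsval X *m vsval Y - vsval Y *m vsval X)).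

Definition coadp (h : dualsp p) : 'Hom(subvs_of p, dualsp p) :=
  linfun (fun X : subvs_of p => - (h \o adp X)%VF).

(* The stabiliser p(h) of h in p *)
Definition stabp (h : dualsp p) : {vspace subvs_of p} := lker (coadp h).

(* The dimension of the orbit P.h, i.e. of its tangent space p.h at h. *)
Definition orbit_dim (h : dualsp p) : nat := \dim (limg (coadp h)).

Definition regular_form (h : dualsp p) : Prop :=
  forall h' : dualsp p, (orbit_dim h' <= orbit_dim h)%N.

Definition semisimple (V : vectType R) (u : 'End(V)) : Prop :=
  forall U : {vspace V}, (u @: U <= U)%VS ->
  exists W : {vspace V},
    [/\ (u @: W <= W)%VS, (U + W)%VS = fullv & (U :&: W)%VS = 0%VS].

Definition s_set (h : dualsp p) : set (subvs_of p) :=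
  [set X | X \in stabp h /\ semisimple (adp X)].

(* The largest number of linearly independent elements of A, i.e. the
   dimension of A when A is a linear subspace. *)
Definition set_dim (V : vectType R) (A : set V) : nat :=
  \max_(k < (\dim {:V}).+1 |
        `[< exists X : k.-tuple V, free X /\ forall i, A (tnth X i) >]) k.

Definition strongly_regular : set (dualsp p) :=
  [set h | regular_form h /\
    forall h', regular_form h' -> (set_dim (s_set h') <= set_dim (s_set h))%N].

(* Compactness in a finite-dimensional space, for its usual topology (that of
   the coordinates in any basis).  For A inside an orbit, being compact in the
   orbit and in the ambient space is the same. *)
Definition fd_compact (V : vectType R) (A : set V) : Prop :=
  compact [set passmx.rVof (vbasis {:V}) v | v in A].

Definition weakly_proper (f : dualsp g) : Prop :=
  forall K : set (dualsp p), fd_compact K ->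
    K `<=` moment @` coadjoint_orbit f `&` strongly_regular ->
    fd_compact (coadjoint_orbit f `&` moment @^-1` K).

Definition proper_moment (f : dualsp g) : Prop :=
  forall K : set (dualsp p), fd_compact K ->
    fd_compact (coadjoint_orbit f `&` moment @^-1` K).

End Orbits.

Definition tprime (R : realType) (n : nat) (a : 'I_n -> R) :
    'M[R]_((2 * n).-1 + 2) :=
  \sum_(k < n) a k *:
    (if (k.+1 < n)%N
     then Emx R _ (2 * k) (2 * k).+1 - Emx R _ (2 * k).+1 (2 * k)
     else Emx R _ (2 * n).-1 (2 * n) + Emx R _ (2 * n) (2 * n).-1).

(* Main.v *)
(** Through the trace form, O_f is the SO_e-conjugacy class of T = t'_a and p^*
    is g/n.  Let v be a vector spanning the isotropic line fixed by P.  Two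
    elements Y1, Y2 of the class have the same image in p^* iff
    (Y2 - Y1) J = v w^T - w v^T for some w orthogonal to v.  Such a change is seen
    neither by the determinant of x - Y bordered by v and v^T J, nor by the
    contraction of YJ /\ ... /\ YJ /\ v with the volume form.  If Yi = gi T gi^-1,
    these invariants determine gi^-1 v up to the torus centralising T: the first
    one gives the norms of its components in the T-invariant planes, the second
    one its component on ker T with its sign.  Hence some h in the torus makes
    g2 h^-1 g1^-1 fix v; it then lies in P and carries Y1 to Y2.

    If Y v is a multiple of v then q(Y) is not regular.  On a compact set of
    regular values |Y v| is therefore bounded below, and then q(Y) bounds Y.  A
    bounded Y is g T g^-1 with g bounded, after multiplying g by a boost that
    centralises T; so the preimage of a compact set is the image of a compact
    set of matrices g.  Finally the N-orbit of T contains an affine line with a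
    single image, so q is not proper. *)

Require Import Defs.
From HB Require Import structures.
From mathcomp Require Import all_boot all_order all_algebra all_fingroup.
From mathcomp Require Import all_classical all_reals all_analysis.
From mathcomp Require Import ring lra zify.

Set Implicit Arguments.
Unset Strict Implicit.
Unset Printing Implicit Defensive.

Import Order.TTheory GRing.Theory Num.Theory numFieldNormedType.Exports.

Local Open Scope classical_set_scope.
Local Open Scope ring_scope.

(** Each term of the rank two change between two elements with the same image has [v0] as a factor,
    so bordering by [v0] and [v0^T J] turns the change into row and column operations. This yields
    only squares of components, whereas the torus fixes ker T pointwise: the sign there is a genuine
    invariant, and it takes a covariant that sees the orientation to detect it. In the hyperbolic
    plane of T squares are not enough either. A boost scales [v_l + v_m] and [v_l - v_m] by inverse
    factors, so the signs must match and, if one of them vanishes, it must be known which. Time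
    orientation gives the signs; the eigenvalue of Y on [v0] settles the degenerate case. For
    compactness the obstacle is that [J] is indefinite, so the invariants of a conjugacy class bound
    no norm by themselves. On the isotropic vectors [Linv g *m v0], however, the negative square can
    be eliminated, and the values of the form on the images under T, T^2 and T^3 become
    comparable. *)

(** [linfun] accepts any function but represents only linear ones. The forms of the statement are
    built from bare functions, so each is evaluated through a proof of linearity. *)
Lemma linfun_linear (F : fieldType) (aT rT : vectType F) (f : aT -> rT) :
  linear f -> linfun f =1 f.
Proof.
move=> lf.
pose f' : {linear aT -> rT} :=
  HB.pack f (GRing.isLinear.Build _ _ _ _ f lf).
exact: (lfunE f').
Qed.

(** * Topology of matrix spaces *)

Section Continuity.
Variables (R : realType) (T : topologicalType).

Lemma continuous_sumr (V : normedModType R) (I : Type) (r : seq I) (P : pred I)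
    (F : I -> T -> V) :
  (forall i, P i -> continuous (F i)) ->
  continuous (fun x => \sum_(i <- r | P i) F i x).
Proof. by move=> cF; apply: continuous_big => // x; exact: add_continuous. Qed.

Lemma continuous_prodr (I : Type) (r : seq I) (P : pred I) (F : I -> T -> R) :
  (forall i, P i -> continuous (F i)) ->
  continuous (fun x => \prod_(i <- r | P i) F i x).
Proof. by move=> cF; apply: continuous_big => // x; exact: mul_continuous. Qed.

Lemma continuous_mx p q (f : T -> 'M[R]_(p, q)) :
  (forall i j, continuous (fun x => f x i j)) -> continuous f.
Proof.
move=> cf; rewrite (_ : f = fun x => \sum_i \sum_j f x i j *: delta_mx i j).
  apply: continuous_sumr => i _; apply: continuous_sumr => j _ x.
  by apply: continuousZr_tmp; exact: cf.
by apply/funext => x; exact: matrix_sum_delta.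
Qed.

Lemma continuous_coord p q (f : T -> 'M[R]_(p, q)) i j :
  continuous f -> continuous (fun x => f x i j).
Proof.
move=> cf x; apply: (@continuous_comp _ _ _ f (fun M : 'M[R]_(p, q) => M i j)).
  exact: cf.
exact: coord_continuous.
Qed.

Lemma continuous_mulmx p q r (f : T -> 'M[R]_(p, q))
    (g : T -> 'M[R]_(q, r)) :
  continuous f -> continuous g -> continuous (fun x => f x *m g x).
Proof.
move=> cf cg; apply: continuous_mx => i j.
under eq_fun do rewrite mxE.
apply: continuous_sumr => k _ x.
by apply: continuousM; exact: continuous_coord.
Qed.

Lemma continuous_trmx p q (f : T -> 'M[R]_(p, q)) :
  continuous f -> continuous (fun x => (f x)^T).
Proof.
move=> cf; apply: continuous_mx => i j; under eq_fun do rewrite mxE.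
exact: continuous_coord.
Qed.

Lemma continuous_det p (f : T -> 'M[R]_p) :
  continuous f -> continuous (fun x => \det (f x)).
Proof.
move=> cf; apply: continuous_sumr => s _ x.
apply: cvgMl_tmp.
by apply: continuous_prodr => i _; exact: continuous_coord.
Qed.

Lemma continuous_cstf (U : topologicalType) (c : U) :
  continuous (fun _ : T => c).
Proof. exact: cst_continuous. Qed.

Lemma continuous_idf : continuous (fun x : T => x).
Proof. by move=> x; exact: cvg_id. Qed.

End Continuity.

Lemma continuous_linear_mx (R : realType) p q (V : normedModType R)
    (f : 'M[R]_(p, q) -> V) : linear f -> continuous f.
Proof.
move=> lf.
pose f' : {linear 'M[R]_(p, q) -> V} :=
  HB.pack f (GRing.isLinear.Build _ _ _ _ f lf).
rewrite (_ : f = fun M => \sum_i \sum_j M i j *: f (delta_mx i j)).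
  apply: continuous_sumr => i _; apply: continuous_sumr => j _ x.
  by apply: continuousZr_tmp; exact: coord_continuous.
apply/funext => M; rewrite [in LHS](matrix_sum_delta M) -[f _]/(f' _) linear_sum.
by apply: eq_bigr => i _; rewrite linear_sum; apply: eq_bigr => j _; rewrite linearZ.
Qed.

Lemma closed_eq_fun (R : realType) (T : topologicalType) (V : normedModType R)
  (f : T -> V) (c : V) : continuous f -> closed [set x | f x = c].
Proof.
move=> cf; apply: (@preimage_closed _ _ f [set c]) => [x _|]; first exact: cf.
by apply: compact_closed; [exact: norm_hausdorff|exact: compact_set1].
Qed.

(** * The Lorentz group *)

Section Lorentz.
Variables (R : realType) (m : nat).
Local Notation mx := 'M[R]_(m + 2).
Local Notation J := (@Iform R m).
Local Notation O := (@Opq R m).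
Local Notation SO := (@SOe R m).

Definition ordm : 'I_(m + 2) := rshift m (0 : 'I_2).
Definition ordl : 'I_(m + 2) := rshift m (1 : 'I_2).
Local Notation im := ordm.
Local Notation il := ordl.

Definition sgJ (i : 'I_(m + 2)) : R := if i == il then -1 else 1.
Local Notation eps := sgJ.

Lemma IformE : J = diag_mx (\row_i eps i).
Proof.
congr diag_mx; apply/rowP => i; rewrite !mxE /sgJ -val_eqE /= addn1.
by [].
Qed.

Lemma trJ : J^T = J. Proof. exact: tr_diag_mx. Qed.

Lemma JJ : J *m J = 1%:M.
Proof.
rewrite IformE mulmx_diag -diag_const_mx; congr diag_mx; apply/rowP => i.
by rewrite !mxE /sgJ; case: ifP => _; rewrite ?mulrNN mulr1.
Qed.

Lemma mulJmx q (A : 'M[R]_(m + 2, q)) i j : (J *m A) i j = eps i * A i j.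
Proof. by rewrite IformE mul_diag_mx !mxE. Qed.

Lemma mulmxJ q (A : 'M[R]_(q, m + 2)) i j : (A *m J) i j = A i j * eps j.
Proof. by rewrite IformE mul_mx_diag !mxE. Qed.

(* Locked, as otherwise [mulmxA] unfolds it and reassociates the product. *)
Definition Linv (g : mx) : mx := locked (J *m g^T *m J).

Lemma LinvE g : Linv g = J *m g^T *m J. Proof. by rewrite /Linv -lock. Qed.

Lemma OP g : O g <-> g *m Linv g = 1%:M.
Proof.
rewrite /Opq LinvE /= !mulmxA; split => [->|H]; first exact: JJ.
by rewrite -[LHS]mulmx1 -JJ mulmxA H mul1mx.
Qed.

Lemma mulOV g : O g -> g *m Linv g = 1%:M. Proof. by move/OP. Qed.
Lemma mulVO g : O g -> Linv g *m g = 1%:M. Proof. by move/OP/mulmx1C. Qed.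

Lemma Linv1 : Linv 1%:M = 1%:M. Proof. by rewrite LinvE trmx1 mulmx1 JJ. Qed.

Lemma LinvM g h : Linv (g *m h) = Linv h *m Linv g.
Proof.
rewrite !LinvE trmx_mul !mulmxA; congr (_ *m _ *m _).
by rewrite -[RHS]mulmxA JJ mulmx1.
Qed.

Lemma LinvK g : Linv (Linv g) = g.
Proof. by rewrite !LinvE !trmx_mul trmxK trJ !mulmxA JJ mul1mx -mulmxA JJ mulmx1. Qed.

Lemma O1 : O 1%:M. Proof. by apply/OP; rewrite Linv1 mulmx1. Qed.

Lemma OM g h : O g -> O h -> O (g *m h).
Proof.
move=> Og Oh; apply/OP.
by rewrite LinvM -mulmxA [h *m _]mulmxA mulOV // mul1mx mulOV.
Qed.

Lemma OV g : O g -> O (Linv g).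
Proof. by move=> Og; apply/OP; rewrite LinvK mulVO. Qed.

Lemma O_trmx g : O g -> g^T *m J *m g = J.
Proof.
move/mulVO; rewrite LinvE => H.
by rewrite -[LHS]mul1mx -JJ -[RHS]mulmx1 -H !mulmxA.
Qed.

Lemma SO_O : SO `<=` O. Proof. exact: connected_component_sub. Qed.

Lemma SO1 : SO 1%:M. Proof. exact/connected_component_refl/O1. Qed.

Lemma closed_O : closed O.
Proof.
apply: closed_eq_fun; apply: continuous_mulmx.
  by apply: continuous_mulmx; [exact: continuous_idf|exact: continuous_cstf].
by apply: continuous_trmx; exact: continuous_idf.
Qed.

Lemma closed_SO : closed SO. Proof. exact/component_closed/closed_O. Qed.

(** Membership in the identity component spreads along a connected family from one of its points;
    this serves for paths, left translations and inversion. *)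
Lemma connected_image (T : topologicalType) (f : T -> mx) (A : set T) :
  connected A -> continuous f -> (forall x, A x -> O (f x)) ->
  forall x y, A x -> A y -> SO (f x) -> SO (f y).
Proof.
move=> cA cf AO x y Ax Ay Sx.
apply: (connected_component_trans Sx).
exists (f @` A); last by exists y.
split; [by exists x| by move=> _ [z Az <-]; exact: AO|].
by apply: connected_continuous_connected => //; exact: continuous_subspaceT.
Qed.

Lemma path_SO (f : R -> mx) : continuous f -> (forall t, O (f t)) -> f 0 = 1%:M ->
  forall t, SO (f t).
Proof.
move=> cf fO f0 t.
have [t0|t0] := leP 0 t.
  apply: (@connected_image _ f `[0, t] _ cf _ 0 t) => //.
  - exact: segment_connected.
  - by rewrite /= in_itv /= lexx.
  - by rewrite /= in_itv /= lexx andbT.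
  - by rewrite f0; exact: SO1.
apply: (@connected_image _ f `[t, 0] _ cf _ 0 t) => //.
- exact: segment_connected.
- by rewrite /= in_itv /= lexx andbT ltW.
- by rewrite /= in_itv /= lexx ltW.
- by rewrite f0; exact: SO1.
Qed.

Lemma SOM g h : SO g -> SO h -> SO (g *m h).
Proof.
move=> Sg Sh; have Og := SO_O Sg.
apply: (@connected_image _ (mulmx g) SO _ _ _ 1%:M h) => //.
- exact: component_connected.
- by apply: continuous_mulmx; [exact: continuous_cstf|exact: continuous_idf].
- by move=> x /SO_O; exact: OM.
- exact: SO1.
- by rewrite mulmx1.
Qed.

Lemma SOV g : SO g -> SO (Linv g).
Proof.
move=> Sg.
apply: (@connected_image _ Linv SO _ _ _ 1%:M g) => //.
- exact: component_connected.
- rewrite (_ : Linv = fun h => J *m h^T *m J); last by apply/funext => h; rewrite LinvE.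
  apply: continuous_mulmx; last exact: continuous_cstf.
  apply: continuous_mulmx; first exact: continuous_cstf.
  by apply: continuous_trmx; exact: continuous_idf.
- by move=> x /SO_O; exact: OV.
- exact: SO1.
- by rewrite Linv1; exact: SO1.
Qed.

Lemma O_detK g : O g -> \det g * \det g = 1.
Proof.
move=> Og; have /(congr1 determinant) := mulOV Og.
rewrite LinvE !det_mulmx det_tr det1 => H; rewrite -{}[RHS]H.
have := congr1 determinant JJ; rewrite det_mulmx det1 => HJ.
by rewrite [X in _ = _ * X]mulrAC HJ mul1r.
Qed.

Lemma connected_pos (T : topologicalType) (A : set T) (f : T -> R) x y :
  connected A -> continuous f -> (forall x, A x -> f x != 0) -> A x -> A y ->
  0 < f x -> 0 < f y.
Proof.
move=> cA cf f0 Ax Ay fx; rewrite ltNge; apply/negP => fy.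
have /connected_intervalP cI : connected (f @` A).
  by apply: connected_continuous_connected => //; exact: continuous_subspaceT.
have [z Az /eqP] : (f @` A) 0.
  apply: (cI (f y) (f x)); [by exists y|by exists x|].
  by rewrite fy ltW.
by rewrite (negPf (f0 z Az)).
Qed.

Lemma SO_det g : SO g -> \det g = 1.
Proof.
move=> Sg; have d0 h : SO h -> \det h != 0.
  move/SO_O/O_detK => H; apply/eqP => d; move: H.
  by rewrite d mul0r => /esym/eqP; rewrite oner_eq0.
have dg : 0 < \det g.
  apply: (@connected_pos _ SO (fun h : mx => \det h) 1%:M) => //.
  - exact: component_connected.
  - by apply: continuous_det; exact: continuous_idf.
  - exact: SO1.
  - by rewrite det1.
have /eqP := O_detK (SO_O Sg).
rewrite -expr2 sqrf_eq1 => /orP[/eqP//|/eqP H].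
by move: dg; rewrite H oppr_gt0 ltNge ler01.
Qed.

Lemma O_row_l g : O g -> \sum_i g il i ^+ 2 * eps i = -1.
Proof.
move=> Og; have /matrixP/(_ il il) := Og; rewrite mxE.
have -> : J il il = -1 by rewrite IformE !mxE /sgJ eqxx.
by move=> <-; apply: eq_bigr => i _; rewrite mulmxJ mxE expr2 mulrAC.
Qed.

Lemma eps_lshift (i : 'I_m) : eps (lshift 2 i) = 1.
Proof. by rewrite /sgJ /ordl eq_lrshift. Qed.
Lemma eps_im : eps im = 1.
Proof. by rewrite /sgJ /im /ordl eq_rshift. Qed.
Lemma eps_il : eps il = -1.
Proof. by rewrite /sgJ eqxx. Qed.

Lemma big_split_l (F : 'I_(m + 2) -> R) :
  \sum_i F i = \sum_(i < m) F (lshift 2 i) + F im + F il.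
Proof.
rewrite big_split_ord /= !big_ord_recl big_ord0 addr0 addrA.
congr (_ + _ + _); congr F; exact/val_inj.
Qed.

Lemma O_row_lE g : O g ->
  g il il ^+ 2 = 1 + \sum_(i < m) g il (lshift 2 i) ^+ 2 + g il im ^+ 2.
Proof.
move/O_row_l; rewrite big_split_l eps_im eps_il => /eqP.
under eq_bigr do rewrite eps_lshift mulr1.
by rewrite -subr_eq0 => /eqP H; apply/eqP; rewrite -subr_eq0; apply/eqP; lra.
Qed.

(** Time orientation: the square of this entry is at least 1 on the whole Lorentz group, so its sign
    is constant on the identity component. *)
Lemma SO_ll_gt0 g : SO g -> 0 < g il il.
Proof.
move=> Sg; apply: (@connected_pos _ SO (fun h : mx => h il il) 1%:M) => //.
- exact: component_connected.
- exact: coord_continuous.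
- move=> h /SO_O/O_row_lE; case: eqP => // -> /eqP.
  rewrite expr0n /= lt_eqF // -addrA ltr_pwDl // addr_ge0 ?sqr_ge0 //.
  by apply: sumr_ge0 => i _; exact: sqr_ge0.
- exact: SO1.
- by rewrite mxE eqxx.
Qed.

Lemma SO_lm_lt g : SO g -> `|g il im| < g il il.
Proof.
move=> Sg; have gl := SO_ll_gt0 Sg.
rewrite -(gtr0_norm gl) -ltr_sqr ?nnegrE // !real_normK ?num_real //.
rewrite O_row_lE; last exact: SO_O.
rewrite ltrDr ltr_pwDl //.
by apply: sumr_ge0 => i _; exact: sqr_ge0.
Qed.

End Lorentz.

(** * The Pfaffian covector *)

Section Pfaffian.
Variables (R : realFieldType) (n N : nat).
Variables (enc : option ('I_n * bool) -> 'I_N) (dec : 'I_N -> option ('I_n * bool)).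
Hypotheses (encK : cancel enc dec) (decK : cancel dec enc).

Local Notation p k := (enc (Some (k, false))).
Local Notation q k := (enc (Some (k, true))).
Local Notation r := (enc None).

Lemma prod_enc (F : 'I_N -> R) :
  \prod_j F j = (\prod_k (F (p k) * F (q k))) * F r.
Proof.
rewrite (reindex enc) /=; last by exists dec => j _; rewrite ?encK ?decK.
rewrite (bigD1 None) //= mulrC; congr (_ * _).
rewrite (reindex_omap Some id) /=; last by case.
rewrite (eq_bigl predT); last by move=> x; rewrite eqxx.
rewrite (eq_bigr (fun x => F (enc (Some (x.1, x.2))))); last by case.
rewrite -(pair_bigA _ (fun k b => F (enc (Some (k, b))))) /=.
by apply: eq_bigr => k _; rewrite big_bool mulrC.
Qed.

(** Distributing the product chooses two indices for each pair and one for the remaining slot; [enc]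
    merges these choices into a single map on coordinates. *)
Lemma distr_enc (G : 'I_n -> 'I_N -> 'I_N -> R) (H : 'I_N -> R) :
  (\prod_k \sum_a \sum_b G k a b) * (\sum_c H c) =
  \sum_(g : {ffun 'I_N -> 'I_N}) (\prod_k G k (g (p k)) (g (q k))) * H (g r).
Proof.
transitivity ((\prod_k \sum_(ab : 'I_N * 'I_N) G k ab.1 ab.2) * (\sum_c H c)).
  by congr (_ * _); apply: eq_bigr => k _; rewrite pair_bigA.
rewrite bigA_distr_bigA /= big_distrlr /= pair_bigA /=.
pose g2 (g : {ffun 'I_N -> 'I_N}) :=
  ([ffun k : 'I_n => (g (p k), g (q k))], g r).
pose g1 (hc : {ffun 'I_n -> 'I_N * 'I_N} * 'I_N) : {ffun 'I_N -> 'I_N} :=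
  [ffun j => match dec j with
             | None => hc.2
             | Some (k, b) => if b then (hc.1 k).2 else (hc.1 k).1 end].
rewrite (reindex g2) /=.
  apply: eq_bigr => g _; congr (_ * _).
  by apply: eq_bigr => k _; rewrite ffunE.
exists g1 => [g _|[h c] _].
  apply/ffunP => j; rewrite ffunE /= -[in RHS](decK j).
  by case: (dec j) => [[k []]|] //; rewrite ffunE.
rewrite /g2 /g1; congr pair; last by rewrite ffunE encK.
by apply/ffunP => k; rewrite !ffunE !encK; case: (h k).
Qed.

Definition pfterm (S : 'M[R]_N) (v : 'cV[R]_N) (f : 'I_N -> 'I_N) : R :=
  (\prod_k S (f (p k)) (f (q k))) * v (f r) 0.

(* Up to a factor, the contraction of the volume form with [n] copies of the
   bivector [S] and the vector [v]; [enc] pairs up the coordinates. *)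
Definition pfvec (S : 'M[R]_N) (v : 'cV[R]_N) : R :=
  \sum_(s : 'S_N) (-1) ^+ s * pfterm S v s.

(** As in the Cauchy-Binet formula: for a fixed choice [g] of inner indices, the signed sum over
    permutations is the determinant of the columns of [phi] selected by [g]. *)
Lemma pfvec_expand (phi S : 'M[R]_N) v :
  pfvec (phi *m S *m phi^T) (phi *m v) =
  \sum_(g : {ffun 'I_N -> 'I_N})
    \det (phi *m \matrix_(i, j) (i == g j)%:R) * pfterm S v g.
Proof.
have E (s : 'S_N) : pfterm (phi *m S *m phi^T) (phi *m v) s =
    \sum_(g : {ffun 'I_N -> 'I_N}) (\prod_j phi (s j) (g j)) * pfterm S v g.
  rewrite /pfterm.
  transitivity ((\prod_k \sum_a \sum_b
      (phi (s (p k)) a * S a b * phi (s (q k)) b)) *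
      (\sum_c phi (s r) c * v c 0)).
    rewrite !mxE; congr (_ * _); apply: eq_bigr => k _.
    rewrite mxE exchange_big; apply: eq_bigr => b _.
    by rewrite !mxE big_distrl.
  rewrite distr_enc; apply: eq_bigr => g _.
  rewrite prod_enc mulrA [RHS]mulrA; congr (_ * _); rewrite -!mulrA.
  rewrite [phi _ _ * _]mulrC mulrA; congr (_ * _); rewrite -big_split /=.
  by apply: eq_bigr => k _; rewrite mulrAC.
rewrite /pfvec; under eq_bigr do rewrite E big_distrr.
rewrite exchange_big; apply: eq_bigr => g _.
rewrite -det_tr /determinant big_distrl; apply: eq_bigr => s _ /=.
rewrite -mulrA; congr (_ * (_ * _)); apply: eq_bigr => j _.
rewrite !mxE (bigD1 (g j)) //= mxE eqxx mulr1 big1 ?addr0 // => i.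
by rewrite mxE => /negPf ->; rewrite mulr0.
Qed.

(** Compare the expansions for [phi] and for the identity: each selected determinant splits off the
    factor [\det phi]. *)
Lemma pfvec_mul (phi S : 'M[R]_N) v :
  pfvec (phi *m S *m phi^T) (phi *m v) = \det phi * pfvec S v.
Proof.
rewrite pfvec_expand.
have := pfvec_expand 1%:M S v; rewrite trmx1 mulmx1 !mul1mx => ->.
rewrite big_distrr; apply: eq_bigr => g _ /=.
by rewrite det_mulmx mul1mx mulrA.
Qed.

(** Only permutations with [s r = l] give a nonzero term, and by injectivity these send no paired
    coordinate to [l]. *)
Lemma pfvec_eq_off (S S' : 'M[R]_N) l :
  (forall i j, i != l -> j != l -> S i j = S' i j) ->
  pfvec S (delta_mx l 0) = pfvec S' (delta_mx l 0).
Proof.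
move=> SS'; apply: eq_bigr => s _; congr (_ * _); rewrite /pfterm !mxE eqxx andbT.
have [srl|] := eqVneq (s r) l; last by rewrite !mulr0.
congr (_ * _); apply: eq_bigr => k _; apply: SS'.
- by rewrite -srl (inj_eq perm_inj) (can_eq encK).
- by rewrite -srl (inj_eq perm_inj) (can_eq encK).
Qed.

Definition blockfun (b : bool) (pi : 'S_n) (j : 'I_N) : 'I_N :=
  if dec j is Some (k, c) then if c == b then enc (Some (pi k, b)) else j
  else j.

Lemma blockfun_inj b pi : injective (blockfun b pi).
Proof.
pose pV := blockfun b pi^-1%g.
apply: (can_inj (g := pV)) => j; rewrite /pV /blockfun.
case Dj: (dec j) => [[k c]|] /=; last by rewrite Dj.
case: eqP => [cb|/eqP/negPf cb]; last by rewrite Dj cb.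
by rewrite encK eqxx permK -cb -Dj decK.
Qed.

Definition blockperm b pi : 'S_N := perm (@blockfun_inj b pi).

Definition swapfun (j : 'I_N) : 'I_N :=
  if dec j is Some (k, c) then enc (Some (k, ~~ c)) else j.

Lemma swapfunK : involutive swapfun.
Proof.
move=> j; rewrite /swapfun; case Dj: (dec j) => [[k c]|]; last by rewrite Dj.
by rewrite encK negbK -Dj decK.
Qed.

Definition swapperm : 'S_N := perm (can_inj swapfunK).

Lemma blockperm_conj pi : (blockperm false pi ^ swapperm)%g = blockperm true pi.
Proof.
apply/permP => j; rewrite -[j in LHS](permKV swapperm) permJ.
have -> : (swapperm^-1 j)%g = swapfun j.
  by apply: (@perm_inj _ swapperm); rewrite permKV permE swapfunK.
rewrite !permE /blockfun /swapfun.
case Dj: (dec j) => [[k []]|]; rewrite ?encK ?eqxx ?Dj //= ?encK //=.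
by rewrite -Dj decK.
Qed.

(** The same permutation acts on the first and on the second members of the pairs. The two actions
    are conjugate by the swap of all pairs, so their parities cancel. *)
Lemma block_even (s : 'S_N) (pi' : 'S_n) :
  (forall k b, s (enc (Some (k, b))) = enc (Some (pi' k, b))) -> s r = r ->
  odd_perm s = false.
Proof.
move=> sE sr.
have -> : s = (blockperm false pi' * blockperm true pi')%g.
  apply/permP => j; rewrite permM !permE /blockfun -[j](decK).
  case: (dec j) => [[k []]|]; rewrite !encK ?sE ?sr //= ?encK //=.
by rewrite odd_permM -blockperm_conj odd_permJ addbb.
Qed.

Section BlockValue.
Variables (S : 'M[R]_N) (w : 'I_n -> R).
Hypothesis w_neq0 : forall k, w k != 0.
Hypothesis SE : forall i j, S i j =
  match dec i, dec j with
  | Some (k, b), Some (k', b') =>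
      if (k == k') && (b != b') then (if b then - w k else w k) else 0
  | _, _ => 0
  end.

(** Exchanging the two members of a pair changes the sign of the permutation and, [S] being skew,
    the sign of one entry. Induction on the number of reversed pairs leads to a permutation of whole
    pairs, which is even. *)
Lemma pair_term (s : 'S_N) :
  (forall k, S (s (p k)) (s (q k)) != 0) -> s r = r ->
  (-1) ^+ s * \prod_k S (s (p k)) (s (q k)) = \prod_k w k.
Proof.
have [c] := ubnP #|[pred k | if dec (s (p k)) is Some (_, b) then b else false]|.
elim: c s => // c IHc s; rewrite ltnS => sc sS sr.
have sS' k : { l : 'I_n & { b : bool | s (p k) = enc (Some (l, b)) /\
    s (q k) = enc (Some (l, ~~ b)) } }.
  have := sS k; rewrite SE; case Dp: (dec _) => [[l b]|] /=; last by rewrite eqxx.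
  case Dq: (dec _) => [[l' b']|] /=; last by rewrite eqxx.
  have [ll'|_] := eqVneq l l'; last by rewrite /= eqxx.
  have [_|bb' _] := eqVneq b b'; first by rewrite /= eqxx.
  exists l, b; split; first by rewrite -Dp decK.
  by rewrite -[LHS]decK Dq ll'; case: b b' bb' {Dp Dq} => [] [].
have [k sk|none] :=
  pickP [pred k | if dec (s (p k)) is Some (_, b) then b else false].
  have pq : p k != q k by rewrite (can_eq encK); apply/eqP => -[].
  pose s' := (tperm (p k) (q k) * s)%g.
  have s'r : s' r = r by rewrite permM tpermD ?(can_eq encK).
  have s'k : s' (p k) = s (q k) /\ s' (q k) = s (p k).
    by rewrite !permM tpermL tpermR.
  have s'E k' b : k' != k -> s' (enc (Some (k', b))) = s (enc (Some (k', b))).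
    by move=> k'k; rewrite permM tpermD // (can_eq encK); apply/eqP => -[kk'];
      rewrite kk' eqxx in k'k.
  have Sflip : S (s (p k)) (s (q k)) = - S (s (q k)) (s (p k)).
    have [l [b [-> ->]]] := sS' k.
    by rewrite !SE !encK eqxx; case: b => /=; rewrite ?opprK.
  rewrite -(IHc s') //.
  - rewrite odd_permM odd_tperm pq signr_addb /= expr1.
    rewrite [in LHS](bigD1 k) //= [in RHS](bigD1 k) //= s'k.1 s'k.2 Sflip.
    rewrite !mulNr mul1r mulrN; congr (- (_ * (_ * _))).
    by apply: eq_bigr => k' k'k; rewrite !s'E.
  - apply: leq_trans sc; apply: proper_card; apply/properP; split.
      apply/fintype.subsetP => k'; rewrite !inE.
      have [->|k'k] := eqVneq k' k; last by rewrite s'E.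
      by move=> _; exact: sk.
    exists k; rewrite !inE //= s'k.1.
    have [l [b [Ep Eq]]] := sS' k.
    by move: sk; rewrite /= Ep Eq !encK => ->.
  - move=> k'; have [->|k'k] := eqVneq k' k; last by rewrite !s'E.
    by rewrite s'k.1 s'k.2 -oppr_eq0 -Sflip.
pose f k := projT1 (sS' k).
have fE k b : s (enc (Some (k, b))) = enc (Some (f k, b)).
  rewrite /f; case: (sS' k) => l [b' [Ep Eq]] /=.
  have := none k; rewrite /= Ep encK => b'F.
  by move: Ep Eq; rewrite b'F; case: b.
have f_inj : injective f.
  move=> k k' kk'; have /perm_inj/(can_inj encK)[] // :
    s (enc (Some (k, false))) = s (enc (Some (k', false))) by rewrite !fE kk'.
rewrite (@block_even s (perm f_inj)) => [|k b|//]; last by rewrite permE fE.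
rewrite expr0 mul1r [RHS](reindex_inj f_inj); apply: eq_bigr => k _.
by rewrite !fE SE !encK eqxx.
Qed.

(** Row and column [r] of [S] vanish, so only permutations fixing [r] contribute. By [pair_term]
    they all contribute the same amount, so nothing cancels in the constant. *)
Lemma pfvec_block : exists2 C, C != 0 & forall v, pfvec S v = C * v r 0.
Proof.
pose C := \sum_(s : 'S_N) (-1) ^+ s * \prod_k S (s (p k)) (s (q k)).
have Sr i : (S r i = 0) * (S i r = 0).
  by rewrite !SE encK; case: (dec i) => [[]|].
have sr (s : 'S_N) : \prod_k S (s (p k)) (s (q k)) != 0 -> s r = r.
  move/prodf_neq0 => sS; rewrite -[s r]decK.
  case Ds: (dec (s^-1%g r)) => [[k b]|].
    have /(_ isT) := sS k; rewrite (_ : r = s (s^-1%g r)) ?permKV //.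
    have := sS k isT; move: Ds => /(congr1 enc); rewrite decK => /(canRL (permKV s)) rE.
    by case: b rE => rE; rewrite -rE Sr eqxx.
  by move/(congr1 enc): Ds; rewrite decK => /(canRL (permKV s)) <-; rewrite encK.
exists C => [|v]; last first.
  rewrite /C big_distrl; apply: eq_bigr => s _; rewrite /pfterm mulrA /=.
  have [->|/sr ->//] := eqVneq (\prod_k S (s (p k)) (s (q k))) 0.
  by rewrite !mulr0 !mul0r.
have w0 : \prod_k w k != 0 by apply/prodf_neq0 => k _.
(* Divided by the product of the [w k], the constant counts the permutations with a nonzero term,
   and the identity is one of them. *)
rewrite -(mulfVK w0 C) mulf_neq0 // gt_eqF // /C big_distrl.
rewrite (bigD1 (1%g : 'S_N)) //= ltr_pwDl //.
  rewrite pair_term ?perm1 ?divff // => k; rewrite !perm1.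
  by rewrite SE !encK eqxx /= w_neq0.
apply: sumr_ge0 => s _.
have [->|S0] := eqVneq (\prod_k S (s (p k)) (s (q k))) 0.
  by rewrite mulr0 mul0r.
rewrite pair_term ?divff //; last exact: sr.
by move=> k; move/prodf_neq0: S0; exact.
Qed.

End BlockValue.

End Pfaffian.

(** * Uniqueness of partial fractions *)

Lemma partial_fractions (R : realFieldType) (I : finType) (d lam : I -> R) (B : R) :
  (forall x, B < x -> \sum_i d i / (x - lam i) = 0) ->
  forall l, \sum_(i | lam i == l) d i = 0.
Proof.
move=> H l.
pose s := undup [seq lam i | i <- enum I].
(* Poles may coincide, so denominators are cleared with the list of distinct values; at [l] only the
   terms with that pole survive in [P]. *)
have s_lam i : lam i \in s by rewrite mem_undup map_f ?mem_enum.
pose P := \sum_i d i *: \prod_(l' <- s | l' != lam i) ('X - l'%:P).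
have PE x : P.[x] = \sum_i d i * \prod_(l' <- s | l' != lam i) (x - l').
  rewrite horner_sum; apply: eq_bigr => i _; rewrite hornerZ horner_prod.
  by congr (_ * _); apply: eq_bigr => l' _; rewrite !hornerE.
pose M : R := `|B| + \sum_i `|lam i|.
have MB (x : R) : M < x -> B < x /\ forall i, lam i < x.
  move=> Mx; split.
    apply: le_lt_trans Mx; apply: (le_trans (ler_norm B)).
    by rewrite lerDl sumr_ge0.
  move=> i; apply: le_lt_trans Mx; apply: (le_trans (ler_norm (lam i))).
  by rewrite /M (bigD1 i) //= addrCA lerDl addr_ge0 // sumr_ge0.
have root_P (x : R) : M < x -> root P x.
  move=> /MB[Bx lx]; rewrite rootE PE.
  apply/eqP; transitivity ((\sum_i d i / (x - lam i)) * \prod_(l' <- s) (x - l')).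
    2: by rewrite H // mul0r.
  rewrite big_distrl; apply: eq_bigr => i _ /=.
  rewrite (bigD1_seq (lam i)) ?undup_uniq //= mulrA mulfVK //.
  by rewrite subr_eq0 gt_eqF.
have P0 : P = 0.
  apply/eqP; apply: contraT => P_neq0.
  (* As many distinct points beyond [M] as the size of [P], all of them roots: one more than a
     nonzero [P] can have. *)
  pose rs := [seq M + k.+1%:R | k <- iota 0 (size P)].
  suff: (size rs < size P)%N by rewrite size_map size_iota ltnn.
  apply: max_poly_roots => //.
    by apply/allP => _ /mapP[k _ ->]; apply: root_P; rewrite ltrDl ltr0n.
  rewrite map_inj_uniq ?iota_uniq // => k k' /addrI/eqP.
  by rewrite eqr_nat => /eqP[].
have [ls|ls] := boolP (l \in s); last first.
  by rewrite big1 // => i /eqP li; rewrite -li s_lam in ls.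
have s0 : \prod_(l' <- s | l' != l) (l - l') != 0.
  by rewrite prodf_seq_neq0; apply/allP => l' _; rewrite subr_eq0 eq_sym implybb.
apply: (mulIf s0); rewrite mul0r big_distrl /=.
transitivity P.[l]; last by rewrite P0 horner0.
rewrite PE.
rewrite [RHS](bigID (fun i => lam i == l)) /= [X in _ = _ + X]big1 ?addr0.
  by apply: eq_bigr => i /eqP ->.
move=> i li; apply/eqP; rewrite mulf_eq0 prodf_seq_eq0; apply/orP; right.
by apply/hasP; exists l; rewrite // eq_sym li subrr eqxx.
Qed.

(** * Bordered determinants *)

Section Bordered.
Variables (F : fieldType) (N : nat).

(** Schur complement of [B]: the bordered determinant is a resolvent coefficient once [B] is
    [x - Y]. *)
Lemma det_bordered (B : 'M[F]_N) (v : 'cV[F]_N) (u : 'rV[F]_N) : B \in unitmx ->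
  \det (block_mx B v u (0 : 'M[F]_1)) = - (\det B * (u *m invmx B *m v) 0 0).
Proof.
move=> uB.
have -> : block_mx B v u (0 : 'M[F]_1) =
    block_mx (1%:M : 'M[F]_N) 0 (u *m invmx B) (1%:M : 'M[F]_1) *m
    block_mx B v 0 (- (u *m invmx B *m v)).
  rewrite mulmx_block !mul1mx !(mul0mx, mulmx0, addr0) mulmxKV //.
  by rewrite addrN.
rewrite det_mulmx det_lblock det_ublock !det1 !mul1r.
by rewrite det_mx11 mxE mulrN.
Qed.

(** Multiples of the border column and of the border row absorb the two rank one terms. *)
Lemma det_bordered_shift (B : 'M[F]_N) (v w' : 'cV[F]_N) (u w : 'rV[F]_N) :
  \det (block_mx (B + v *m w + w' *m u) v u (0 : 'M[F]_1)) =
  \det (block_mx B v u (0 : 'M[F]_1)).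
Proof.
have -> : block_mx (B + v *m w + w' *m u) v u (0 : 'M[F]_1) =
    block_mx (1%:M : 'M[F]_N) w' 0 (1%:M : 'M[F]_1) *m
    (block_mx B v u 0 *m block_mx (1%:M : 'M[F]_N) 0 w (1%:M : 'M[F]_1)).
  rewrite !mulmx_block !(mul1mx, mul0mx, mulmx0, mulmx1).
  by rewrite !(addr0, add0r) mulmx0 addr0.
by rewrite !det_mulmx det_lblock det_ublock !det1 !(mul1r, mulr1).
Qed.

Lemma resolvent_shift (B B' : 'M[F]_N) (v w' : 'cV[F]_N) (u w : 'rV[F]_N) :
    B \in unitmx -> \det B' = \det B -> B' = B + v *m w + w' *m u ->
  u *m invmx B' *m v = u *m invmx B *m v.
Proof.
move=> uB dB BE; have uB' : B' \in unitmx by rewrite unitmxE dB -unitmxE.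
have := det_bordered_shift B v w' u w; rewrite -BE !det_bordered // dB.
move/oppr_inj/mulfI; rewrite -unitfE -unitmxE => /(_ uB) E.
by apply/matrixP => i j; rewrite !ord1.
Qed.

End Bordered.

(** * Rotations of the plane *)

Lemma rotation_exists (R : realType) (x y x' y' : R) :
  x' ^+ 2 + y' ^+ 2 = x ^+ 2 + y ^+ 2 ->
  exists a, cos a * x' + sin a * y' = x /\ cos a * y' - sin a * x' = y.
Proof.
move=> E; pose n := x ^+ 2 + y ^+ 2.
have n_ge0 : 0 <= n by rewrite addr_ge0 ?sqr_ge0.
have [n0|n0] := eqVneq n 0.
  have [-> ->] : x = 0 /\ y = 0.
    by move/eqP: n0; rewrite paddr_eq0 ?sqr_ge0 // !sqrf_eq0 => /andP[/eqP ? /eqP].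
  have [-> ->] : x' = 0 /\ y' = 0.
    move/eqP: n0; rewrite /n -E paddr_eq0 ?sqr_ge0 // !sqrf_eq0.
    by move=> /andP[/eqP ? /eqP].
  by exists 0; rewrite !mulr0 addr0 subr0.
(* For [z = x + iy] and [z' = x' + iy'] of equal modulus, [c - i s] is the quotient [z / z']. *)
pose c := (x * x' + y * y') / n; pose s := (x * y' - y * x') / n.
have cs : c ^+ 2 + s ^+ 2 = 1.
  have -> : c ^+ 2 + s ^+ 2 =
      ((x * x' + y * y') ^+ 2 + (x * y' - y * x') ^+ 2) / n ^+ 2.
    by rewrite mulrDl -!expr_div_n.
  have -> : (x * x' + y * y') ^+ 2 + (x * y' - y * x') ^+ 2 =
      n * (x' ^+ 2 + y' ^+ 2) by rewrite /n; ring.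
  by rewrite E -/n -expr2 divff // sqrf_eq0.
have [a [ca sa]] : exists a, cos a = c /\ sin a = s.
  have c1 : -1 <= c <= 1.
    rewrite -ler_norml -(ler_sqr) ?nnegrE // real_normK ?num_real // expr1n -cs.
    by rewrite lerDl sqr_ge0.
  have S : sin (acos c) = `|s|.
    (* [acos] yields only angles with nonnegative sine, whence the two cases on the sign of [s]. *)
    by rewrite sin_acos // -cs addrC addKr sqrtr_sqr.
  have [s0|s0] := leP 0 s.
    by exists (acos c); rewrite acosK ?in_itv // S ger0_norm.
  exists (- acos c); rewrite cosN sinN acosK ?in_itv // S ltr0_norm //.
  by rewrite opprK.
have [cn sn] : c * n = x * x' + y * y' /\ s * n = x * y' - y * x'.
  by rewrite !mulfVK.
exists a; rewrite ca sa; split; apply: (mulIf n0).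
  rewrite mulrDl (mulrAC c) (mulrAC s) cn sn /n -E; ring.
by rewrite mulrBl (mulrAC c) (mulrAC s) cn sn /n -E; ring.
Qed.

(** * The torus of [t'_a] *)

Section Monomial.
Variables (R : realType) (m : nat).
Local Notation mx := 'M[R]_(m + 2).
Local Notation I := 'I_(m + 2).
Local Notation J := (@Iform R m).
Local Notation eps := (@sgJ R m).
Local Notation im := (ordm m).
Local Notation il := (ordl m).

Variable tau : I -> I.
Hypothesis tauK : involutive tau.

(* [C + S P_tau], with [C], [S] diagonal and [P_tau] the matrix of [tau]. *)
Definition hm (C S : I -> R) : mx :=
  \matrix_(i, j) (C i *+ (i == j) + S i *+ (j == tau i)).

Lemma tau_eq i j : (i == tau j) = (tau i == j).
Proof. by rewrite -(inj_eq (inv_inj tauK)) tauK. Qed.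

Lemma hm_sum C S i (F : I -> R) :
  \sum_k hm C S i k * F k = C i * F i + S i * F (tau i).
Proof.
under eq_bigr => k _ do rewrite mxE mulrDl !mulrnAl !mulrb.
rewrite big_split /= -!big_mkcond /=; congr (_ + _).
  by under eq_bigl do rewrite eq_sym; rewrite big_pred1_eq.
by rewrite big_pred1_eq.
Qed.

Lemma hmM C S C' S' : hm C S *m hm C' S' =
  hm (fun i => C i * C' i + S i * S' (tau i))
     (fun i => C i * S' i + S i * C' (tau i)).
Proof.
apply/matrixP => i j; rewrite mxE hm_sum !mxE tauK.
rewrite [tau i == j]eq_sym [j == i]eq_sym.
by case: (i == j); case: (j == tau i); rewrite ?mulr1n ?mulr0n; ring.
Qed.

Lemma hm_col C S (v : 'cV[R]_(m + 2)) i :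
  (hm C S *m v) i 0 = C i * v i 0 + S i * v (tau i) 0.
Proof. by rewrite mxE hm_sum. Qed.

Lemma eq_hm C S C' S' : C =1 C' -> S =1 S' -> hm C S = hm C' S'.
Proof. by move=> CC SS; apply/matrixP => i j; rewrite !mxE CC SS. Qed.

Lemma hm1 : hm (fun=> 1) (fun=> 0) = 1%:M.
Proof. by apply/matrixP => i j; rewrite !mxE mul0rn addr0. Qed.

Lemma Linv_hm C S :
  Linv (hm C S) = hm C (fun i => eps i * eps (tau i) * S (tau i)).
Proof.
rewrite LinvE; apply/matrixP => i j; rewrite mulmxJ mulJmx !mxE tau_eq [j == i]eq_sym.
rewrite [tau i == j]eq_sym mulrDr mulrDl.
have e2 k : eps k * eps k = 1 :> R.
  by rewrite /sgJ; case: ifP; rewrite ?mulrNN mulr1.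
congr (_ + _).
  have [->|_] := eqVneq i j; last by rewrite !mulr0n mulr0 mul0r.
  by rewrite !mulr1n mulrAC e2 mul1r.
have [->|_] := eqVneq j (tau i); last by rewrite !mulr0n mulr0 mul0r.
by rewrite !mulr1n mulrAC.
Qed.

Lemma hm_O C S :
  (forall i, C i * C i + eps i * eps (tau i) * (S i * S i) = 1) ->
  (forall i, eps i * eps (tau i) * S (tau i) * C i + S i * C (tau i) = 0) ->
  @Opq R m (hm C S).
Proof.
move=> H1 H2; apply/OP; rewrite Linv_hm hmM -hm1; apply: eq_hm => i.
  rewrite tauK -(H1 i); ring.
by rewrite -(H2 i); ring.
Qed.

Lemma bilin_hm C S (v : 'cV[R]_(m + 2)) :
  (v^T *m J *m hm C S *m v) 0 0 =
  \sum_i eps i * (v i 0 * (C i * v i 0 + S i * v (tau i) 0)).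
Proof.
rewrite -mulmxA mxE; apply: eq_bigr => i _.
by rewrite hm_col mulmxJ mxE; ring.
Qed.

End Monomial.

Section TorusData.
Variables (R : realType) (m : nat).
Local Notation mx := 'M[R]_(m + 2).
Local Notation I := 'I_(m + 2).
Local Notation J := (@Iform R m).
Local Notation SO := (@SOe R m).
Local Notation eps := (@sgJ R m).
Local Notation im := (ordm m).
Local Notation il := (ordl m).

Definition nullv : 'cV[R]_(m + 2) := delta_mx im 0 + delta_mx il 0.
Local Notation v0 := nullv.

Lemma v0E i : v0 i 0 = (i == im)%:R + (i == il)%:R.
Proof. by rewrite !mxE !andbT. Qed.

Lemma im_il : im != il. Proof. by rewrite /ordm /ordl eq_rshift. Qed.

Lemma eps_eps i : eps i * eps i = 1.
Proof. by rewrite /sgJ; case: ifP; rewrite ?mulrNN mulr1. Qed.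

(* The paper's [t'_a] is [hm tau 0 t]: [tau] exchanges the two coordinates of
   each 2x2 block and fixes the coordinate [r] of the block 0. *)
Record torus_data (t : I -> R) (tau : I -> I) (r : I) : Prop := TorusData {
  tauK : involutive tau;
  tau_im : tau im = il;
  tau_r : tau r = r;
  tau_fix : forall i, tau i = i -> i = r;
  t_r : t r = 0;
  t_neq0 : forall i, i != r -> t i != 0;
  t_tau : forall i, t (tau i) * eps (tau i) = - (t i * eps i);
  t_inj : forall i j, t i * t (tau i) = t j * t (tau j) -> j = i \/ j = tau i;
  t_im_gt0 : 0 < t im }.

Variables (t : I -> R) (tau : I -> I) (r : I).
Hypothesis td : torus_data t tau r.

Local Notation c := (t im).
Local Notation hm := (hm tau).
Local Notation T := (hm (fun=> 0) t).

(** The eigenvalues of [T^2], which is diagonal: [- t_i^2] on the rotation planes, [c^2] on the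
    hyperbolic plane, 0 on the kernel. *)
Definition lamT i := t i * t (tau i).
Local Notation lam := lamT.

Let tK := tauK td.

Lemma tau_il : tau il = im. Proof. by rewrite -(tau_im td) tK. Qed.

Lemma r_im : r != im.
Proof.
apply/eqP => rm; have := im_il; rewrite -(tau_im td) -rm.
by rewrite (tau_r td) eqxx.
Qed.

Lemma r_il : r != il.
Proof.
by apply/eqP => rl; have := im_il; rewrite -tau_il -rl (tau_r td) eqxx.
Qed.

Lemma tau_eqm i : (tau i == im) = (i == il).
Proof. by rewrite -tau_il (inj_eq (inv_inj tK)). Qed.
Lemma tau_eql i : (tau i == il) = (i == im).
Proof. by rewrite -(tau_im td) (inj_eq (inv_inj tK)). Qed.
Lemma tau_eqr i : (tau i == r) = (i == r).
Proof. by rewrite -[in LHS](tau_r td) (inj_eq (inv_inj tK)). Qed.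

Lemma eps_other i : i != il -> eps i = 1.
Proof. by rewrite /sgJ => /negPf ->. Qed.

Lemma t_il : t il = c.
Proof.
have := t_tau td im; rewrite (tau_im td) eps_im eps_il mulr1 mulrN1.
by move/oppr_inj.
Qed.

Lemma t_rot i : i != im -> i != il -> t (tau i) = - t i.
Proof.
move=> im' il'; have := t_tau td i.
by rewrite !eps_other ?tau_eql // !mulr1.
Qed.

Lemma lam_tau i : lam (tau i) = lam i.
Proof. by rewrite /lamT tK mulrC. Qed.

Lemma lam_rot i : i != im -> i != il -> lam i = - (t i ^+ 2).
Proof. by move=> i1 i2; rewrite /lamT t_rot // mulrN expr2. Qed.

Lemma lam_im : lam im = c ^+ 2.
Proof. by rewrite /lamT (tau_im td) t_il expr2. Qed.
Lemma lam_il : lam il = c ^+ 2.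
Proof. by rewrite -(tau_im td) lam_tau lam_im. Qed.
Lemma lam_le i : lam i <= c ^+ 2.
Proof.
have [->|i1] := eqVneq i im; first by rewrite lam_im.
have [->|i2] := eqVneq i il; first by rewrite lam_il.
by rewrite lam_rot // (@le_trans _ _ 0) ?oppr_le0 ?sqr_ge0.
Qed.

(** Here the parameters must be distinct: an eigenvalue of [T^2] singles out one plane or the
    kernel. *)
Lemma lam_class i j : (lam j == lam i) = (j == i) || (j == tau i).
Proof.
apply/eqP/orP => [/esym/(t_inj td)[]->|[]/eqP ->]; rewrite ?eqxx ?lam_tau; auto.
Qed.

Lemma sum_class i (F : I -> R) :
  \sum_(j | lam j == lam i) F j = if i == r then F r else F i + F (tau i).
Proof.
under eq_bigl do rewrite lam_class.
have [->|ir] := eqVneq i r.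
  by rewrite (tau_r td); under eq_bigl do rewrite orbb; rewrite big_pred1_eq.
rewrite (bigD1 i) ?eqxx //=; congr (_ + _).
rewrite (big_pred1 (tau i)) // => j /=.
have [->|] := eqVneq j (tau i); last by rewrite orbF andbN.
by rewrite orbT /=; apply: contra ir => /eqP/(tau_fix td)/eqP.
Qed.

Definition dres (x : R) i := (x ^+ 2 - lam i)^-1.

Lemma dres_neq0 x i : c < x -> x ^+ 2 - lam i != 0.
Proof.
move=> cx; rewrite subr_eq0 gt_eqF // (le_lt_trans (lam_le i)) //.
by rewrite ltr_sqr // ?nnegrE ?ltW // ?(t_im_gt0 td) // (lt_trans (t_im_gt0 td)).
Qed.

Lemma xT_hm x : x%:M - T = hm (fun=> x) (fun i => - t i).
Proof.
apply/matrixP => i j; rewrite !mxE mul0rn add0r mulNrn.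
by [].
Qed.

(** From [(x - T)(x + T) = x^2 - T^2] with [T^2] diagonal; [x > c] puts [x^2] above every eigenvalue
    of [T^2]. *)
Lemma resolventE x : c < x ->
  (x%:M - T) *m hm (fun i => x * dres x i) (fun i => t i * dres x i) = 1%:M.
Proof.
move=> cx; rewrite xT_hm hmM // -(@hm1 R m tau); apply: eq_hm => i.
  rewrite -[RHS](@divff _ (x ^+ 2 - lam i)) ?dres_neq0 //.
  by rewrite /dres lam_tau /lam; ring.
by rewrite /dres lam_tau; ring.
Qed.

Lemma resolvent_unit x : c < x -> x%:M - T \in unitmx.
Proof. by move/resolventE/mulmx1_unit => []. Qed.

Lemma invmx_resolvent x : c < x ->
  invmx (x%:M - T) = hm (fun i => x * dres x i) (fun i => t i * dres x i).
Proof.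
move=> cx; have u := resolvent_unit cx.
by apply: (can_inj (mulKmx u)); rewrite mulmxV // resolventE.
Qed.

Lemma resolvent_bilin x (v : 'cV[R]_(m + 2)) : c < x ->
  (v^T *m J *m invmx (x%:M - T) *m v) 0 0 =
  x * \sum_i eps i * v i 0 ^+ 2 * dres x i.
Proof.
move=> cx; rewrite invmx_resolvent // bilin_hm //.
pose s i := eps i * t i * v i 0 * v (tau i) 0 * dres x i.
(* The part of the resolvent that is odd in T defines a skew form, which vanishes on the pair
   [v, v]; [tau] realises the cancellation. *)
have s0 : \sum_i s i = 0.
  have : \sum_i s i = - \sum_i s i.
    rewrite {1}(reindex_inj (inv_inj tK)) -sumrN; apply: eq_bigr => i _.
    rewrite /s tK /dres lam_tau [eps _ * _]mulrC (t_tau td); ring.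
  by move/eqP; rewrite -addr_eq0 -mulr2n mulrn_eq0 /= => /eqP.
transitivity (x * (\sum_i eps i * v i 0 ^+ 2 * dres x i) + \sum_i s i); last first.
  by rewrite s0 addr0.
rewrite big_distrr -big_split; apply: eq_bigr => i _ /=.
by rewrite /s; ring.
Qed.

(** In [X = x^2] the resolvent is a sum of simple fractions with one pole per plane, so each residue
    is determined. Residues involve squares only, which leaves the sign on the kernel open. *)
Lemma resolvent_inj (v v' : 'cV[R]_(m + 2)) :
  (forall x, c < x -> (v^T *m J *m invmx (x%:M - T) *m v) 0 0 =
                      (v'^T *m J *m invmx (x%:M - T) *m v') 0 0) ->
  forall i, if i == r then v r 0 ^+ 2 = v' r 0 ^+ 2 else
    eps i * v i 0 ^+ 2 + eps (tau i) * v (tau i) 0 ^+ 2 =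
    eps i * v' i 0 ^+ 2 + eps (tau i) * v' (tau i) 0 ^+ 2.
Proof.
move=> H i.
have c0 := t_im_gt0 td.
have := @partial_fractions R I (fun i => eps i * v i 0 ^+ 2 - eps i * v' i 0 ^+ 2)
  lam (c ^+ 2) _ (lam i).
rewrite sum_class => P.
suff /P : forall X, c ^+ 2 < X ->
    \sum_i (eps i * v i 0 ^+ 2 - eps i * v' i 0 ^+ 2) / (X - lam i) = 0.
  have [_|_] := eqVneq i r.
    rewrite eps_other ?r_il // !mul1r => /eqP.
    by rewrite subr_eq0 => /eqP.
  by move=> E; apply/eqP; rewrite -subr_eq0 -E; apply/eqP; ring.
move=> X cX; pose x := Num.sqrt X.
have X0 : 0 <= X by rewrite ltW // (le_lt_trans _ cX) // sqr_ge0.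
have xX : x ^+ 2 = X by rewrite sqr_sqrtr.
have cx : c < x.
  by rewrite -ltr_sqr ?nnegrE ?sqrtr_ge0 ?ltW // xX.
have := H x cx; rewrite !resolvent_bilin // => /mulfI.
have -> : x != 0 by rewrite gt_eqF // (lt_trans c0).
move=> /(_ isT)/eqP; rewrite -subr_eq0 -sumrB => /eqP {2}<-.
by apply: eq_bigr => k _; rewrite /dres xX mulrBl.
Qed.

Section TorusElement.
Variables (v v' : 'cV[R]_(m + 2)) (mu : R).
Hypothesis v_r : v r 0 = v' r 0.
Hypothesis v_rot : forall i, i != r -> i != im -> i != il ->
  v i 0 ^+ 2 + v (tau i) 0 ^+ 2 = v' i 0 ^+ 2 + v' (tau i) 0 ^+ 2.
Hypothesis mu_gt0 : 0 < mu.
Hypothesis v_plus : v il 0 + v im 0 = mu * (v' il 0 + v' im 0).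
Hypothesis v_minus : mu * (v il 0 - v im 0) = v' il 0 - v' im 0.

(** A rotation in each rotation plane, and in the hyperbolic plane the boost that scales the two
    isotropic coordinates by [mu] and [mu^-1]. Multiplying all parameters by [s] joins the element
    to the identity. *)
Lemma torus_element :
  exists h : mx, [/\ SO h, h *m T = T *m h & h *m v' = v].
Proof.
have rot i : exists a, (i != r) && (i != im) && (i != il) ->
    cos a * v' i 0 + sin a * v' (tau i) 0 = v i 0 /\
    cos a * v' (tau i) 0 - sin a * v' i 0 = v (tau i) 0.
  have [/andP[/andP[i1 i2] i3]|_] := boolP (_ && _); last by exists 0.
  by have [a ?] := rotation_exists (esym (v_rot i1 i2 i3)); exists a.
have [th thP] := choice rot.
pose hyp i := (i == im) || (i == il).
(* The angle is chosen at the smaller coordinate of each plane. The other coordinate gets the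
   opposite angle because the sine entry changes sign there; the boost parameter is the same on
   both. *)
pose phi i := if hyp i then ln mu
  else if (i < tau i)%N then th i else if (tau i < i)%N then - th (tau i) else 0.
pose C s i := if hyp i then (expR (s * phi i) + expR (- (s * phi i))) / 2
  else cos (s * phi i).
pose S s i := if hyp i then (expR (s * phi i) - expR (- (s * phi i))) / 2
  else sin (s * phi i).
have hyp_tau i : hyp (tau i) = hyp i by rewrite /hyp tau_eqm tau_eql orbC.
have phi_tau i : phi (tau i) = if hyp i then phi i else - phi i.
  rewrite /phi hyp_tau tK; case: ifP => // _.
  by case: ltngtP; rewrite ?opprK ?oppr0.
have C_tau s i : C s (tau i) = C s i.
  by rewrite /C hyp_tau phi_tau; case: (hyp i); rewrite // mulrN cosN.
have S_tau s i : S s (tau i) = if hyp i then S s i else - S s i.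
  by rewrite /S hyp_tau phi_tau; case: (hyp i); rewrite // mulrN sinN.
have hyp_eps i : eps i * eps (tau i) = if hyp i then -1 else 1.
  rewrite /hyp; have [->|i1] := eqVneq i im.
    by rewrite (tau_im td) eps_im eps_il mul1r.
  have [->|i2] /= := eqVneq i il; first by rewrite tau_il eps_im eps_il mulr1.
  by rewrite !eps_other ?tau_eql // mulr1.
have hO s : @Opq R m (hm (C s) (S s)).
  apply: hm_O => // i; rewrite hyp_eps ?C_tau ?S_tau /C /S; case: (hyp i).
  - rewrite [X in X = _](_ : _ = expR (s * phi i) * expR (- (s * phi i))).
      by rewrite -expRD subrr expR0.
    by field.
  - by rewrite mul1r -!expr2 cos2Dsin2.
  - by ring.
  - by ring.
exists (hm (C 1) (S 1)); split.
- apply: (@path_SO _ _ (fun s => hm (C s) (S s))) => //.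
  + apply: continuous_mx => i j.
    have cph k : continuous (fun s : R => s * k).
      by move=> s; apply: cvgMr_tmp; exact: cvg_id.
    have cexp k : continuous (fun s : R => expR (s * k)).
      by move=> s; apply: continuous_comp; [exact: cph|exact: continuous_expR].
    have cexpN k : continuous (fun s : R => expR (- (s * k))).
      by rewrite (_ : (fun _ => _) = fun s => expR (s * - k)) //;
        apply/funext => s; rewrite mulrN.
    have cC : continuous (fun s => C s i).
      rewrite /C; case: (hyp i) => s; last first.
        by apply: continuous_comp; [exact: cph|exact: continuous_cos].
      by apply: cvgMr_tmp; apply: cvgD; [exact: cexp|exact: cexpN].
    have cS : continuous (fun s => S s i).
      rewrite /S; case: (hyp i) => s; last first.
        by apply: continuous_comp; [exact: cph|exact: continuous_sin].
      by apply: cvgMr_tmp; apply: cvgB; [exact: cexp|exact: cexpN].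
    rewrite (_ : (fun _ => _) =
        fun s => C s i * (i == j)%:R + S s i * (j == tau i)%:R); last first.
      apply/funext => s; rewrite mxE.
      by case: (i == j); case: (j == tau i); rewrite ?mulr1n ?mulr0n ?mulr1 ?mulr0.
    by move=> s; apply: cvgD; apply: cvgMr_tmp; [exact: cC|exact: cS].
  + rewrite -(@hm1 R m tau); apply: eq_hm => i; rewrite /C /S mul0r oppr0 expR0.
      by case: (hyp i); rewrite ?cos0 //; field.
    by case: (hyp i); rewrite ?sin0 // subrr mul0r.
- rewrite !hmM //; apply: eq_hm => i.
    rewrite S_tau !mul0r !mulr0 !add0r; have [hi|hi] := boolP (hyp i).
      have -> : t (tau i) = t i.
        by move: hi => /orP[]/eqP ->; rewrite ?tau_il ?(tau_im td) t_il.
      by rewrite mulrC.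
    by move: hi; rewrite negb_or => /andP[i1 i2]; rewrite t_rot //; ring.
  by rewrite C_tau; ring.
- apply/colP => i; rewrite hm_col // /C /S mul1r.
  have [hi|hi] := boolP (hyp i).
    rewrite /phi hi expRN lnK ?posrE //.
    have mu0 : mu != 0 by rewrite gt_eqF.
    have vm : v il 0 - v im 0 = mu^-1 * (v' il 0 - v' im 0).
      by rewrite -v_minus mulKf.
    have -> : v i 0 = ((v il 0 + v im 0) + (if i == il then 1 else -1) *
        (v il 0 - v im 0)) / 2.
      by move: hi => /orP[]/eqP ->; rewrite ?eqxx ?(negPf im_il); field.
    rewrite v_plus vm.
    by move: hi => /orP[]/eqP ->; rewrite ?eqxx ?(negPf im_il) ?tau_il ?(tau_im td);
      field.
  move: (hi); rewrite negb_or => /andP[i1 i2].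
  have [->|ir] := eqVneq i r.
    have hr : hyp r = false by rewrite /hyp (negPf r_im) (negPf r_il).
    by rewrite /phi (tau_r td) hr ltnn cos0 sin0 mul1r mul0r addr0 v_r.
  rewrite /phi (negPf hi).
  case: ltngtP => [lt|lt|/val_inj/esym/(tau_fix td)/eqP]; last by rewrite (negPf ir).
    by have [] := thP i; rewrite ?ir ?i1 ?i2.
  have := thP (tau i); rewrite tau_eqm tau_eql tau_eqr ir i1 i2 tK => /(_ isT)[_ <-].
  by rewrite cosN sinN mulNr.
Qed.

End TorusElement.
End TorusData.

Lemma congr_rank2 (F : comNzRingType) N (f S : 'M[F]_N) (u w : 'cV[F]_N) :
  f *m (S + u *m w^T - w *m u^T) *m f^T =
  f *m S *m f^T + ((f *m u) *m (f *m w)^T - (f *m w) *m (f *m u)^T).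
Proof. by rewrite !trmx_mul mulmxBr mulmxBl mulmxDr mulmxDl !mulmxA addrA. Qed.

(** * Fibres of the moment map *)

Section Fibre.
Variables (R : realType) (m : nat).
Local Notation mx := 'M[R]_(m + 2).
Local Notation I := 'I_(m + 2).
Local Notation J := (@Iform R m).
Local Notation SO := (@SOe R m).
Local Notation eps := (@sgJ R m).
Local Notation im := (ordm m).
Local Notation il := (ordl m).
Local Notation v0 := (@nullv R m).

Variables (t : I -> R) (tau : I -> I) (r : I).
Hypothesis td : torus_data t tau r.
Local Notation T := (hm tau (fun=> 0) t).

Let tK := tauK td.

(** One representative of each two-element orbit of [tau]; these number the pairs over which the
    Pfaffian covector is formed. *)
Definition firsts : {set I} := [set i : I | (i < tau i)%N].

Lemma im_firsts : im \in firsts.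
Proof. by rewrite inE (tau_im td) /= ltn_add2l. Qed.

Definition enc (d : option ('I_#|firsts| * bool)) : I :=
  match d with
  | None => r
  | Some (k, b) => if b then tau (enum_val k) else enum_val k
  end.

Definition dec (i : I) : option ('I_#|firsts| * bool) :=
  if i == r then None
  else if (i < tau i)%N then Some (enum_rank_in im_firsts i, false)
  else Some (enum_rank_in im_firsts (tau i), true).

Lemma firsts_neq_r (k : 'I_#|firsts|) : enum_val k == r = false.
Proof.
apply/negP => /eqP kr; have := enum_valP k.
by rewrite kr inE (tau_r td) ltnn.
Qed.

Lemma encK : cancel enc dec.
Proof.
case=> [[k []]|] /=; last by rewrite /dec eqxx.
  rewrite /dec (tau_eqr td) firsts_neq_r tK.
  have := enum_valP k; rewrite inE ltnNge => /negPf kt.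
  by rewrite ltn_neqAle kt andbF enum_valK_in.
rewrite /dec firsts_neq_r.
by have := enum_valP k; rewrite inE => ->; rewrite enum_valK_in.
Qed.

Lemma decK : cancel dec enc.
Proof.
move=> i; rewrite /dec; case: eqP => [->//|/eqP ir].
case: ltnP => ti /=; rewrite enum_rankK_in ?inE ?tK //.
rewrite ltn_neqAle ti andbT; apply: contra ir => /eqP/val_inj/(tau_fix td)/eqP.
by [].
Qed.

Lemma TJ_block i j : (T *m J) i j =
  match dec i, dec j with
  | Some (k, b), Some (k', b') =>
      if (k == k') && (b != b') then
        (if b then - (t (enum_val k) * eps (tau (enum_val k)))
         else t (enum_val k) * eps (tau (enum_val k))) else 0
  | _, _ => 0
  end.
Proof.
rewrite mulmxJ mxE mul0rn add0r -{1 2}[i]decK -{1 2}[j]decK.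
case: (dec i) => [[k b]|]; last by rewrite /= (t_r td) mul0rn mul0r.
have kE b' : tau (enc (Some (k, b'))) = enc (Some (k, ~~ b')).
  by case: b' => //=; rewrite tK.
rewrite kE (can_eq encK).
case: (dec j) => [[k' b']|]; last by rewrite mulr0n mul0r.
rewrite (inj_eq (@Some_inj _)) xpair_eqE eq_sym.
have [<-|_] := eqVneq k k'; last by rewrite mulr0n mul0r.
case: b; case: b' => //=; rewrite ?mulr0n ?mul0r // mulr1n.
have := t_tau td (enum_val k).
move=> /(congr1 (fun x => x * eps (tau (enum_val k)) * eps (enum_val k))).
rewrite -mulrA [LHS](_ : _ = t (tau (enum_val k)) * eps (enum_val k) *
   (eps (tau (enum_val k)) * eps (tau (enum_val k)))); last by ring.
rewrite eps_eps mulr1 => ->.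
rewrite [LHS](_ : _ = - (t (enum_val k) * eps (tau (enum_val k))) *
   (eps (enum_val k) * eps (enum_val k))); last by ring.
by rewrite eps_eps mulr1.
Qed.

Local Notation pf := (pfvec enc).

Lemma pf_TJ : exists2 C, C != 0 & forall v, pf (T *m J) v = C * v r 0.
Proof.
apply: (pfvec_block encK decK _ TJ_block) => k.
rewrite mulf_neq0 ?(t_neq0 td) ?firsts_neq_r // /sgJ.
by case: ifP; rewrite ?oppr_eq0 oner_eq0.
Qed.

(** A shear of determinant different from 0 takes [v0] to a basis vector. The rank two term then
    lives in the row and column of that vector, which the contraction with it ignores. *)
Lemma pf_shift (S : mx) (w : 'cV[R]_(m + 2)) :
  pf (S + v0 *m w^T - w *m v0^T) v0 = pf S v0.
Proof.
pose phi : mx := 1%:M - delta_mx im il.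
have phi_v0 : phi *m v0 = delta_mx il 0.
  rewrite /phi mulmxBl mul1mx /nullv mulmxDr mul_delta_mx.
  rewrite mul_delta_mx_0 1?eq_sym ?im_il //.
  by rewrite add0r addrAC subrr add0r.
have dphi : \det phi != 0.
  have : phi *m (1%:M + delta_mx im il) = 1%:M.
    rewrite /phi mulmxDr mulmx1 mulmxBl mul1mx mul_delta_mx_0 1?eq_sym ?im_il //.
    by rewrite subr0 subrK.
  by move/mulmx1_unit => [+ _]; rewrite unitmxE unitfE.
have := congr_rank2 phi S v0 w; rewrite phi_v0 => E.
apply: (mulfI dphi); rewrite -!(pfvec_mul encK decK) phi_v0 E.
apply: (pfvec_eq_off encK) => i j /negPf il' /negPf jl'.
rewrite mxE [X in _ + X]mxE [X in _ + (X + _)]mxE [X in _ + (_ + X)]mxE.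
rewrite [X in _ + (_ - X)]mxE !big_ord1 [delta_mx il 0 i 0]mxE il' mul0r.
by rewrite [(delta_mx il 0)^T 0 j]mxE [delta_mx il 0 j 0]mxE jl' mulr0 subr0 addr0.
Qed.

Section Transitive.
Variables (g1 g2 : mx) (w : 'cV[R]_(m + 2)).
Hypotheses (Sg1 : SO g1) (Sg2 : SO g2).
Local Notation Y1 := (g1 *m T *m Linv g1).
Local Notation Y2 := (g2 *m T *m Linv g2).
Hypothesis wv0 : w^T *m J *m v0 = 0.
Hypothesis Y12 : Y2 = Y1 + (v0 *m w^T - w *m v0^T) *m J.

Let v := Linv g1 *m v0.
Let v' := Linv g2 *m v0.

Lemma LinvJ (g : mx) : Linv g *m J = J *m g^T.
Proof. by rewrite LinvE -mulmxA JJ mulmx1. Qed.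

(** [Linv g *m J = J *m g^T] turns conjugation of T into congruence of [T *m J], and [g] has
    determinant 1. *)
Lemma pf_conj (g : mx) : SO g ->
  pf (g *m T *m Linv g *m J) v0 = pf (T *m J) (Linv g *m v0).
Proof.
move=> Sg; have Og := SO_O Sg.
rewrite -mulmxA LinvJ mulmxA -(mulmxA g).
rewrite -{1}[v0]mul1mx -(mulOV Og) -(mulmxA g (Linv g)).
by rewrite (pfvec_mul encK decK) SO_det // mul1r.
Qed.

Lemma v_r_eq : v r 0 = v' r 0.
Proof.
have [C C0 CE] := pf_TJ.
apply: (mulfI C0); rewrite -!CE -!pf_conj // Y12 mulmxDl -[_ *m J *m J]mulmxA JJ.
by rewrite mulmx1 addrA pf_shift.
Qed.

Lemma v0J_tr (g : mx) : v0^T *m J *m g = (Linv g *m v0)^T *m J.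
Proof.
by rewrite LinvE !trmx_mul trmxK trJ !mulmxA -[RHS]mulmxA -!mulmxA JJ mulmx1.
Qed.

Lemma resolvent_conj (g : mx) x : SO g -> t im < x ->
  [/\ x%:M - g *m T *m Linv g \in unitmx,
      \det (x%:M - g *m T *m Linv g) = \det (x%:M - T) &
      v0^T *m J *m invmx (x%:M - g *m T *m Linv g) *m v0 =
      (Linv g *m v0)^T *m J *m invmx (x%:M - T) *m (Linv g *m v0)].
Proof.
move=> Sg cx; have Og := SO_O Sg.
have E : x%:M - g *m T *m Linv g = g *m (x%:M - T) *m Linv g.
  by rewrite mulmxBr mulmxBl scalar_mxC -(mulmxA x%:M) mulOV // mulmx1.
have u := resolvent_unit td cx.
have EV : (x%:M - g *m T *m Linv g) *m (g *m invmx (x%:M - T) *m Linv g) = 1%:M.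
  rewrite E !mulmxA -(mulmxA _ (Linv g) g) mulVO // mulmx1.
  by rewrite -(mulmxA g (_ - _)) mulmxV // mulmx1 mulOV.
have [uY _] := mulmx1_unit EV.
split => //.
  by rewrite E !det_mulmx (SO_det Sg) (SO_det (SOV Sg)) mul1r mulr1.
have -> : invmx (x%:M - g *m T *m Linv g) = g *m invmx (x%:M - T) *m Linv g.
  by apply: (can_inj (mulKmx uY)); rewrite mulmxV.
by rewrite !mulmxA v0J_tr.
Qed.

Lemma resolvent_eq x : t im < x ->
  (v^T *m J *m invmx (x%:M - T) *m v) 0 0 =
  (v'^T *m J *m invmx (x%:M - T) *m v') 0 0.
Proof.
move=> cx; have [u1 d1 <-] := resolvent_conj Sg1 cx.
have [u2 d2 <-] := resolvent_conj Sg2 cx.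
congr (fun_of_matrix _ 0 0); apply: esym.
(* [x - Y2] is [x - Y1] minus [v0 w^T J] plus [w v0^T J]: one term contains the border column [v0],
   the other the border row [v0^T J]. *)
apply: (@resolvent_shift _ _ _ _ _ w _ (- (w^T *m J))) => //; first by rewrite d1.
rewrite Y12 mulmxBl !mulmxA mulmxN opprD opprB !addrA.
by rewrite mulmxA addrAC.
Qed.

Lemma null_v0 : v0^T *m J *m v0 = 0.
Proof.
apply/matrixP => i j; rewrite !ord1 mxE big_split_l !mulmxJ ![v0^T _ _]mxE !v0E.
rewrite !eqxx (negPf (im_il m)) eq_sym (negPf (im_il m)) eps_im eps_il big1 => [|k _].
  by rewrite mxE; ring.
by rewrite mulmxJ mxE !v0E /ordm /ordl !eq_lrshift addr0 !mul0r.
Qed.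

Lemma null_v (g : mx) : SO g ->
  \sum_(i < m) (Linv g *m v0) (lshift 2 i) 0 ^+ 2 + (Linv g *m v0) im 0 ^+ 2 =
  (Linv g *m v0) il 0 ^+ 2.
Proof.
move=> Sg; have Og := OV (SO_O Sg); set u := _ *m v0.
have : (u^T *m J *m u) 0 0 = 0.
  rewrite /u trmx_mul !mulmxA -(mulmxA v0^T) -(mulmxA v0^T) O_trmx //.
  by rewrite null_v0 mxE.
rewrite mxE big_split_l !mulmxJ ![u^T _ _]mxE eps_im eps_il.
under eq_bigr => i _ do rewrite mulmxJ mxE eps_lshift mulr1 -expr2.
by move=> E; apply/eqP; rewrite -subr_eq0 -[X in _ == X]E; apply/eqP; ring.
Qed.

(** The identity component keeps [v0] on the future light cone, since the last row of a matrix in it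
    has its [im] entry smaller than its last one. *)
Lemma v_il_gt0 (g : mx) : SO g -> 0 < (Linv g *m v0) il 0.
Proof.
move=> Sg; have := SO_lm_lt (SOV Sg).
rewrite /nullv mulmxDr mxE -!colE !mxE ltr_norml => /andP[H _].
by rewrite -ltrBlDr sub0r.
Qed.

Lemma Y_v0 : Y2 *m v0 = Y1 *m v0.
Proof.
rewrite Y12 mulmxDl -[RHS]addr0; congr (_ + _).
by rewrite !mulmxBl -!mulmxA (mulmxA w^T) wv0 (mulmxA v0^T) null_v0 !mulmx0 subr0.
Qed.

Lemma tau_lshift (i : 'I_m) : exists j : 'I_m, tau (lshift 2 i) = lshift 2 j.
Proof.
have i1 : lshift 2 i != im by rewrite /ordm eq_lrshift.
have i2 : lshift 2 i != il by rewrite /ordl eq_lrshift.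
have := tau_eqm td (lshift 2 i); have := tau_eql td (lshift 2 i).
rewrite (negPf i1) (negPf i2); case: (split_ordP (tau (lshift 2 i))) => k -> k1 k2.
  by exists k.
by move: k1 k2; case: k => -[|[|//]] p; rewrite /ordl /ordm !eq_rshift.
Qed.

(** Isotropy kills every component outside the hyperbolic plane, so [Linv g *m v0] lies on one of
    its two isotropic lines, the eigenlines of T for [c] and [-c]. *)
Lemma degenerate_T (g : mx) (s : R) : SO g -> s ^+ 2 = 1 ->
  (Linv g *m v0) im 0 = s * (Linv g *m v0) il 0 ->
  g *m T *m Linv g *m v0 = (s * t im) *: v0.
Proof.
move=> Sg s2; have Og := SO_O Sg; set u := Linv g *m v0 => us.
have u0 (i : 'I_m) : u (lshift 2 i) 0 = 0.
  have := null_v Sg; rewrite -/u us exprMn s2 mul1r -[X in _ = X]add0r => /addIr.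
  move/eqP; rewrite psumr_eq0 => [|k _]; last exact: sqr_ge0.
  by move/allP/(_ i); rewrite mem_index_enum sqrf_eq0 => /(_ isT)/eqP.
suff Tu : T *m u = (s * t im) *: u.
  rewrite -!mulmxA -/u Tu -scalemxAr /u mulmxA mulOV // mul1mx.
  by [].
apply/colP => i; rewrite hm_col // mul0r add0r [RHS]mxE.
case: (split_ordP i) => k ->.
  by have [j ->] := tau_lshift k; rewrite !u0 !mulr0.
have [->|->] : rshift m k = im \/ rshift m k = il.
- by case: k => -[|[|//]] p; [left|right]; apply/val_inj.
- rewrite (tau_im td) us [RHS](_ : _ = s ^+ 2 * (t im * u il 0)); last by ring.
  by rewrite s2 mul1r.
by rewrite (tau_il td) (t_il td) us; ring.
Qed.

(** The resolvent gives the product of [v_l + v_m] and [v_l - v_m]. If it is nonzero, both factors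
    are positive and [mu] is a ratio. If it is zero, [v] and [v'] must lie on the same isotropic ray
    for a boost to relate them. *)
Lemma boost_factor : exists mu, [/\ 0 < mu,
  v il 0 + v im 0 = mu * (v' il 0 + v' im 0) &
  mu * (v il 0 - v im 0) = v' il 0 - v' im 0].
Proof.
have vl := v_il_gt0 Sg1; have vl' := v_il_gt0 Sg2.
have N := null_v Sg1; have N' := null_v Sg2.
have E : v il 0 ^+ 2 - v im 0 ^+ 2 = v' il 0 ^+ 2 - v' im 0 ^+ 2.
  have := resolvent_inj td resolvent_eq im.
  rewrite eq_sym (negPf (r_im td)) (tau_im td) eps_im eps_il !mul1r !mulN1r => H.
  by rewrite -opprB H opprB.
rewrite -/v -/v' in vl vl' N N'.
have le_v : v im 0 ^+ 2 <= v il 0 ^+ 2.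
  by rewrite -N lerDr sumr_ge0 // => i _; exact: sqr_ge0.
have [lt_v|eq_v] : v im 0 ^+ 2 < v il 0 ^+ 2 \/ v im 0 ^+ 2 = v il 0 ^+ 2.
- by move: le_v; rewrite le_eqVlt => /orP[/eqP ?|?]; [right|left].
- have lt_v' : v' im 0 ^+ 2 < v' il 0 ^+ 2 by rewrite -subr_gt0 -E subr_gt0.
  have pos (x y : R) : 0 < y -> x ^+ 2 < y ^+ 2 -> 0 < y + x /\ 0 < y - x.
    move=> y0; rewrite -real_normK ?num_real // ltr_sqr ?nnegrE ?normr_ge0 ?ltW //.
    by rewrite ltr_norml => /andP[? ?]; split; lra.
  have [p1 p2] := pos _ _ vl lt_v; have [p1' p2'] := pos _ _ vl' lt_v'.
  exists ((v il 0 + v im 0) / (v' il 0 + v' im 0)); split.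
  + exact: divr_gt0.
  + by rewrite mulfVK // gt_eqF.
  + rewrite mulrAC; apply: (mulIf (lt0r_neq0 p1')).
    by rewrite mulfVK ?gt_eqF //; move: E; rewrite !subr_sqr mulrC => ->; rewrite mulrC.
have eq_v' : v' im 0 ^+ 2 = v' il 0 ^+ 2.
  by apply/eqP; rewrite eq_sym -subr_eq0 -E eq_v subrr.
have sgn (x y : R) : x ^+ 2 = y ^+ 2 -> exists2 s, s ^+ 2 = 1 & x = s * y.
  move/eqP; rewrite eqf_sqr => /orP[]/eqP ->.
    by exists 1; rewrite ?expr1n ?mul1r.
  by exists (-1); rewrite ?sqrrN ?expr1n ?mulN1r.
have [s s2 us] := sgn _ _ eq_v; have [s' s2' us'] := sgn _ _ eq_v'.
(* [Y1] and [Y2] agree on [v0], as [w] is orthogonal to it, so the eigenvalues [s c] and [s' c]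
   coincide. *)
have ss' : s = s'.
  have := Y_v0; rewrite (degenerate_T Sg1 s2 us) (degenerate_T Sg2 s2' us').
  move/colP/(_ im); rewrite !mxE !andbT eqxx (negPf (im_il m)) addr0 !mulr1.
  by move/(mulIf (lt0r_neq0 (t_im_gt0 td))).
subst s'; rewrite us us'.
move/eqP: s2; rewrite sqrf_eq1 => /orP[]/eqP ->.
  exists (v il 0 / v' il 0); rewrite !mul1r !subrr mulr0; split => //.
    exact: divr_gt0.
  by rewrite mulrDr mulfVK ?gt_eqF.
exists (v' il 0 / v il 0); rewrite !mulN1r !subrr !opprK mulr0; split => //.
  exact: divr_gt0.
by rewrite mulrDr mulfVK ?gt_eqF.
Qed.

Lemma transporter : exists p : mx,
  [/\ SO p, p *m v0 = v0 & p *m Y1 *m Linv p = Y2].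
Proof.
have [mu [mu0 vp vm]] := boost_factor.
have [i ir i1 i2|h [Sh hT hv]] := torus_element td v_r_eq _ mu0 vp vm.
  have := resolvent_inj td resolvent_eq i.
  by rewrite (negPf ir) !eps_other ?(tau_eql td) // !mul1r.
have Oh := SO_O Sh; have O1 := SO_O Sg1; have O2 := SO_O Sg2.
have ShV := SOV Sh.
exists (g2 *m Linv h *m Linv g1); split.
- by apply: SOM; [exact: SOM|exact: SOV].
- rewrite -!mulmxA -/v -hv (mulmxA (Linv h)) mulVO // mul1mx.
  by rewrite /v' mulmxA mulOV // mul1mx.
have -> : g2 *m Linv h *m Linv g1 *m Y1 = g2 *m (Linv h *m T) *m Linv g1.
  by rewrite !mulmxA -(mulmxA _ (Linv g1) g1) mulVO // mulmx1.
have -> : Linv h *m T = T *m Linv h.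
  have := congr1 (fun M => Linv h *m M *m Linv h) hT.
  rewrite !mulmxA mulVO // mul1mx -!mulmxA mulOV // mulmx1.
  by move=> ->.
rewrite !LinvM !LinvK !mulmxA -(mulmxA _ (Linv g1) g1) mulVO // mulmx1.
by rewrite -(mulmxA _ (Linv h) h) mulVO // mulmx1.
Qed.

End Transitive.
End Fibre.

(** * The minimal parabolic subgroup *)

Section Parabolic.
Variables (R : realType) (m : nat).
Local Notation mx := 'M[R]_(m + 2).
Local Notation J := (@Iform R m).
Local Notation SO := (@SOe R m).
Local Notation eps := (@sgJ R m).
Local Notation im := (ordm m).
Local Notation il := (ordl m).
Local Notation v0 := (@nullv R m).
Local Notation H0 := (@H0 R m).

Lemma ord_split (i : 'I_(m + 2)) :
  [\/ exists k : 'I_m, i = lshift 2 k, i = im | i = il].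
Proof.
case: (split_ordP i) => k ->; first by apply: Or31; exists k.
by case: k => -[|[|//]] p; [apply: Or32|apply: Or33]; apply/val_inj.
Qed.

Lemma eq_li (i : 'I_m) : (lshift 2 i == im = false) * (lshift 2 i == il = false) *
  (im == lshift 2 i = false) * (il == lshift 2 i = false).
Proof. by rewrite ![_ == lshift 2 i]eq_sym /ordm /ordl !eq_lrshift. Qed.

Lemma eq_ml : (im == il = false) * (il == im = false).
Proof. by rewrite [il == _]eq_sym (negPf (im_il m)). Qed.

Definition emb (alpha : 'rV[R]_m) : 'cV[R]_(m + 2) := col_mx alpha^T 0.

Lemma embE alpha :
  ((forall i, emb alpha (lshift 2 i) 0 = alpha 0 i) *
   (emb alpha im 0 = 0) * (emb alpha il 0 = 0))%type.
Proof.
split; first split.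
- by move=> i; rewrite /emb col_mxEu mxE.
- by rewrite /emb col_mxEd mxE.
- by rewrite /emb col_mxEd mxE.
Qed.

Lemma v0_entries :
  ((forall i, v0 (lshift 2 i) 0 = 0) * (v0 im 0 = 1) * (v0 il 0 = 1))%type.
Proof.
by split; first split; rewrite ?v0E => *; rewrite ?v0E ?eq_li ?eq_ml ?eqxx ?addr0 ?add0r.
Qed.

Lemma outerE N (v w : 'cV[R]_N) i j : (v *m w^T) i j = v i 0 * w j 0.
Proof. by rewrite mxE big_ord1 mxE. Qed.

Lemma Xn_entries alpha i j : (@Xn R m alpha) i j =
  ((v0 *m (emb alpha)^T - emb alpha *m v0^T) *m J) i j.
Proof.
rewrite [RHS]mulmxJ [in RHS]mxE [X in _ + X]mxE !outerE.
have [[k ->]|->|->] := ord_split i; have [[l ->]|->|->] := ord_split j;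
  rewrite ?embE ?v0_entries ?eps_lshift ?eps_im ?eps_il /Xn.
- by rewrite block_mxEul mxE; ring.
- rewrite block_mxEur (_ : 0 = lshift 1 0 :> 'I_(1 + 1)); last exact/val_inj.
  by rewrite [LHS](@row_mxEl _ m 1 1) !mxE; ring.
- rewrite block_mxEur (_ : 1 = rshift 1 0 :> 'I_(1 + 1)); last exact/val_inj.
  by rewrite [LHS](@row_mxEr _ m 1 1) !mxE; ring.
- rewrite block_mxEdl (_ : 0 = lshift 1 0 :> 'I_(1 + 1)); last exact/val_inj.
  by rewrite [LHS](@col_mxEu _ 1 1 m); ring.
- by rewrite block_mxEdr mxE; ring.
- by rewrite block_mxEdr mxE; ring.
- rewrite block_mxEdl (_ : 1 = rshift 1 0 :> 'I_(1 + 1)); last exact/val_inj.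
  by rewrite [LHS](@col_mxEd _ 1 1 m); ring.
- by rewrite block_mxEdr mxE; ring.
- by rewrite block_mxEdr mxE; ring.
Qed.

(** As a bivector, [Xn alpha] is [v0 /\ alpha]: this links the block matrices of n to the rank two
    changes studied above. *)
Lemma XnE alpha : @Xn R m alpha = (v0 *m (emb alpha)^T - emb alpha *m v0^T) *m J.
Proof. by apply/matrixP => i j; exact: Xn_entries. Qed.

Lemma emb_v0 alpha : (emb alpha)^T *m J *m v0 = 0.
Proof.
apply/matrixP => i j; rewrite !ord1 mxE big_split_l !mulmxJ ![(emb _)^T _ _]mxE.
rewrite !embE !mul0r !addr0 big1 ?mxE // => k _.
by rewrite v0_entries mulr0.
Qed.

Lemma v0_emb alpha : v0^T *m J *m emb alpha = 0.
Proof.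
by rewrite -[RHS]trmx0 -(emb_v0 alpha) !trmx_mul !trmxK trJ mulmxA.
Qed.

Lemma Xn_v0 alpha : @Xn R m alpha *m v0 = 0.
Proof.
rewrite XnE -!mulmxA mulmxBl -!mulmxA (mulmxA (emb _)^T) emb_v0 (mulmxA v0^T).
by rewrite null_v0 !mulmx0 subr0.
Qed.

Lemma Xn2 alpha : @Xn R m alpha *m Xn alpha =
  - (((emb alpha)^T *m J *m emb alpha) 0 0 *: (v0 *m v0^T *m J)).
Proof.
rewrite {2}XnE !mulmxA mulmxBr !mulmxA Xn_v0 !mul0mx sub0r mulNmx; congr (- _).
have -> : Xn alpha *m emb alpha = v0 *m ((emb alpha)^T *m J *m emb alpha).
  by rewrite XnE -!mulmxA mulmxBl -!mulmxA (mulmxA v0^T) v0_emb mulmx0 subr0.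
by rewrite [X in v0 *m X]mx11_scalar mul_mx_scalar -!scalemxAl.
Qed.

Lemma Xn3 alpha : @Xn R m alpha *m (Xn alpha *m Xn alpha) = 0.
Proof. by rewrite Xn2 mulmxN -scalemxAr !mulmxA Xn_v0 !mul0mx scaler0 oppr0. Qed.

Lemma Linv_lin (a b : R) (A B : mx) : Linv (a *: A + b *: B) = a *: Linv A + b *: Linv B.
Proof.
by rewrite !LinvE linearD !linearZ /= mulmxDr mulmxDl -!scalemxAr -!scalemxAl.
Qed.

Lemma Linv_so (A : mx) : A *m J + J *m A^T = 0 -> Linv A = - A.
Proof.
rewrite addrC => /eqP; rewrite addr_eq0 => /eqP E.
by rewrite LinvE E mulNmx -mulmxA JJ mulmx1.
Qed.

Lemma Xn_so alpha : @Xn R m alpha *m J + J *m (Xn alpha)^T = 0.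
Proof.
rewrite XnE -mulmxA JJ mulmx1 !trmx_mul trJ mulmxA JJ mul1mx raddfB /=.
by rewrite !trmx_mul !trmxK addrA subrK subrr.
Qed.

(** The exponential of [Xn alpha], a polynomial because the cube vanishes. *)
Definition Nmx alpha : mx := 1%:M + Xn alpha + 2^-1 *: (Xn alpha *m Xn alpha).

Lemma NmxVl alpha : Nmx alpha *m Nmx (- alpha) = 1%:M.
Proof.
have -> : Nmx (- alpha) = 1%:M - Xn alpha + 2^-1 *: (Xn alpha *m Xn alpha).
  by rewrite /Nmx linearN mulmxN mulNmx opprK.
rewrite /Nmx; set X := Xn alpha; set Y := X *m X.
have XY : X *m Y = 0 by exact: Xn3.
have YX : Y *m X = 0 by rewrite /Y -mulmxA Xn3.
have YY : Y *m Y = 0 by rewrite {1}/Y -mulmxA XY mulmx0.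
rewrite !(mulmxDl, mulmxDr) !mulmxN !mul1mx !mulmx1 -!scalemxAl -!scalemxAr.
rewrite -/Y XY YX YY !scaler0 oppr0 !addr0.
clear XY YX YY; clearbody Y; clearbody X; apply/matrixP => i j; rewrite !mxE; by field.
Qed.

Lemma Linv_Nmx alpha : Linv (Nmx alpha) = Nmx (- alpha).
Proof.
have -> : Nmx alpha = 1 *: (1 *: 1%:M + 1 *: Xn alpha) +
    2^-1 *: (Xn alpha *m Xn alpha) by rewrite !scale1r.
rewrite !Linv_lin Linv1 LinvM Linv_so; last exact: Xn_so.
have XN : Xn (- alpha) = - Xn alpha by exact: linearN.
by rewrite !scale1r /Nmx XN.
Qed.

Lemma Nmx_SO alpha : SO (Nmx alpha).
Proof.
rewrite -[alpha]scale1r.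
apply: (@path_SO _ _ (fun t => Nmx (t *: alpha))) => [|t|].
- rewrite (_ : (fun _ => _) =
    fun t => 1%:M + t *: Xn alpha + (2^-1 * (t * t)) *: (Xn alpha *m Xn alpha)).
    move=> t; apply: cvgD; first apply: cvgD.
    + exact: cvg_cst.
    + by apply: cvgZr_tmp; exact: cvg_id.
    + by apply: cvgZr_tmp; apply: cvgMl_tmp; apply: cvgM; exact: cvg_id.
  apply/funext => t; rewrite /Nmx linearZ /= -scalemxAl -scalemxAr !scalerA.
  by rewrite mulrA.
- by apply/OP; rewrite Linv_Nmx NmxVl.
- by rewrite /Nmx scale0r linear0 mul0mx scaler0 !addr0.
Qed.

Lemma Nmx_v0 alpha : Nmx alpha *m v0 = v0.
Proof.
by rewrite /Nmx !mulmxDl mul1mx -scalemxAl -mulmxA Xn_v0 mulmx0 scaler0 !addr0.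
Qed.

Lemma mexp_Xn alpha : mexp (@Xn R m alpha) = Nmx alpha.
Proof.
apply: lim_near_cst; first exact: norm_hausdorff.
exists 3 => // n /= n3; rewrite /series /=.
rewrite (@big_cat_nat _ _ _ 3) //= [X in _ + X]big1_seq ?addr0.
  rewrite !big_nat_recr //= big_geq // add0r.
  by rewrite fact0 invr1 !scale1r expr0 expr1 expr2.
move=> i /andP[_]; rewrite mem_index_iota => /andP[i3 _].
rewrite -(subnKC i3) exprD !exprS expr0 mulr1.
by rewrite (_ : _ * (_ * _) = 0) ?mul0r ?scaler0 //; exact: Xn3.
Qed.

Lemma H0E : H0 = delta_mx im il + delta_mx il im.
Proof.
by apply/matrixP => i j; rewrite !mxE -!val_eqE /= addn0 addn1.
Qed.

Lemma H02 : H0 *m H0 = delta_mx im im + delta_mx il il.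
Proof.
rewrite H0E mulmxDl !mulmxDr !mul_delta_mx !mul_delta_mx_0 ?eq_ml //.
by rewrite add0r addr0.
Qed.

Lemma H03 : H0 *m H0 *m H0 = H0.
Proof.
rewrite H02 H0E mulmxDl !mulmxDr !mul_delta_mx !mul_delta_mx_0 ?eq_ml ?im_il //.
by rewrite addr0 add0r.
Qed.

Lemma H0_v0 : H0 *m v0 = v0.
Proof.
rewrite H0E /nullv mulmxDl !mulmxDr !mul_delta_mx !mul_delta_mx_0 ?eq_ml ?im_il //.
by rewrite addr0 add0r addrC.
Qed.

Lemma mexp_H0_v0 (t : R) : mexp (t *: H0) *m v0 = expR t *: v0.
Proof.
(* [P], [Q] and the later [S] are the spectral projections of [H0] for 1, -1 and 0, which makes
   every power of [t *: H0] explicit. *)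
pose P := 2^-1 *: (H0 *m H0 + H0); pose Q := 2^-1 *: (H0 *m H0 - H0).
have HP : H0 *m P = P.
  by rewrite /P -scalemxAr mulmxDr mulmxA H03 addrC.
have HQ : H0 *m Q = - Q.
  by rewrite /Q -scalemxAr mulmxBr mulmxA H03 -scalerN opprB.
have PQ : P + Q = H0 *m H0.
  rewrite /P /Q; move: (H0 *m H0) H0 => E H; apply/matrixP => a b; rewrite !mxE.
  by field.
have Pv : P *m v0 = v0.
  rewrite /P -scalemxAl mulmxDl -mulmxA !H0_v0.
  have -> : v0 + v0 = 2 *: v0 by rewrite scaler_nat mulr2n.
  by rewrite scalerA mulVf ?scale1r.
have Qv : Q *m v0 = 0.
  by rewrite /Q -scalemxAl mulmxBl -mulmxA !H0_v0 subrr scaler0.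
pose S : mx := 1%:M - H0 *m H0.
have HS : H0 *m S = 0 by rewrite /S mulmxBr mulmx1 mulmxA H03 subrr.
have PQS : P + Q + S = 1%:M by rewrite PQ addrC subrK.
have Sv : S *m v0 = 0 by rewrite /S mulmxBl mul1mx -mulmxA !H0_v0 subrr.
clearbody P Q S; clear PQ.
have pw i : (t *: H0) ^+ i = t ^+ i *: P + (- t) ^+ i *: Q +
    (i == 0)%:R *: S.
  elim: i => [|i IHi]; first by rewrite !expr0 !scale1r PQS.
  rewrite exprS -[LHS]/((t *: H0) *m (t *: H0) ^+ i) IHi -scalemxAl !mulmxDr.
  rewrite -!scalemxAr HP HQ HS.
  rewrite scaler0 addr0 scale0r addr0.
  by rewrite scalerDr !scalerA -exprS scalerN -scaleNr -mulNr -exprS.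
have -> : mexp (t *: H0) = expR t *: P + expR (- t) *: Q + S.
  apply: cvg_lim; first exact: norm_hausdorff.
  rewrite (_ : series _ = fun n => series (exp_coeff t) n *: P +
     series (exp_coeff (- t)) n *: Q +
     (\sum_(0 <= i < n) (i == 0)%:R) *: S); last first.
    apply/funext => n; rewrite /series /= !scaler_suml -!big_split.
    apply: eq_bigr => i _ /=; rewrite pw !scalerDr !scalerA /exp_coeff /=.
    rewrite ![_^-1 * _]mulrC; congr (_ + _ *: _).
    by case: i => [|i]; rewrite ?mul0r // fact0 invr1 mulr1.
  apply: cvgD; first apply: cvgD.
  - by apply: cvgZr_tmp; exact: is_cvg_series_exp_coeff.
  - by apply: cvgZr_tmp; exact: is_cvg_series_exp_coeff.
  - rewrite -[X in _ --> X]scale1r; apply: cvgZr_tmp; apply: cvg_near_cst.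
    exists 1%N => // n /= n0; rewrite big_ltn // big1_seq ?addr0 //.
    by move=> i; rewrite mem_index_iota => /andP[_ /andP[i0 _]]; case: i i0.
rewrite !mulmxDl -!scalemxAl Pv Qv Sv.
by rewrite scaler0 !addr0.
Qed.

End Parabolic.

(** * P and its Lie algebra through the isotropic line *)

Section ParabolicSubgroup.
Variables (R : realType) (m : nat).
Local Notation mx := 'M[R]_(m + 2).
Local Notation J := (@Iform R m).
Local Notation SO := (@SOe R m).
Local Notation eps := (@sgJ R m).
Local Notation im := (ordm m).
Local Notation il := (ordl m).
Local Notation v0 := (@nullv R m).
Local Notation H0 := (@H0 R m).
Local Notation ei i := (lshift 2 i).

Definition Kmx (k : 'M[R]_m) : mx := block_mx k 0 0 (1%:M : 'M[R]_2).

Lemma KmxE k : ((forall i j, Kmx k (ei i) (ei j) = k i j) *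
  (forall i, Kmx k (ei i) im = 0) * (forall i, Kmx k (ei i) il = 0) *
  (forall i, Kmx k im (ei i) = 0) * (forall i, Kmx k il (ei i) = 0) *
  (Kmx k im im = 1) * (Kmx k im il = 0) * (Kmx k il im = 0) * (Kmx k il il = 1))%type.
Proof.
rewrite /Kmx /ordm /ordl; do ![split] => *.
all: by rewrite ?(block_mxEul, block_mxEur, block_mxEdl, block_mxEdr) ?mxE.
Qed.

Lemma Kmx_v0 k : Kmx k *m v0 = v0.
Proof.
apply/colP => i; rewrite mxE big_split_l !v0_entries !mulr1 big1 => [|j _]; last first.
  by rewrite v0_entries mulr0.
by have [[j ->]|->|->] := ord_split i; rewrite !KmxE !v0_entries ?addr0 ?add0r.
Qed.

Lemma Linv_entry (g : mx) i j : Linv g i j = eps i * g j i * eps j.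
Proof. by rewrite LinvE mulmxJ mulJmx mxE. Qed.

Lemma Kmx_O k : k *m k^T = 1%:M -> @Opq R m (Kmx k).
Proof.
move=> kk; apply/OP.
have -> : Linv (Kmx k) = Kmx k^T.
  apply/matrixP => i j; rewrite Linv_entry.
  have [[a ->]|->|->] := ord_split i; have [[b ->]|->|->] := ord_split j;
    rewrite !KmxE ?eps_lshift ?eps_im ?eps_il ?mulr0 ?mul0r ?mulr1 ?mul1r //.
    by rewrite mxE.
  by rewrite mulrNN mulr1.
by rewrite /Kmx mulmx_block !mulmx0 !mul0mx !addr0 !add0r mulmx1 kk scalar_mx_block.
Qed.

Lemma col_ei (A : mx) i j : (A *m delta_mx j 0 : 'cV_(m + 2)) i 0 = A i j.
Proof. by rewrite -colE mxE. Qed.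

(** On the hyperbolic plane orthogonal to all [ei i], an isometry that fixes an isotropic vector is
    the identity. *)
Lemma O_unipotent_id (q : mx) : @Opq R m q -> q *m v0 = v0 ->
  (forall i : 'I_m, q *m delta_mx (ei i) 0 = delta_mx (ei i) 0 :> 'cV[R]_(m + 2)) ->
  q = 1%:M.
Proof.
move=> Oq qv qe.
have inv_fix (v : 'cV[R]_(m + 2)) : q *m v = v -> Linv q *m v = v.
  by move=> E; rewrite -{1}E mulmxA mulVO // mul1mx.
have qi i j : q i (ei j) = (i == ei j)%:R.
  by rewrite -(col_ei q) qe mxE andbT.
have iq i j : q (ei i) j = (ei i == j)%:R.
  have := congr1 (fun M : 'cV_(m + 2) => M j 0) (inv_fix _ (qe i)).
  rewrite col_ei Linv_entry eps_lshift mulr1 mxE andbT eq_sym => E.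
  rewrite -[q _ _]mul1r -(eps_eps R j) -mulrA E.
  case: eqP => [<-|_]; last by rewrite mulr0.
  by rewrite eps_lshift mulr1.
have c1 : q im im + q im il = 1.
  have := congr1 (fun M : 'cV_(m + 2) => M im 0) qv.
  by rewrite /nullv mulmxDr mxE !col_ei -/v0 v0_entries.
have c2 : q il im + q il il = 1.
  have := congr1 (fun M : 'cV_(m + 2) => M il 0) qv.
  by rewrite /nullv mulmxDr mxE !col_ei -/v0 v0_entries.
have r1 : q im im - q il im = 1.
  have := congr1 (fun M : 'cV_(m + 2) => M im 0) (inv_fix _ qv).
  rewrite /nullv mulmxDr mxE !col_ei -/v0 v0_entries !Linv_entry eps_im eps_il.
  by rewrite mul1r mulr1 mulrN1 mul1r.
have r2 : q im il - q il il = -1.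
  have := congr1 (fun M : 'cV_(m + 2) => M il 0) (inv_fix _ qv).
  rewrite /nullv mulmxDr mxE !col_ei -/v0 v0_entries !Linv_entry eps_im eps_il.
  by rewrite mulN1r mulr1 mulrN1 mulN1r opprK => E; lra.
have n1 : q im im ^+ 2 - q im il ^+ 2 = 1.
  have /matrixP/(_ im im) := Oq; rewrite mxE big_split_l !mulmxJ.
  rewrite [J im im](_ : _ = 1); last first.
    by rewrite IformE !mxE eqxx eps_im.
  rewrite big1 => [|j _]; last by rewrite mulmxJ mxE qi !eq_li mulr0n !mul0r.
  by rewrite !mxE eps_im eps_il => E; lra.
have x0 : q im il = 0.
  move: n1; rewrite (_ : q im im = 1 - q im il); last by lra.
  by move=> n1; lra.
apply/matrixP => i j; rewrite [RHS]mxE.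
have [[a ->]|->|->] := ord_split i; first by rewrite iq.
  by have [[b ->]|->|->] := ord_split j; rewrite ?qi // ?eq_ml ?eqxx //=; lra.
by have [[b ->]|->|->] := ord_split j; rewrite ?qi // ?eq_ml ?eqxx //=; lra.
Qed.

Lemma Xn_ei alpha (i : 'I_m) :
  Xn alpha *m delta_mx (ei i) 0 = alpha 0 i *: v0 :> 'cV[R]_(m + 2).
Proof.
apply/colP => j; rewrite col_ei Xn_entries mulmxJ mxE [X in _ + X]mxE !outerE.
by rewrite eps_lshift embE v0_entries [RHS]mxE; ring.
Qed.

Lemma Nmx_ei alpha (i : 'I_m) :
  Nmx alpha *m delta_mx (ei i) 0 = delta_mx (ei i) 0 + alpha 0 i *: v0 :> 'cV[R]_(m + 2).
Proof.
rewrite /Nmx !mulmxDl mul1mx -scalemxAl -mulmxA !Xn_ei -scalemxAr Xn_v0.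
by rewrite !scaler0 addr0.
Qed.

(** The stabiliser of [v0] itself is MN: [k] is the Euclidean block of [p] and [alpha] its row [im].
    The factorisation is then checked on [v0] and the [ei i] only. *)
Lemma parabolic_decomp (p : mx) : SO p -> p *m v0 = v0 ->
  exists (k : 'M[R]_m) (alpha : 'rV[R]_m),
    [/\ k *m k^T = 1%:M, \det k = 1 & p = Kmx k *m Nmx alpha].
Proof.
move=> Sp pv; have Op := SO_O Sp.
have pml (i : 'I_m) : p il (ei i) = p im (ei i).
  (* Fixing [v0] also fixes the covector [v0^T J], so the rows [im] and [il] agree on the Euclidean
     coordinates. *)
  have E : v0^T *m J *m p = v0^T *m J.
    rewrite v0J_tr; congr (_^T *m _).
    by rewrite -{1}pv mulmxA mulVO // mul1mx.
  have /matrixP/(_ 0 (ei i)) := E.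
  rewrite mulmxJ [v0^T _ _]mxE v0_entries mul0r mxE big_split_l !mulmxJ ![v0^T _ _]mxE.
  rewrite !v0_entries eps_im eps_il big1 => [|j _].
    by rewrite !mul1r mulN1r add0r => /subr0_eq.
  by rewrite mulmxJ mxE v0_entries !mul0r.
pose k := ulsubmx p; pose alpha : 'rV[R]_m := \row_i p im (ei i).
have kE i j : k i j = p (ei i) (ei j) by rewrite /k !mxE.
have kk : k^T *m k = 1%:M.
  apply/matrixP => i j; have /matrixP/(_ (ei i) (ei j)) := O_trmx Op.
  rewrite -[p^T *m J *m p]mulmxA mxE big_split_l !mulJmx eps_im eps_il.
  rewrite ![p^T _ _]mxE !pml mulN1r mulrN mul1r addrK.
  have -> : J (ei i) (ei j) = (i == j)%:R.
    by rewrite IformE !mxE eps_lshift mulrb (inj_eq (@lshift_inj _ _)); case: eqP.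
  move=> E; rewrite [RHS]mxE -E mxE; apply: eq_bigr => a _.
  by rewrite mulJmx eps_lshift mul1r !mxE.
have kk' := mulmx1C kk.
have OK := Kmx_O kk'.
have KE : p = Kmx k *m Nmx alpha.
  have ON := SO_O (Nmx_SO alpha).
  suff q1 : Linv (Kmx k *m Nmx alpha) *m p = 1%:M.
    have OKN := OM OK ON.
    by rewrite -[LHS]mul1mx -(mulOV OKN) -mulmxA q1 mulmx1.
  apply: O_unipotent_id.
  - by apply: OM => //; apply: OV; exact: OM.
  - have KNv : Kmx k *m Nmx alpha *m v0 = v0 by rewrite -mulmxA Nmx_v0 Kmx_v0.
    by rewrite -mulmxA pv -{1}KNv mulmxA mulVO ?mul1mx //; exact: OM.
  - move=> i.
    have pe : p *m delta_mx (ei i) 0 =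
        Kmx k *m Nmx alpha *m delta_mx (ei i) 0 :> 'cV[R]_(m + 2).
      rewrite -mulmxA Nmx_ei mulmxDr -scalemxAr Kmx_v0.
      apply/colP => j; rewrite col_ei [RHS]mxE col_ei [X in _ + X]mxE [alpha 0 i]mxE.
      have [[a ->]|->|->] := ord_split j.
      + by rewrite KmxE v0_entries mulr0 addr0 kE.
      + by rewrite KmxE v0_entries mulr1 add0r.
      + by rewrite KmxE v0_entries mulr1 add0r pml.
    by rewrite -mulmxA pe mulmxA mulVO ?mul1mx //; exact: OM.
exists k, alpha; split => //.
have := SO_det Sp; rewrite KE det_mulmx (SO_det (Nmx_SO alpha)) mulr1.
by rewrite /Kmx det_ublock det1 mulr1.
Qed.

Lemma so_entry (Z : mx) : Z \in @so_alg R m ->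
  forall i j, Z i j * eps j = - (eps i * Z j i).
Proof.
rewrite mem_so => /eqP E i j; have /matrixP/(_ i j) := E.
rewrite [LHS]mxE mulmxJ mulJmx [Z^T _ _]mxE [RHS]mxE => /eqP.
by rewrite addr_eq0 => /eqP.
Qed.

Lemma so_so (Z : mx) : Z \in @so_alg R m -> Z *m J + J *m Z^T = 0.
Proof. by rewrite mem_so => /eqP. Qed.

Lemma ulblockE (B : 'M[R]_m) : ((forall i j, ulblock B (ei i) (ei j) = B i j) *
  (forall i, ulblock B i im = 0) * (forall i, ulblock B i il = 0) *
  (forall i, ulblock B im i = 0) * (forall i, ulblock B il i = 0))%type.
Proof.
rewrite /ulblock; do ![split] => [i j|i|i|i|i]; first by rewrite block_mxEul.
all: have [[k ->]|->|->] := ord_split i; rewrite /ordm /ordl.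
all: by rewrite ?(block_mxEur, block_mxEdl, block_mxEdr) mxE.
Qed.

Lemma H0_entries : ((forall i j, H0 (ei i) j = 0) * (forall i j, H0 j (ei i) = 0) *
  (H0 im im = 0) * (H0 im il = 1) * (H0 il im = 1) * (H0 il il = 0))%type.
Proof.
by rewrite H0E; do ![split] => *; rewrite !mxE ?eq_li ?eq_ml ?eqxx ?andbF ?addr0 ?add0r.
Qed.

Lemma Xn_entry alpha : ((forall i j, Xn alpha (ei i) (ei j) = 0 :> R) *
  (forall i, Xn alpha (ei i) im = - alpha 0 i) *
  (forall i, Xn alpha (ei i) il = alpha 0 i) *
  (forall i, Xn alpha im (ei i) = alpha 0 i) *
  (forall i, Xn alpha il (ei i) = alpha 0 i) *
  (Xn alpha im im = 0) * (Xn alpha im il = 0) * (Xn alpha il im = 0) *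
  (Xn alpha il il = 0))%type.
Proof.
do ![split] => *; rewrite Xn_entries mulmxJ mxE [X in _ + X]mxE !outerE.
all: rewrite ?embE ?v0_entries ?eps_lshift ?eps_im ?eps_il; ring.
Qed.

Lemma so_v0_decomp (Z : mx) s : Z \in @so_alg R m -> Z *m v0 = s *: v0 ->
  Z = ulblock (ulsubmx Z) + s *: H0 + Xn (\row_i Z im (ei i)) /\
  ulsubmx Z + (ulsubmx Z)^T = 0.
Proof.
move=> soZ Zv; have E := so_entry soZ.
have row i : Z i im + Z i il = s * v0 i 0.
  have /colP/(_ i) := Zv; rewrite /nullv mulmxDr mxE !col_ei -/v0 => ->.
  by rewrite mxE.
have E1 i : Z (ei i) im = - Z im (ei i).
  by have := E (ei i) im; rewrite eps_im eps_lshift mulr1 mul1r.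
have E2 i : Z (ei i) il = Z il (ei i).
  have := E (ei i) il; rewrite eps_il eps_lshift mulrN1 mul1r.
  by move/oppr_inj.
have E3 i : Z (ei i) il = Z im (ei i).
  by have := row (ei i); rewrite v0_entries mulr0 E1 addrC => /subr0_eq.
have E4 : Z im im = 0.
  by have := E im im; rewrite eps_im mulr1 mul1r => H; lra.
have E5 : Z il il = 0.
  by have := E il il; rewrite eps_il mulrN1 mulN1r opprK => H; lra.
have E6 : Z im il = s by have := row im; rewrite v0_entries E4 add0r mulr1.
have E7 : Z il im = s by have := row il; rewrite v0_entries E5 addr0 mulr1.
split.
  apply/matrixP => i j; rewrite [RHS]mxE [X in X + _]mxE [X in _ + X + _]mxE.
  have [[a ->]|->|->] := ord_split i; have [[b ->]|->|->] := ord_split j;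
    rewrite ?ulblockE ?H0_entries ?Xn_entry ?[(\row_i _) _ _]mxE ?mulr0 ?mulr1
      ?addr0 ?add0r //.
  - by rewrite !mxE.
  - by rewrite -E2 E3.
apply/matrixP => i j; rewrite !mxE.
have := E (ei i) (ei j); rewrite !eps_lshift mulr1 mul1r => ->.
by rewrite addNr.
Qed.

Lemma ulblock_v0 (B : 'M[R]_m) : ulblock B *m v0 = 0.
Proof.
apply/colP => i; rewrite /nullv mulmxDr mxE !col_ei !ulblockE addr0.
by rewrite mxE.
Qed.

Lemma ulblock_so (B : 'M[R]_m) : B + B^T = 0 -> ulblock B \in @so_alg R m.
Proof.
move=> /matrixP BB; rewrite mem_so; apply/eqP/matrixP => i j.
rewrite mxE mulmxJ mulJmx [(ulblock B)^T _ _]mxE [RHS]mxE.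
have [[a ->]|->|->] := ord_split i; have [[b ->]|->|->] := ord_split j;
  rewrite ?ulblockE ?mulr0 ?mul0r ?addr0 //.
by rewrite !eps_lshift mulr1 mul1r; have := BB a b; rewrite !mxE.
Qed.

Lemma H0_so : H0 \in @so_alg R m.
Proof.
rewrite mem_so; apply/eqP/matrixP => i j.
rewrite mxE mulmxJ mulJmx [H0^T _ _]mxE [RHS]mxE.
have [[a ->]|->|->] := ord_split i; have [[b ->]|->|->] := ord_split j;
  rewrite ?H0_entries ?mulr0 ?mul0r ?addr0 // ?eps_im ?eps_il; ring.
Qed.

Lemma Xn_in_so alpha : Xn alpha \in @so_alg R m.
Proof. by rewrite mem_so Xn_so. Qed.

(** The stabiliser of the isotropic line replaces the sum m + a + n from here on. *)
Lemma mem_p (Z : mx) :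
  Z \in @p_alg R m <-> Z \in @so_alg R m /\ exists s, Z *m v0 = s *: v0.
Proof.
split.
  move=> /memv_addP[_ /memv_addP[_ /mem_m[B BB ->] [_ /vlineP[s ->] ->]]].
  move=> [_ /mem_n[alpha ->] ->]; split.
    apply: memvD (Xn_in_so _); apply: memvD; last exact/memvZ/H0_so.
    exact: ulblock_so.
  exists s; rewrite !mulmxDl -scalemxAl ulblock_v0 H0_v0 Xn_v0.
  by rewrite add0r addr0.
move=> [soZ [s Zv]]; have [ZE BB] := so_v0_decomp soZ Zv; rewrite ZE.
apply: memv_add; last by apply/mem_n; eexists.
apply: memv_add; last exact/memvZ/memv_line.
by apply/mem_m; exists (ulsubmx Z).
Qed.

Lemma p_so (Z : mx) : Z \in @p_alg R m -> Z \in @so_alg R m.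
Proof. by move=> /mem_p[]. Qed.

Lemma mxtrace_outer N (D : 'M[R]_N) (v w : 'cV[R]_N) :
  \tr (D *m (v *m w^T)) = (w^T *m D *m v) 0 0.
Proof. by rewrite mulmxA mxtrace_mulC mulmxA /mxtrace big_ord1. Qed.

Lemma so_skew (D : mx) (v w : 'cV[R]_(m + 2)) : D \in @so_alg R m ->
  (v^T *m J *m D *m w) 0 0 = - (w^T *m J *m D *m v) 0 0.
Proof.
move=> /so_so soD.
have E : D^T *m J = - (J *m D).
  move/eqP: soD; rewrite addr_eq0 => /eqP E.
  have := congr1 (fun M => J *m M *m J) E.
  rewrite mulmxN mulNmx !mulmxA JJ mul1mx -mulmxA JJ mulmx1 => ->.
  by rewrite opprK.
transitivity ((w^T *m (D^T *m J) *m v) 0 0).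
  have -> : w^T *m (D^T *m J) *m v = (v^T *m J *m D *m w)^T.
    by rewrite !trmx_mul !trmxK trJ !mulmxA.
  by rewrite [RHS]mxE.
by rewrite E mulmxN mulNmx mxE !mulmxA.
Qed.

(** Hence the restriction of a form to n is, up to a factor, the Euclidean part of [D *m v0]. *)
Lemma tr_so_Xn (D : mx) alpha : D \in @so_alg R m ->
  \tr (D *m Xn alpha) = 2 * \sum_(i < m) alpha 0 i * (D *m v0) (ei i) 0.
Proof.
move=> soD.
transitivity (2 * ((emb alpha)^T *m J *m D *m v0) 0 0).
  rewrite XnE mulmxA mxtrace_mulC !mulmxBr linearB /= mulmxA mxtrace_outer.
  rewrite [X in _ - \tr X]mulmxA mxtrace_outer !mulmxA.
  by rewrite [X in _ - X]so_skew // opprK mulr2n mulrDl mul1r.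
congr (_ * _); rewrite -mulmxA mxE big_split_l !mulmxJ ![(emb _)^T _ _]mxE !embE.
rewrite !mul0r !addr0; apply: eq_bigr => i _.
by rewrite mulmxJ mxE embE eps_lshift mulr1.
Qed.

End ParabolicSubgroup.

(** * Linear forms and reduced spaces *)

Section Forms.
Variables (R : realType) (m : nat) (G : spinGroup R m).
Local Notation mx := 'M[R]_(m + 2).
Local Notation J := (@Iform R m).
Local Notation SO := (@SOe R m).
Local Notation eps := (@sgJ R m).
Local Notation im := (ordm m).
Local Notation il := (ordl m).
Local Notation v0 := (@nullv R m).
Local Notation H0 := (@H0 R m).
Local Notation ei i := (lshift 2 i).
Local Notation g := (@so_alg R m).
Local Notation p := (@p_alg R m).

Lemma cov_SO (x : G) : SO (cov x).
Proof. by have [_ <- _] := cov_two_fold G; exists x. Qed.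

Lemma cov_surj A : SO A -> exists x : G, cov x = A.
Proof. by have [_ <- _] := cov_two_fold G; case=> x _ <-; exists x. Qed.

Lemma cov1 : cov (1%g : G) = 1%:M.
Proof.
have O1 := SO_O (cov_SO 1%g).
by rewrite -[LHS]mul1mx -(mulVO O1) -mulmxA -covM mulg1.
Qed.

Lemma covV (x : G) : cov (x^-1)%g = Linv (cov x).
Proof.
have Ox := SO_O (cov_SO x).
by rewrite -[LHS]mul1mx -(mulVO Ox) -mulmxA -covM mulgV cov1 mulmx1.
Qed.

Lemma AdE (x : G) Y : Ad x Y = cov x *m Y *m Linv (cov x).
Proof. by rewrite /Ad covV. Qed.

Lemma AdVE (x : G) Y : Ad (x^-1)%g Y = Linv (cov x) *m Y *m cov x.
Proof. by rewrite AdE covV LinvK. Qed.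

Lemma conj_so (A Y : mx) : @Opq R m A -> Y \in g -> A *m Y *m Linv A \in g.
Proof.
move=> OA; rewrite !mem_so => /eqP E; apply/eqP.
have H : (A *m Y *m Linv A)^T = J *m A *m J *m Y^T *m A^T.
  by rewrite !trmx_mul LinvE !trmx_mul trmxK trJ !mulmxA.
rewrite H !mulmxA JJ mul1mx -[A *m Y *m Linv A *m J]mulmxA LinvJ.
rewrite mulmxA -mulmxDl -!mulmxA -mulmxDr E.
by rewrite mulmx0 mul0mx.
Qed.

Lemma Ad_so (x : G) Y : Y \in g -> Ad x Y \in g.
Proof. by rewrite AdE; apply: conj_so; exact: SO_O (cov_SO x). Qed.

Lemma coad_linear U (x : G) (h : dualsp U) :
  linear (fun Y : subvs_of U => h (vsproj U (Ad (x^-1)%g (vsval Y)))).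
Proof.
move=> a Y Z; have -> : vsval (a *: Y + Z) = a *: vsval Y + vsval Z by [].
by rewrite /Ad mulmxDr mulmxDl -scalemxAr -scalemxAl !linearP.
Qed.

Lemma coadE U (x : G) (h : dualsp U) Y :
  coad x h Y = h (vsproj U (Ad (x^-1)%g (vsval Y))).
Proof. exact: (linfun_linear (coad_linear x h)). Qed.

Lemma iota_linear (X : mx) :
  linear (fun Y : subvs_of g => (2^-1 * \tr (X *m vsval Y) : R^o)).
Proof.
move=> a Y Z; have -> : vsval (a *: Y + Z) = a *: vsval Y + vsval Z by [].
rewrite mulmxDr -scalemxAr linearD linearZ /=.
by rewrite mulrDr [a *: _]/(a * _); congr (_ + _); rewrite mulrCA.
Qed.

Lemma iotaE (X : mx) (Y : subvs_of g) : iota_form X Y = 2^-1 * \tr (X *m vsval Y).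
Proof. exact: (linfun_linear (iota_linear X)). Qed.

Lemma moment_linear (f : dualsp g) :
  linear (fun Y : subvs_of p => f (vsproj g (vsval Y))).
Proof.
move=> a Y Z; have -> : vsval (a *: Y + Z) = a *: vsval Y + vsval Z by [].
by rewrite !linearP.
Qed.

Lemma momentE (f : dualsp g) Y : moment f Y = f (vsproj g (vsval Y)).
Proof. exact: (linfun_linear (moment_linear f)). Qed.

Lemma moment_iotaE (X : mx) (Z : subvs_of p) :
  moment (iota_form X) Z = 2^-1 * \tr (X *m vsval Z).
Proof. by rewrite momentE iotaE vsprojK //; exact/p_so/subvsP. Qed.

Lemma conj_tr (x : G) (X Z : mx) : \tr (X *m Ad (x^-1)%g Z) = \tr (Ad x X *m Z).
Proof.
rewrite AdVE AdE !mulmxA mxtrace_mulC !mulmxA.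
by rewrite -!mulmxA.
Qed.

Lemma coad_iota (x : G) (X : mx) : coad x (iota_form X) = iota_form (Ad x X).
Proof.
apply/lfunP => Z; rewrite coadE !iotaE vsprojK ?conj_tr //.
exact/Ad_so/subvsP.
Qed.

Lemma AdM (x y : G) (X : mx) : Ad (x * y)%g X = Ad x (Ad y X).
Proof. by rewrite !AdE covM LinvM !mulmxA. Qed.

Lemma mexp0 : mexp (0 : mx) = 1%:M.
Proof.
have <- : Xn (0 : 'rV[R]_m) = 0 by exact: linear0.
by rewrite mexp_Xn /Nmx linear0 mul0mx scaler0 !addr0.
Qed.

Lemma MAN_v0 (x : G) : MAN x -> exists2 c, c != 0 & cov x *m v0 = c *: v0.
Proof.
move=> [k [t [alpha [_ _ ->]]]]; exists (expR t); first by rewrite gt_eqF // expR_gt0.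
rewrite mexp_Xn -!mulmxA Nmx_v0 mexp_H0_v0 -scalemxAr.
by rewrite -/(Kmx k) Kmx_v0.
Qed.

(** [MAN] is a condition on [cov x] alone, so either lift of a matrix fixing [v0] belongs to P. *)
Lemma fix_MAN (x : G) : cov x *m v0 = v0 -> MAN x.
Proof.
move=> xv; have [k [alpha [kk dk E]]] := parabolic_decomp (cov_SO x) xv.
exists k, 0, alpha; split => //.
by rewrite scale0r mexp0 mulmx1 mexp_Xn.
Qed.

(** P normalises p, so on P the projection inside [coad] merely retypes its argument. *)
Lemma MAN_p (x : G) Z : MAN x -> Z \in p -> Ad (x^-1)%g Z \in p.
Proof.
move=> /MAN_v0[c c0 xv] /mem_p[soZ [s Zv]]; apply/mem_p.
split; first exact: Ad_so.
have Lv : c *: (Linv (cov x) *m v0) = v0.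
  by rewrite scalemxAr -xv mulmxA mulVO ?mul1mx //; exact: SO_O (cov_SO x).
exists s; rewrite AdVE -!mulmxA xv -!scalemxAr Zv -scalemxAr.
by rewrite scalerA mulrC -scalerA Lv.
Qed.

Lemma coad_moment (x : G) (X : mx) : MAN x ->
  coad x (moment (iota_form X)) = moment (iota_form (Ad x X)).
Proof.
move=> Mx; apply/lfunP => Z; rewrite coadE !moment_iotaE vsprojK ?conj_tr //.
by apply: MAN_p => //; exact: subvsP.
Qed.

Lemma tr_sqr_skew N (B : 'M[R]_N) : B + B^T = 0 -> \tr (B *m B) = 0 -> B = 0.
Proof.
move=> /eqP; rewrite addrC addr_eq0 => /eqP BT tB.
have : \sum_i \sum_j B i j ^+ 2 = 0.
  transitivity (- \tr (B *m B)); last by rewrite tB oppr0.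
  rewrite /mxtrace -sumrN; apply: eq_bigr => i _; rewrite mxE -sumrN.
  apply: eq_bigr => j _; have /matrixP/(_ i j) := BT; rewrite !mxE => ->.
  by rewrite mulrN opprK expr2.
move/eqP; rewrite psumr_eq0 => [|i _]; last by apply: sumr_ge0 => j _; exact: sqr_ge0.
move=> /allP H; apply/matrixP => i j; rewrite mxE; apply/eqP; rewrite -sqrf_eq0.
have := H i; rewrite mem_index_enum => /(_ isT) /=.
rewrite psumr_eq0 => [/allP/(_ j)|k _]; last exact: sqr_ge0.
by rewrite mem_index_enum => /(_ isT).
Qed.

Lemma mxtrace_delta N (D : 'M[R]_N) i j : \tr (D *m delta_mx i j) = D j i.
Proof.
rewrite mxtrace_mulC /mxtrace (bigD1 i) //= big1 => [|k /negPf ki].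
  rewrite mxE (bigD1 j) //= mxE !eqxx mul1r big1 ?addr0 // => k /negPf kj.
  by rewrite mxE eqxx kj mul0r.
by rewrite mxE big1 // => l _; rewrite mxE ki mul0r.
Qed.

Lemma tr_H0 (D : mx) : \tr (D *m H0) = D il im + D im il.
Proof. by rewrite H0E mulmxDr linearD /= !mxtrace_delta. Qed.

(** The orthogonal of p for the trace form is n. Testing [D] against [H0] and n gives [D *m v0 = 0];
    testing it against m removes the remaining block. *)
Lemma moment_inj (X Y : mx) : X \in g -> Y \in g ->
  moment (iota_form X) = moment (iota_form Y) -> exists alpha, Y = X + Xn alpha.
Proof.
move=> gX gY E; pose D := Y - X.
have gD : D \in g by apply: rpredB.
have trD Z : Z \in p -> \tr (D *m Z) = 0.
  move=> pZ; have /lfunP/(_ (vsproj p Z)) := E.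
  rewrite !moment_iotaE vsprojK // => /mulfI H.
  by rewrite /D mulmxBl linearB /= H ?subrr // invr_neq0.
have DH : D im il = 0.
  have : \tr (D *m H0) = 0.
    by apply: trD; apply/mem_p; split; [exact: H0_so|exists 1; rewrite H0_v0 scale1r].
  rewrite tr_H0; have := so_entry gD im il; rewrite eps_il eps_im; lra.
have Dm i : D i i = 0.
  have := so_entry gD i i; rewrite [eps i * _]mulrC => /eqP.
  rewrite -addr_eq0 -mulr2n mulrn_eq0 /= mulf_eq0 => /orP[/eqP //|/eqP e0].
  by have := eps_eps R i; rewrite e0 mulr0 => /esym/eqP; rewrite oner_eq0.
have Dl : D il im = 0.
  by have := so_entry gD im il; rewrite eps_il eps_im DH; lra.
have De i : (D *m v0) (ei i) 0 = 0.
  have := tr_so_Xn (delta_mx 0 i) gD; rewrite trD; last first.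
    by apply/mem_p; split; [exact: Xn_in_so|exists 0; rewrite Xn_v0 scale0r].
  rewrite (bigD1 i) //= big1 => [|j /negPf ji]; last by rewrite mxE ji andbF mul0r.
  rewrite !mxE !eqxx mul1r addr0 => /esym/eqP.
  by rewrite mulf_eq0 pnatr_eq0 /= => /eqP.
have Dv : D *m v0 = 0 *: v0.
  rewrite scale0r; apply/colP => i; rewrite [RHS]mxE.
  have [[a ->]|->|->] := ord_split i; first exact: De.
    by rewrite /nullv mulmxDr mxE !col_ei DH Dm addr0.
  by rewrite /nullv mulmxDr mxE !col_ei Dl Dm addr0.
have [DE BB] := so_v0_decomp gD Dv.
exists (\row_i D im (ei i)).
suff B0 : ulsubmx D = 0.
  have U0 : ulblock (0 : 'M[R]_m) = 0 by exact: linear0.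
  by move: DE; rewrite B0 U0 scale0r !add0r => <-; rewrite addrC subrK.
(* The block is tested against itself: the trace form is definite on skew matrices. *)
apply: (tr_sqr_skew BB).
have gB := ulblock_so BB.
have : \tr (D *m ulblock (ulsubmx D)) = 0.
  by apply: trD; apply/mem_p; split => //; exists 0; rewrite ulblock_v0 scale0r.
rewrite [X in X *m _]DE scale0r addr0; move: (ulsubmx D) gB => B gB {DE BB}.
rewrite mulmxDl linearD /= [\tr (Xn _ *m _)]mxtrace_mulC tr_so_Xn // ulblock_v0.
rewrite [X in _ + _ * X]big1 => [|k _]; last by rewrite [X in _ * X]mxE mulr0.
by rewrite mulr0 addr0 /ulblock mulmx_block mxtrace_block !mulmx0 !addr0 mxtrace0 addr0.
Qed.

Section ReducedSpace.
Variables (t : 'I_(m + 2) -> R) (tau : 'I_(m + 2) -> 'I_(m + 2)) (r : 'I_(m + 2)).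
Hypothesis td : torus_data t tau r.
Local Notation T := (hm tau (fun=> 0) t).
Local Notation f := (iota_form T).

Lemma T_so : T \in g.
Proof.
rewrite mem_so; apply/eqP/matrixP => i j.
rewrite mxE mulmxJ mulJmx [T^T _ _]mxE !mxE !mul0rn !add0r.
have [->|ji] := eqVneq j (tau i).
  have -> : t (tau i) = - (t i * eps i * eps (tau i)).
    by rewrite -mulNr -(t_tau td) -mulrA eps_eps mulr1.
  rewrite (tauK td) !eqxx !mulr1n.
  rewrite [LHS](_ : _ = t i * eps (tau i) * (1 - eps i * eps i)); last by ring.
  by rewrite eps_eps subrr mulr0.
have /negPf -> : i != tau j by rewrite (tau_eq (tauK td)) eq_sym.
by rewrite !mulr0n mul0r mulr0 addr0.
Qed.

Lemma orbit_iota u : coadjoint_orbit G f u ->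
  exists x : G, u = iota_form (cov x *m T *m Linv (cov x)).
Proof. by case=> x _ <-; exists x; rewrite coad_iota AdE. Qed.

Lemma orbit_coad (x : G) u : coadjoint_orbit G f u -> coadjoint_orbit G f (coad x u).
Proof.
by case=> y _ <-; exists (x * y)%g => //; rewrite !coad_iota AdM.
Qed.

Lemma moment_coad (x : G) u : coadjoint_orbit G f u -> MAN x ->
  moment (coad x u) = coad x (moment u).
Proof.
by move=> /orbit_iota[y ->] Mx; rewrite coad_moment // coad_iota.
Qed.

Lemma fiber_transitive u u' : coadjoint_orbit G f u -> coadjoint_orbit G f u' ->
  moment u = moment u' -> exists2 x : G, MAN x & coad x u = u'.
Proof.
move=> /orbit_iota[x ->] /orbit_iota[y ->].
have gT (z : G) : cov z *m T *m Linv (cov z) \in g.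
  by apply: conj_so; [exact: SO_O (cov_SO z)|exact: T_so].
move=> /(moment_inj (gT x) (gT y))[alpha E].
have [q [Sq qv qE]] : exists q : mx, [/\ SO q, q *m v0 = v0 &
    q *m (cov x *m T *m Linv (cov x)) *m Linv q = cov y *m T *m Linv (cov y)].
  apply: (transporter td (cov_SO x) (cov_SO y) (emb_v0 alpha)).
  by rewrite E XnE.
have [z zq] := cov_surj Sq; exists z.
  by apply: fix_MAN; rewrite zq.
by rewrite coad_iota AdE zq qE.
Qed.

Lemma reduced_singleton (x : G) :
  exists o, reduced_space G f (moment (coad x f)) = [set o].
Proof.
set h := moment _; exists (fiber G f h).
have orb u : fiber G f h u -> [set coad y u | y in @StabP R m G h] = fiber G f h.
  move=> [ou mu]; apply/seteqP; split=> [_ [y [My yh] <-]|u' [ou' mu']].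
    by split; [exact: orbit_coad|rewrite moment_coad // mu].
  have [y My yu] := fiber_transitive ou ou' (etrans mu (esym mu')).
  (* [y] carries one point of the fibre to another and the moment map is P-equivariant, so [y]
     stabilises [h]. *)
  exists y => //; split => //.
  by rewrite -mu -moment_coad // yu mu'.
apply/seteqP; split=> [_ [u Fu <-]|_ ->]; first exact: orb.
have fx : fiber G f h (coad x f) by split => //; exists x.
by exists (coad x f) => //; exact: orb.
Qed.

End ReducedSpace.
End Forms.

(** * Regular forms *)

Section Regular.
Variables (R : realType) (m : nat).
Local Notation mx := 'M[R]_(m + 2).
Local Notation J := (@Iform R m).
Local Notation SO := (@SOe R m).
Local Notation eps := (@sgJ R m).
Local Notation im := (ordm m).
Local Notation il := (ordl m).
Local Notation v0 := (@nullv R m).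
Local Notation H0 := (@H0 R m).
Local Notation ei i := (lshift 2 i).
Local Notation g := (@so_alg R m).
Local Notation p := (@p_alg R m).

Lemma tr_Xn_p alpha W : W \in p -> \tr (@Xn R m alpha *m W) = 0.
Proof.
move=> /mem_p[gW [s Wv]]; rewrite mxtrace_mulC tr_so_Xn // Wv.
rewrite big1 ?mulr0 // => i _.
by rewrite [X in _ * X]mxE v0_entries !mulr0.
Qed.

Lemma perp_p D : D \in g -> (forall Z, Z \in p -> \tr (D *m Z) = 0) ->
  exists alpha, D = Xn alpha.
Proof.
move=> gD H; have g0 : (0 : mx) \in g by exact: mem0v.
have [|al ->] := moment_inj g0 gD; last by rewrite add0r; exists al.
by apply/lfunP => Z; rewrite !moment_iotaE H ?mul0mx ?mxtrace0 //; exact: subvsP.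
Qed.

Lemma bracket_so (X Y : mx) : X \in g -> Y \in g -> X *m Y - Y *m X \in g.
Proof.
rewrite !mem_so => /eqP EX /eqP EY; apply/eqP.
have XT : J *m X^T = - (X *m J) by apply/eqP; rewrite -addr_eq0 addrC EX.
have YT : J *m Y^T = - (Y *m J) by apply/eqP; rewrite -addr_eq0 addrC EY.
rewrite linearB /= !trmx_mul mulmxBl mulmxBr !mulmxA XT YT !mulNmx.
by rewrite -!mulmxA XT YT !mulmxN !opprK addrC addrA subrK subrr.
Qed.

Lemma bracket_p (X Y : mx) : X \in p -> Y \in p -> X *m Y - Y *m X \in p.
Proof.
move=> /mem_p[gX [s Xv]] /mem_p[gY [u Yv]]; apply/mem_p; split.
  exact: bracket_so.
exists 0; rewrite mulmxBl -!mulmxA Xv Yv -!scalemxAr Xv Yv !scalerA mulrC.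
by rewrite subrr scale0r.
Qed.

Lemma bracket_linr (X Y Z : mx) (a : R) :
  X *m (a *: Y + Z) - (a *: Y + Z) *m X =
  a *: (X *m Y - Y *m X) + (X *m Z - Z *m X).
Proof.
by rewrite mulmxDr mulmxDl -!scalemxAr -!scalemxAl opprD addrACA -scalerBr.
Qed.

Lemma adpE (X Y : subvs_of p) :
  adp X Y = vsproj p (vsval X *m vsval Y - vsval Y *m vsval X).
Proof.
apply: linfun_linear => a Z W.
have -> : vsval (a *: Z + W) = a *: vsval Z + vsval W by [].
by rewrite bracket_linr linearP.
Qed.

Lemma coadp_linear (h : dualsp p) : linear (fun X : subvs_of p => - (h \o adp X)%VF).
Proof.
move=> a X Y; apply/lfunP => Z.
rewrite add_lfunE scale_lfunE !opp_lfunE !comp_lfunE !adpE scalerN -opprD.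
rewrite -linearP -linearP.
have -> : vsval (a *: X + Y) = a *: vsval X + vsval Y by [].
congr (- h (vsproj p _)); rewrite -[LHS]opprB bracket_linr.
by rewrite opprD -scalerN !opprB.
Qed.

Lemma coadpE (h : dualsp p) X : coadp h X = - (h \o adp X)%VF.
Proof. exact: (linfun_linear (coadp_linear h)). Qed.

(** Invariance of the trace form moves the bracket onto [Y], and n is the orthogonal of p. *)
Lemma stab_iotaP (Y : mx) (X : subvs_of p) : Y \in g ->
  reflect (exists alpha, Y *m vsval X - vsval X *m Y = Xn alpha)
    (X \in stabp (moment (iota_form Y))).
Proof.
move=> gY; have gX := p_so (subvsP X).
have trE (Z : subvs_of p) : \tr ((Y *m vsval X - vsval X *m Y) *m vsval Z) =
    \tr (Y *m (vsval X *m vsval Z - vsval Z *m vsval X)).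
  rewrite mulmxBl mulmxBr !linearB /= !mulmxA; congr (_ - _).
  by rewrite -[in LHS]mulmxA [LHS]mxtrace_mulC.
have vE (Z : subvs_of p) : coadp (moment (iota_form Y)) X Z =
    - (2^-1 * \tr ((Y *m vsval X - vsval X *m Y) *m vsval Z)).
  rewrite coadpE opp_lfunE comp_lfunE moment_iotaE adpE vsprojK ?trE //.
  by apply: bracket_p; exact: subvsP.
rewrite /stabp memv_ker; apply: (iffP eqP) => [H|[al E]].
  apply: perp_p => [|Z pZ]; first exact: bracket_so.
  have := vE (vsproj p Z); rewrite H lfunE /= vsprojK // => /esym/eqP.
  by rewrite oppr_eq0 mulf_eq0 invr_eq0 pnatr_eq0 /= => /eqP.
apply/lfunP => Z; rewrite vE E tr_Xn_p ?mulr0 ?oppr0; last exact: subvsP.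
by rewrite lfunE.
Qed.

(** Transposes of elements of n span the opposite nilradical, which the trace form pairs
    nondegenerately with n. *)
Lemma trXn_so (u : 'rV[R]_m) : (Xn u)^T \in g.
Proof.
rewrite mem_so trmxK; apply/eqP.
have := so_so (Xn_in_so u) => /(congr1 (fun M => J *m M *m J)).
rewrite mulmxDr mulmxDl mulmx0 mul0mx !mulmxA JJ mul1mx -mulmxA JJ mulmx1.
by rewrite addrC.
Qed.

Lemma trXnE (u : 'rV[R]_m) : (Xn u)^T = J *m (emb u *m v0^T - v0 *m (emb u)^T).
Proof. by rewrite XnE !trmx_mul trJ linearB /= !trmx_mul !trmxK. Qed.

Lemma v0v0 : v0^T *m v0 = 2%:M.
Proof.
apply/matrixP => i j; rewrite !ord1 mxE big_split_l big1 => [|k _].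
  by rewrite ![v0^T _ _]mxE !v0_entries [RHS]mxE eqxx mulr1n; ring.
by rewrite [v0^T _ _]mxE v0_entries mul0r.
Qed.

Lemma v0Temb (u : 'rV[R]_m) : v0^T *m emb u = 0.
Proof.
apply/matrixP => i j; rewrite !ord1 mxE big_split_l big1 => [|k _].
  by rewrite !embE !mulr0 !addr0 mxE.
by rewrite [v0^T _ _]mxE v0_entries mul0r.
Qed.

Lemma Jemb (u : 'rV[R]_m) : J *m emb u = emb u.
Proof.
apply/colP => i; rewrite mulJmx.
by have [[a ->]|->|->] := ord_split i; rewrite ?embE ?mulr0 ?eps_lshift ?mul1r.
Qed.

Lemma embTemb (u w : 'rV[R]_m) : (emb u)^T *m emb w = (\sum_i u 0 i * w 0 i)%:M.
Proof.
apply/matrixP => i j; rewrite !ord1 mxE big_split_l ![(emb u)^T _ _]mxE !embE.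
rewrite !mul0r !addr0 mxE; apply: eq_bigr => k _.
by rewrite mxE !embE.
Qed.

Lemma trXn_v0 (u : 'rV[R]_m) : (Xn u)^T *m v0 = 2 *: emb u.
Proof.
rewrite trXnE -mulmxA mulmxBl -!mulmxA v0v0 -[(emb u)^T *m v0]trmxK trmx_mul trmxK.
by rewrite v0Temb trmx0 mulmx0 subr0 mul_mx_scalar -scalemxAr Jemb.
Qed.

Lemma ulblock_emb (B : 'M[R]_m) (u : 'rV[R]_m) : ulblock B *m emb u = emb (u *m B^T).
Proof.
rewrite /ulblock /emb mul_block_col mul0mx mulmx0 addr0 mul0mx add0r.
by rewrite trmx_mul trmxK.
Qed.

Lemma Xn_emb (c u : 'rV[R]_m) : Xn c *m emb u = (\sum_i c 0 i * u 0 i) *: v0.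
Proof.
rewrite XnE -mulmxA mulmxBl -!mulmxA Jemb embTemb v0Temb mulmx0 subr0.
by rewrite mul_mx_scalar.
Qed.

Lemma H0_emb (u : 'rV[R]_m) : H0 *m emb u = 0.
Proof.
apply/colP => i; rewrite mxE big_split_l big1 => [|k _]; last first.
  by rewrite H0_entries mul0r.
by rewrite !embE !mulr0 !addr0 mxE.
Qed.

Lemma ulblock_Jv0 (B : 'M[R]_m) : ulblock B *m (J *m v0) = 0.
Proof.
apply/colP => i; rewrite mxE big_split_l big1 => [|k _]; last first.
  by rewrite mulJmx v0_entries !mulr0.
by rewrite !ulblockE !mul0r !addr0 mxE.
Qed.

Lemma emb0 : emb (0 : 'rV[R]_m) = 0.
Proof. by rewrite /emb trmx0 col_mx0. Qed.

Lemma odd_skew_singular (A : 'M[R]_m) : odd m -> A + A^T = 0 ->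
  exists2 u : 'rV[R]_m, u != 0 & u *m A = 0.
Proof.
move=> om /eqP; rewrite addrC addr_eq0 => /eqP AT.
apply/det0P; have := det_tr A; rewrite AT -scaleN1r detZ -signr_odd om expr1 mulN1r.
by move=> E; apply/eqP; lra.
Qed.

Lemma emb_inj : injective (@emb R m).
Proof.
move=> u w /colP E; apply/rowP => i.
by have := E (ei i); rewrite !embE.
Qed.

Lemma skew_form0 (B : 'M[R]_m) (u : 'rV[R]_m) : B + B^T = 0 ->
  (u *m B *m u^T) 0 0 = 0.
Proof.
move=> /eqP; rewrite addrC addr_eq0 => /eqP BT.
have : (u *m B *m u^T)^T = - (u *m B *m u^T).
  by rewrite !trmx_mul trmxK BT mulNmx mulmxN mulmxA.
by move=> /matrixP/(_ 0 0); rewrite !mxE => E; lra.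
Qed.

Lemma sqr_sum_eq0 (u : 'rV[R]_m) : \sum_i u 0 i * u 0 i = 0 -> u = 0.
Proof.
move/eqP; rewrite psumr_eq0 => [/allP H|i _]; last by rewrite -expr2 sqr_ge0.
apply/rowP => i; have := H i; rewrite mem_index_enum => /(_ isT).
by rewrite mulf_eq0 orbb => /eqP ->; rewrite mxE.
Qed.

(* As [m] is odd, the [m]-part [A] of [Y] kills some [u <> 0].  Replacing [Y] by
   [Y + (Xn u)^T] strictly shrinks the stabiliser, which loses [H0]. *)
Lemma regular_neq0 (Y : mx) : odd m -> Y \in g ->
  regular_form (moment (iota_form Y)) -> ~ exists s, Y *m v0 = s *: v0.
Proof.
move=> om gY reg [s Yv].
have [YE AA] := so_v0_decomp gY Yv.
set A := ulsubmx Y in YE AA; set b := \row_i _ in YE.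
have [u u0 uA] := odd_skew_singular om AA.
have Au : u *m A^T = 0.
  by move/eqP: AA; rewrite addrC addr_eq0 => /eqP ->; rewrite mulmxN uA oppr0.
pose Y' := Y + (Xn u)^T.
have gY' : Y' \in g by apply: rpredD => //; exact: trXn_so.
have := reg (moment (iota_form Y')); apply/negP; rewrite -ltnNge /orbit_dim.
have sub : (stabp (moment (iota_form Y')) <= stabp (moment (iota_form Y)))%VS.
  apply/subvP => X /(stab_iotaP _ gY')[al E]; apply/(stab_iotaP _ gY).
  have /mem_p[gX [k Xv]] := subvsP X.
  move: (vsval X) gX Xv E => {}X gX Xv E.
  (* It remains that [X] commutes with [(Xn u)^T]. The relation [E] is evaluated on [v0] and on
     [emb u], which forces [X] to be a rotation in m killing [u]. *)
  exists al; rewrite -E /Y' mulmxDl mulmxDr opprD addrACA -[LHS]addr0; congr (_ + _).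
  have Y'v : Y' *m v0 = s *: v0 + 2 *: emb u by rewrite mulmxDl Yv trXn_v0.
  have [XE BB] := so_v0_decomp gX Xv.
  set B := ulsubmx X in XE BB; set c := \row_i _ in XE.
  have Xu : X *m emb u = k *: emb u.
    apply: (@scalerI _ _ (2 : R)); first by rewrite pnatr_eq0.
    have := congr1 (fun M => M *m v0) E.
    rewrite mulmxBl -!mulmxA Xv Y'v Xn_v0 -scalemxAr Y'v mulmxDr -!scalemxAr Xv.
    move/eqP; rewrite subr_eq0 => /eqP.
    by rewrite scalerDr !scalerA [k * s]mulrC => /addrI; rewrite mulrC => <-.
  have Xu' : X *m emb u = emb (u *m B^T) + (\sum_i c 0 i * u 0 i) *: v0.
    rewrite XE !mulmxDl ulblock_emb Xn_emb -scalemxAl H0_emb scaler0 addr0.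
    by [].
  have cu : \sum_i c 0 i * u 0 i = 0.
    have /colP/(_ im) := etrans (esym Xu') Xu.
    by rewrite [LHS]mxE [X in _ + X]mxE [RHS]mxE !embE v0_entries mulr1 mulr0 add0r.
  have Bu : u *m B^T = k *: u.
    apply/rowP => i; have /colP/(_ (ei i)) := etrans (esym Xu') Xu.
    by rewrite cu scale0r addr0 [RHS]mxE !embE => ->; rewrite mxE.
  (* [u] is a real eigenvector of a skew matrix. *)
  have k0 : k = 0.
    have := skew_form0 u BB; move/eqP: (BB); rewrite addr_eq0 => /eqP ->.
    rewrite mulmxN Bu -scaleNr -scalemxAl mxE mxE => /eqP; rewrite mulf_eq0 oppr_eq0.
    case/orP => /eqP // uu; case/negP: u0; apply/eqP/sqr_sum_eq0; rewrite -[RHS]uu.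
    by apply: eq_bigr => i _; rewrite mxE.
  rewrite k0 scale0r in Bu; rewrite k0 scale0r in Xu; rewrite k0 scale0r in Xv.
  have BJv : ulblock B *m (J *m v0) = 0 by exact: ulblock_Jv0.
  (* On [emb u] the left side of [E] is [-2 |u|^2 emb c] up to a multiple of [v0], the right side a
     multiple of [v0]; compare Euclidean components. *)
  have c0 : c = 0.
    have := congr1 (fun M => M *m emb u) E.
    rewrite mulmxBl -!mulmxA Xu mulmx0 sub0r Xn_emb /Y' mulmxDl [X in X *m emb u + _]YE.
    rewrite !mulmxDl ulblock_emb Au -scalemxAl H0_emb scaler0 addr0 Xn_emb.
    have -> : emb (0 : 'rV[R]_m) = 0 by rewrite /emb trmx0 col_mx0.
    rewrite add0r trXnE -mulmxA mulmxBl -!mulmxA v0Temb mulmx0 sub0r embTemb.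
    rewrite mul_mx_scalar mulmxN mulmxDr -!scalemxAr Xv scaler0 add0r mulmxN opprK.
    rewrite -scalemxAr XE k0 scale0r addr0 mulmxDl BJv add0r XnE -mulmxA.
    rewrite (mulmxA J) JJ mul1mx mulmxBl -!mulmxA v0v0.
    rewrite -[(emb c)^T *m v0]trmxK trmx_mul trmxK v0Temb trmx0 mulmx0 sub0r.
    rewrite mul_mx_scalar scalerN scalerA -scaleNr => Ec.
    apply/rowP => i; rewrite [RHS]mxE.
    have /colP/(_ (ei i)) := Ec; rewrite [LHS]mxE [RHS]mxE embE v0_entries mulr0.
    move/eqP; rewrite !(mulf_eq0, oppr_eq0) pnatr_eq0 orbF => /orP[/eqP uu|/eqP //].
    by case/negP: u0; apply/eqP/sqr_sum_eq0.
  have uB : u *m B = 0.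
    move/eqP: (BB); rewrite addr_eq0 => /eqP ->.
    by rewrite mulmxN Bu oppr0.
  have {XE} XE : X = ulblock B.
    by rewrite XE k0 scale0r addr0 c0 (_ : Xn 0 = 0) ?addr0 //; exact: linear0.
  rewrite trXnE XE -mulmxA mulmxBl -!mulmxA.
  have -> : v0^T *m ulblock B = 0.
    rewrite -[LHS]trmxK trmx_mul trmxK; apply/eqP; rewrite trmx_eq0; apply/eqP.
    have -> : (ulblock B)^T = ulblock B^T by rewrite /ulblock tr_block_mx !trmx0.
    exact: ulblock_v0.
  have -> : (emb u)^T *m ulblock B = 0.
    rewrite -[LHS]trmxK trmx_mul trmxK; apply/eqP; rewrite trmx_eq0; apply/eqP.
    have -> : (ulblock B)^T = ulblock B^T by rewrite /ulblock tr_block_mx !trmx0.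
    by rewrite ulblock_emb trmxK uB /emb trmx0 col_mx0.
  rewrite !mulmx0 subr0 mulmx0 sub0r mulmxBr !mulmxA Jemb.
  rewrite mulmxBr (mulmxA _ (emb u)) ulblock_emb Bu (mulmxA _ (J *m v0)) BJv.
  by rewrite emb0 !mul0mx subrr oppr0.
have pH0 : H0 \in p.
  by apply/mem_p; split; [exact: H0_so|exists 1; rewrite H0_v0 scale1r].
have nsub : vsproj p H0 \notin stabp (moment (iota_form Y')).
  apply/negP => /(stab_iotaP _ gY')[al]; rewrite vsprojK // => E.
  have := congr1 (fun M => M *m v0) E.
  rewrite Xn_v0 mulmxBl -!mulmxA H0_v0 /Y' mulmxDl trXn_v0 Yv mulmxDr -!scalemxAr.
  rewrite H0_v0 H0_emb scaler0 addr0 addrAC subrr add0r => /eqP.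
  rewrite scaler_eq0 pnatr_eq0 /= -emb0 => /eqP/emb_inj/eqP.
  by rewrite (negPf u0).
have H0s : vsproj p H0 \in stabp (moment (iota_form Y)).
  apply/(stab_iotaP _ gY); rewrite vsprojK //.
  have gD := bracket_so gY (H0_so R m).
  have Dv : (Y *m H0 - H0 *m Y) *m v0 = 0 *: v0.
    by rewrite mulmxBl -!mulmxA H0_v0 Yv -scalemxAr H0_v0 subrr scale0r.
  have [DE _] := so_v0_decomp gD Dv; rewrite DE scale0r addr0.
  eexists; rewrite [X in ulblock X](_ : _ = 0).
    by rewrite (_ : ulblock 0 = 0) ?add0r //; exact: linear0.
  apply/matrixP => i j; rewrite !mxE !big1 ?subrr // => k _.
    by rewrite H0_entries mul0r.
  by rewrite H0_entries mulr0.
have := limg_ker_dim (coadp (moment (iota_form Y))) fullv.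
have := limg_ker_dim (coadp (moment (iota_form Y'))) fullv.
rewrite !capfv => <- dimE; rewrite ltnNge; apply/negP => le_im.
have : (\dim (stabp (moment (iota_form Y))) <= \dim (stabp (moment (iota_form Y'))))%N.
  by rewrite /stabp -(leq_add2r (\dim (limg (coadp (moment (iota_form Y)))))) dimE
    leq_add2l.
move=> le_ker.
have /eqP eqs : stabp (moment (iota_form Y')) == stabp (moment (iota_form Y)).
  by rewrite eqEdim sub.
by move: nsub; rewrite eqs H0s.
Qed.

End Regular.

Lemma sum_bound (R : realDomainType) m (F : 'I_m -> R) K :
  (forall i, `|F i| <= K) -> `|\sum_i F i| <= m%:R * K.
Proof.
move=> FK; apply: (le_trans (ler_norm_sum _ _ _)).
rewrite -[m in leRHS]card_ord mulr_natl -sumr_const.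
by apply: ler_sum => i _; exact: FK.
Qed.

Lemma normM_bound (R : realDomainType) (x y a b : R) :
  `|x| <= a -> `|y| <= b -> `|x * y| <= a * b.
Proof. by move=> xa yb; rewrite normrM ler_pM. Qed.

(** * Properness *)

Section Bounds.
Variables (R : realType) (m : nat).
Local Notation mx := 'M[R]_(m + 2).
Local Notation J := (@Iform R m).
Local Notation SO := (@SOe R m).
Local Notation eps := (@sgJ R m).
Local Notation im := (ordm m).
Local Notation il := (ordl m).
Local Notation v0 := (@nullv R m).
Local Notation ei i := (lshift 2 i).

Variables (t : 'I_(m + 2) -> R) (tau : 'I_(m + 2) -> 'I_(m + 2)) (r : 'I_(m + 2)).
Hypothesis td : torus_data t tau r.
Local Notation T := (hm tau (fun=> 0) t).
Local Notation c := (t im).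
Local Notation lam := (lamT t tau).

Definition qf (u : 'cV[R]_(m + 2)) : R := (u^T *m J *m u) 0 0.

Lemma qfE u : qf u = \sum_i eps i * u i 0 ^+ 2.
Proof.
by rewrite /qf mxE; apply: eq_bigr => i _; rewrite mulmxJ mxE expr2 mulrAC mulrC.
Qed.

Lemma qf_split u : qf u = \sum_i u (ei i) 0 ^+ 2 + u im 0 ^+ 2 - u il 0 ^+ 2.
Proof.
rewrite qfE big_split_l eps_im eps_il mul1r mulN1r; congr (_ + _ - _).
by apply: eq_bigr => i _; rewrite eps_lshift mul1r.
Qed.

Lemma qf_O (h : mx) u : @Opq R m h -> qf (h *m u) = qf u.
Proof.
move=> Oh; rewrite /qf trmx_mul -!mulmxA (mulmxA J) (mulmxA h^T).
by rewrite [h^T *m _]mulmxA O_trmx // !mulmxA.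
Qed.

Lemma T_col (u : 'cV[R]_(m + 2)) i : (T *m u) i 0 = t i * u (tau i) 0.
Proof. by rewrite hm_col mul0r add0r. Qed.

Lemma TT_col (u : 'cV[R]_(m + 2)) i : (T *m (T *m u)) i 0 = lam i * u i 0.
Proof. by rewrite !T_col (tauK td) mulrA. Qed.

Lemma qf_T u : qf (T *m u) = \sum_i - (eps i * lam i) * u i 0 ^+ 2.
Proof.
rewrite qfE (reindex_inj (inv_inj (tauK td))); apply: eq_bigr => i _.
rewrite T_col (tauK td) exprMn mulrA; congr (_ * _).
rewrite expr2 mulrA [eps _ * _]mulrC (t_tau td) /lamT; ring.
Qed.

Definition Lbound := \sum_i `|lam i|.

Lemma lam_Lbound i : `|lam i| <= Lbound.
Proof. by rewrite /Lbound (bigD1 i) //= lerDl sumr_ge0. Qed.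

(** Isotropy replaces [v_l^2 - v_m^2] by the sum [D] of the Euclidean squares. The three values
    become sums, up to a sign in the second, of powers of the weights [- lam] and [c^2] times the
    same nonnegative quantities, and these weights lie between 0 and [Lbound]. *)
Lemma norms_T v : qf v = 0 ->
  `|qf (T *m (T *m v))| <= Lbound * qf (T *m v) /\
  qf (T *m (T *m (T *m v))) <= Lbound ^+ 2 * qf (T *m v).
Proof.
rewrite qf_split => /eqP; rewrite subr_eq0 => /eqP null.
have L0 : 0 <= Lbound by rewrite sumr_ge0.
have lk k : 0 <= - lam (ei k) <= Lbound.
  have := lam_Lbound (ei k); rewrite (lam_rot td) ?eq_li // normrN opprK.
  by rewrite ger0_norm ?sqr_ge0 // => ->.
have cL : 0 <= c ^+ 2 <= Lbound.
  by rewrite sqr_ge0 -(lam_im td); apply: le_trans (lam_Lbound im); exact: ler_norm.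
pose D := \sum_k v (ei k) 0 ^+ 2.
have D0 : 0 <= D by apply: sumr_ge0 => k _; exact: sqr_ge0.
have ND : v il 0 ^+ 2 = D + v im 0 ^+ 2 by rewrite -null.
clearbody D.
have N1 : qf (T *m v) = \sum_k (- lam (ei k)) * v (ei k) 0 ^+ 2 + c ^+ 2 * D.
  rewrite qf_T big_split_l eps_im eps_il (lam_im td) (lam_il td) ND.
  under eq_bigr do rewrite eps_lshift mul1r.
  ring.
have N2 : qf (T *m (T *m v)) =
    \sum_k (- lam (ei k)) ^+ 2 * v (ei k) 0 ^+ 2 - (c ^+ 2) ^+ 2 * D.
  rewrite qf_split !TT_col (lam_im td) (lam_il td) !exprMn ND.
  under eq_bigr do rewrite TT_col exprMn -sqrrN.
  ring.
have N3 : qf (T *m (T *m (T *m v))) =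
    \sum_k (- lam (ei k)) ^+ 3 * v (ei k) 0 ^+ 2 + (c ^+ 2) ^+ 3 * D.
  rewrite qf_T big_split_l eps_im eps_il !TT_col (lam_im td) (lam_il td) !exprMn ND.
  under eq_bigr do
    rewrite eps_lshift mul1r TT_col exprMn mulrA -[lam _ ^+ 2]sqrrN -exprS.
  ring.
have mon (k : nat) (x y : R) : 0 <= x <= Lbound -> 0 <= y ->
    x ^+ k.+1 * y <= Lbound ^+ k * (x * y).
  move=> /andP[x0 xL] y0; rewrite exprSr -mulrA ler_wpM2r ?mulr_ge0 //.
  exact: lerXn2r.
have sum_mon k : \sum_i (- lam (ei i)) ^+ k.+1 * v (ei i) 0 ^+ 2 + (c ^+ 2) ^+ k.+1 * D <=
    Lbound ^+ k * qf (T *m v).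
  rewrite N1 mulrDr big_distrr; apply: lerD; last exact: (mon _ _ _ cL D0).
  by apply: ler_sum => i _; exact: (mon _ _ _ (lk i) (sqr_ge0 _)).
split; last by rewrite N3; exact: sum_mon.
apply: le_trans (sum_mon 1%N); rewrite N2; apply: (le_trans (ler_normB _ _)).
rewrite !ger0_norm //; first by rewrite mulr_ge0 // exprn_ge0 // sqr_ge0.
by apply: sumr_ge0 => k _; rewrite mulr_ge0 ?sqr_ge0.
Qed.

(* Put [wj = Y^j v0] and write [<,>] for the form [J].  Skew-symmetry of [Y] gives
   [w2_m - w2_l = - <w1, w1>] and [w3_m = w3_l], while the spectrum of [T] bounds
   [<w2, w2>] and [<w3, w3>] by multiples of [<w1, w1> >= d > 0]. *)
Lemma Yll_bound (B d : R) : 0 < d -> exists M, forall h : mx, SO h ->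
  let Y := h *m T *m Linv h in
  (forall i j, `|Y (ei i) (ei j)| <= B) -> `|Y im il| <= B ->
  (forall i, `|(Y *m v0) (ei i) 0| <= B) ->
  d <= \sum_i (Y *m v0) (ei i) 0 ^+ 2 -> (Y *m Y) il il <= M.
Proof.
move=> d0; pose mR : R := m%:R.
have mR0 : 0 <= mR by exact: ler0n.
(* [B2] bounds the Euclidean entries of [w2], [B3] the sum [w2_m + w2_l], [B4] the Euclidean entries
   of [w3] (its [+ 1] comes from [x <= x^2 + 1]), and [B6] the entries of column [il] of Y. *)
pose B2 := mR * (B * B) + B * B.
pose B3 := (Lbound * (mR * (B * B)) + mR * (B2 * B2)) / d.
pose B4 := Lbound ^+ 2 * (mR * (B * B)) + 1.
pose B5 := mR * (B * B2) + B * B3 + B4.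
pose B6 := B + 2 * B5 / d.
exists (mR * (B6 * B6) + B * B) => h Sh Y YA Ys Yy dE.
have Oh := SO_O Sh.
have gY : Y \in @so_alg R m by apply: conj_so => //; exact: (T_so td).
pose v := Linv h *m v0.
have v_null : qf v = 0 by rewrite /v qf_O ?/qf ?null_v0 ?mxE //; exact: OV.
have [n2 n3] := norms_T v_null.
have hT (u : 'cV[R]_(m + 2)) : Y *m (h *m u) = h *m (T *m u).
  by rewrite /Y -!mulmxA (mulmxA (Linv h)) mulVO // mul1mx.
have hv : v0 = h *m v by rewrite /v mulmxA mulOV // mul1mx.
pose w1 := Y *m v0; pose w2 := Y *m w1; pose w3 := Y *m w2.
have w1E : w1 = h *m (T *m v) by rewrite /w1 hv hT.
have w2E : w2 = h *m (T *m (T *m v)) by rewrite /w2 w1E hT.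
have w3E : w3 = h *m (T *m (T *m (T *m v))) by rewrite /w3 w2E hT.
rewrite -(qf_O (T *m v) Oh) -(qf_O (T *m (T *m v)) Oh) -w1E -w2E in n2.
rewrite -(qf_O (T *m v) Oh) -(qf_O (T *m (T *m (T *m v))) Oh) -w1E -w3E in n3.
have L0 : 0 <= Lbound by rewrite sumr_ge0.
have B0 : 0 <= B by apply: le_trans Ys.
have Ymm : Y im im = 0 by have := so_entry gY im im; rewrite eps_im; lra.
have Yll : Y il il = 0 by have := so_entry gY il il; rewrite eps_il; lra.
have Ylm : Y il im = Y im il.
  by have := so_entry gY il im; rewrite eps_il eps_im; lra.
have Ylk k : Y il (ei k) = Y (ei k) il.
  by have := so_entry gY il (ei k); rewrite eps_il eps_lshift; lra.
have mulY (u : 'cV[R]_(m + 2)) i : (Y *m u) i 0 =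
    \sum_j Y i (ei j) * u (ei j) 0 + Y i im * u im 0 + Y i il * u il 0.
  by rewrite mxE big_split_l.
have w1i i : w1 i 0 = Y i im + Y i il.
  rewrite /w1 mulY big1 => [|j _]; last by rewrite v0_entries mulr0.
  by rewrite !v0_entries !mulr1 add0r.
pose s := Y im il.
have w1m : w1 im 0 = s by rewrite w1i Ymm add0r.
have w1l : w1 il 0 = s by rewrite w1i Yll addr0 Ylm.
pose E := \sum_i w1 (ei i) 0 ^+ 2.
have E1 : qf w1 = E by rewrite qf_split w1m w1l addrK.
have v0J (u : 'cV[R]_(m + 2)) : (v0^T *m J *m u) 0 0 = u im 0 - u il 0.
  rewrite mxE big_split_l !mulmxJ big1 => [|j _].
    by rewrite ![v0^T _ _]mxE !v0_entries eps_im eps_il; ring.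
  by rewrite mulmxJ [v0^T _ _]mxE v0_entries !mul0r.
have w2ml : w2 im 0 - w2 il 0 = - E.
  by rewrite -v0J /w2 mulmxA so_skew // -E1 /qf -mulmxA.
have w3ml : w3 im 0 - w3 il 0 = 0.
  have z : (w1^T *m J *m w2) 0 0 = 0.
    have eqN0 (x : R) : x = - x -> x = 0 by lra.
    by rewrite /w2 mulmxA; apply: eqN0; exact: so_skew.
  rewrite -v0J /w3 mulmxA so_skew // -mulmxA -/w1.
  have tr2 (a b : 'cV[R]_(m + 2)) : a^T *m J *m b = (b^T *m J *m a)^T.
    by rewrite !trmx_mul trmxK trJ mulmxA.
  by rewrite (tr2 w2 w1) [(_^T) 0 0]mxE z oppr0.
have E_le : E <= mR * (B * B).
  apply: (le_trans (ler_norm _)); apply: sum_bound => i.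
  by rewrite expr2; apply: normM_bound; exact: Yy.
have dE' : d <= E by [].
have E0 : 0 <= E by apply: le_trans dE'; exact: ltW.
have B2_ge0 : 0 <= B2 by rewrite addr_ge0 ?mulr_ge0.
have w2k k : `|w2 (ei k) 0| <= B2.
  have -> : w2 (ei k) 0 = \sum_j Y (ei k) (ei j) * w1 (ei j) 0 + s * w1 (ei k) 0.
    by rewrite /w2 mulY w1m w1l [w1 (ei k) 0]w1i; ring.
  apply: (le_trans (ler_normD _ _)); apply: lerD.
    by apply: sum_bound => j; apply: normM_bound; [exact: YA|exact: Yy].
  by apply: normM_bound; [exact: Ys|exact: Yy].
pose S := w2 im 0 + w2 il 0.
have SB : `|S| <= B3.
  rewrite /B3 ler_pdivlMr // mulrC.
  apply: (@le_trans _ _ (E * `|S|)); first by rewrite ler_wpM2r.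
  (* The plane part of [qf w2] is [(w2_m - w2_l)(w2_m + w2_l) = - E S]. *)
  have -> : E * `|S| = `|\sum_k w2 (ei k) 0 ^+ 2 - qf w2|.
    rewrite -[E in LHS]ger0_norm // -normrM.
    congr `| _ |; rewrite qf_split /S.
    rewrite -[E]opprK -w2ml; ring.
  apply: (le_trans (ler_normB _ _)); rewrite addrC; apply: lerD.
    by apply: (le_trans n2); rewrite E1 ler_wpM2l.
  by apply: sum_bound => k; rewrite expr2; apply: normM_bound.
have w3k k : `|w3 (ei k) 0| <= B4.
  have : w3 (ei k) 0 ^+ 2 <= Lbound ^+ 2 * (mR * (B * B)).
    apply: (@le_trans _ _ (Lbound ^+ 2 * E)); last by rewrite ler_wpM2l ?sqr_ge0.
    rewrite -E1; apply: le_trans n3.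
    have w3ml' : w3 im 0 = w3 il 0 by apply/eqP; rewrite -subr_eq0 w3ml.
    rewrite qf_split w3ml' addrK (bigD1 k) //= lerDl sumr_ge0 // => j _.
    exact: sqr_ge0.
  rewrite /B4 -real_normK ?num_real //; move: (`|_|) => x; set K := _ * (_ * _) => xK.
  by have := sqr_ge0 (x - 1); nra.
have Ykm k : `|Y (ei k) im - Y (ei k) il| <= 2 * B5 / d.
  rewrite ler_pdivlMr // mulrC.
  apply: (@le_trans _ _ (E * `|Y (ei k) im - Y (ei k) il|)).
    by rewrite ler_wpM2r.
  rewrite -[E in leLHS]ger0_norm // -normrM.
  (* Row [k] of [w3 = Y w2], with [w2_m = (S - E) / 2] and [w2_l = (S + E) / 2], solved for the
     difference of the two unknown entries. *)
  have -> : E * (Y (ei k) im - Y (ei k) il) =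
      2 * (\sum_j Y (ei k) (ei j) * w2 (ei j) 0 + w1 (ei k) 0 * (S / 2) - w3 (ei k) 0).
    have -> : w3 (ei k) 0 = \sum_j Y (ei k) (ei j) * w2 (ei j) 0 +
      Y (ei k) im * w2 im 0 + Y (ei k) il * w2 il 0 by exact: mulY.
    by rewrite w1i /S -[E]opprK -w2ml; field.
  rewrite normrM [`|2 : R|]ger0_norm // ler_pM2l //.
  apply: (le_trans (ler_normB _ _)); apply: lerD; last exact: w3k.
  apply: (le_trans (ler_normD _ _)); apply: lerD.
    by apply: sum_bound => j; apply: normM_bound; [exact: YA|exact: w2k].
  apply: normM_bound; first exact: Yy.
  rewrite normrM [`|2^-1|]ger0_norm ?invr_ge0 //; apply: le_trans SB.
  by have := normr_ge0 S; lra.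
have Ykl k : `|Y (ei k) il| <= B6.
  have -> : Y (ei k) il = (w1 (ei k) 0 - (Y (ei k) im - Y (ei k) il)) / 2.
    by rewrite w1i; field.
  have := Ykm k; have := Yy k; rewrite -/w1 -/(B6) normrM [`|2^-1|]ger0_norm ?invr_ge0 //.
  have := ler_normB (w1 (ei k) 0) (Y (ei k) im - Y (ei k) il).
  have := normr_ge0 (w1 (ei k) 0 - (Y (ei k) im - Y (ei k) il)).
  rewrite /B6; lra.
rewrite mxE big_split_l Yll mulr0 addr0 Ylm; apply: lerD.
  apply: (le_trans (ler_norm _)); apply: sum_bound => k; rewrite Ylk.
  by apply: normM_bound.
by apply: (le_trans (ler_norm _)); apply: normM_bound.
Qed.

End Bounds.

(** * Compactness in finite-dimensional spaces *)

Import passmx.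

Section FiniteDim.
Variables (R : realType) (V : vectType R).
Local Notation rV := (rVof (vbasis {:V})).
Local Notation Vr := (vecof (vbasis {:V})).

Lemma rVK : cancel rV Vr. Proof. exact/rVofK/vbasisP. Qed.

Lemma continuous_vecof (W : normedModType R) (phi : V -> W) :
  linear phi -> continuous (phi \o Vr).
Proof.
move=> lphi; apply: continuous_linear_mx => a x y /=.
by rewrite linearP lphi.
Qed.

Lemma fd_image (T : topologicalType) (phi : V -> T) (K : set V) :
  continuous (phi \o Vr) -> fd_compact K -> compact (phi @` K).
Proof.
move=> cphi cK.
have -> : phi @` K = (phi \o Vr) @` [set rV v | v in K].
  apply/seteqP; split=> [_ [v Kv <-]|_ [_ [v Kv <-] <-]].
    by exists (rV v); [exists v|rewrite /= rVK].
  by exists v; rewrite //= rVK.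
apply: continuous_compact => //.
exact: continuous_subspaceT.
Qed.

Lemma compact_real_bound (A : set R) : compact A -> exists B, forall x, A x -> `|x| <= B.
Proof.
move=> /(@compact_bounded _ R^o)[M [_ H]]; exists (M + 1) => x Ax.
by apply: H => //; rewrite ltrDl.
Qed.

Lemma fd_bounded (phi : V -> R^o) (K : set V) : linear phi -> fd_compact K ->
  exists B, forall v, K v -> `|phi v| <= B.
Proof.
move=> lphi cK.
have [|B HB] := @compact_real_bound (phi @` K).
  by apply: fd_image => //; exact: (@continuous_vecof R^o).
by exists B => v Kv; apply: HB; exists v.
Qed.

Lemma compact_real_pos (A : set R) : compact A -> (forall x, A x -> 0 < x) ->
  exists2 d, 0 < d & forall x, A x -> d <= x.
Proof.
move=> cA A0; have clA : closed A by apply: compact_closed => //; exact: Rhausdorff.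
have n0 : nbhs (0 : R) (~` A).
  apply: open_nbhs_nbhs; split; first exact: closed_openC.
  by move=> /A0; rewrite ltxx.
have /nbhs_ballP[d d0 H] := n0; exists d => // x Ax; rewrite leNgt; apply/negP => xd.
apply: (H x) => //; rewrite -ball_normE /ball_ /= sub0r normrN gtr0_norm //.
exact: A0.
Qed.

End FiniteDim.

(** * Bounded conjugators modulo the centraliser of T *)

Section BoundedConjugators.
Variables (R : realType) (m : nat) (G : spinGroup R m).
Local Notation mx := 'M[R]_(m + 2).
Local Notation J := (@Iform R m).
Local Notation SO := (@SOe R m).
Local Notation eps := (@sgJ R m).
Local Notation im := (ordm m).
Local Notation il := (ordl m).
Local Notation v0 := (@nullv R m).
Local Notation H0 := (@H0 R m).
Local Notation ei i := (lshift 2 i).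
Local Notation g := (@so_alg R m).
Local Notation p := (@p_alg R m).

Variables (t : 'I_(m + 2) -> R) (tau : 'I_(m + 2) -> 'I_(m + 2)) (r : 'I_(m + 2)).
Hypothesis td : torus_data t tau r.
Hypothesis odd_m : odd m.
Local Notation T := (hm tau (fun=> 0) t).
Local Notation c := (t im).
Local Notation lam := (lamT t tau).
Local Notation f := (iota_form T).

(** Boosts of the hyperbolic plane centralise T, so [h] is determined by its conjugate only up to
    them. The plane part of the last row of [h] is timelike, and a boost aligns it with the time
    axis. *)
Lemma boost_normal (h : mx) : SO h -> exists h' : mx,
  [/\ SO h', h' *m T *m Linv h' = h *m T *m Linv h & h' il im = 0].
Proof.
move=> Sh; have Oh := SO_O Sh.
pose v' : 'cV[R]_(m + 2) := Linv h *m delta_mx il 0.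
have v'E i : v' i 0 = - (eps i * h il i).
  by rewrite /v' col_ei Linv_entry eps_il mulrN1.
have v'l : v' il 0 = h il il by rewrite v'E eps_il mulN1r opprK.
have v'm : v' im 0 = - h il im by rewrite v'E eps_im mul1r.
have := SO_lm_lt Sh; rewrite ltr_norml => /andP[p1 p2].
have pos1 : 0 < v' il 0 + v' im 0 by rewrite v'l v'm; lra.
have pos2 : 0 < v' il 0 - v' im 0 by rewrite v'l v'm; lra.
(* The Lorentz length of the plane part of [v'], the only time component compatible with a zero [im]
   component. *)
pose a := Num.sqrt ((v' il 0 - v' im 0) * (v' il 0 + v' im 0)).
have a2 : a ^+ 2 = (v' il 0 - v' im 0) * (v' il 0 + v' im 0).
  by rewrite sqr_sqrtr // ltW // mulr_gt0.
have a0 : 0 < a by rewrite sqrtr_gt0 mulr_gt0.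
pose v : 'cV[R]_(m + 2) :=
  \col_i (if i == im then 0 else if i == il then a else v' i 0).
have vE i : i != im -> i != il -> v i 0 = v' i 0.
  by rewrite mxE => /negPf -> /negPf ->.
have vm : v im 0 = 0 by rewrite mxE eqxx.
have vl : v il 0 = a by rewrite mxE eqxx eq_ml.
have [|||||h1 [Sh1 hT hv]] := @torus_element _ _ _ _ _ td v v' (a / (v' il 0 + v' im 0)).
- by rewrite vE ?(r_im td) ?(r_il td).
- by move=> i ir i1 i2; rewrite !vE ?(tau_eqm td) ?(tau_eql td).
- exact: divr_gt0.
- by rewrite vm vl addr0 mulfVK // gt_eqF.
- rewrite vm vl subr0 mulrAC -expr2 a2 mulfK //.
  by rewrite gt_eqF.
have O1 := SO_O Sh1.
exists (h *m Linv h1); split; first by apply: SOM => //; exact: SOV.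
- have LT : Linv h1 *m T *m h1 = T by rewrite -mulmxA -hT mulmxA mulVO // mul1mx.
  by rewrite LinvM LinvK !mulmxA -!(mulmxA h) LT.
have : (Linv (h *m Linv h1) *m delta_mx il 0 : 'cV[R]_(m + 2)) im 0 = 0.
  by rewrite LinvM LinvK -mulmxA -/v' hv vm.
rewrite col_ei Linv_entry eps_im eps_il mulrN1 mul1r => /eqP.
by rewrite oppr_eq0 => /eqP.
Qed.

(** With [h il im = 0], the entry [(Y Y)_ll] is a sum of nonnegative terms, one of which is
    [c^2 h_ll^2]; and [h_ll] controls every entry of a Lorentz matrix, as [h_ij^2 <= 1 + h_ll^2].
    The inequality [x <= x^2 + 1] then accounts for the constant 2. *)
Lemma SO_bound (h : mx) M : SO h -> h il im = 0 ->
  let Y := h *m T *m Linv h in (Y *m Y) il il <= M ->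
  forall i j, `|h i j| <= 2 + M / c ^+ 2.
Proof.
move=> Sh hlm Y YM; have Oh := SO_O Sh.
have gY : Y \in g by apply: conj_so => //; exact: (T_so td).
have c0 := t_im_gt0 td; have c2 : 0 < c ^+ 2 by rewrite exprn_gt0.
have YE : (Y *m Y) il il = qf (Y *m delta_mx il 0).
  rewrite qfE mxE; apply: eq_bigr => i _; rewrite col_ei expr2 mulrA; congr (_ * _).
  have := so_entry gY il i; rewrite eps_il mulN1r opprK => <-.
  by rewrite mulrC -mulrA eps_eps mulr1.
have hl2 : c ^+ 2 * h il il ^+ 2 <= M.
  apply: le_trans YM; rewrite YE /Y -!mulmxA qf_O // (qf_T td).
  have xE i : (Linv h *m delta_mx il 0 : 'cV[R]_(m + 2)) i 0 ^+ 2 = h il i ^+ 2.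
    rewrite col_ei Linv_entry eps_il mulrN1 sqrrN exprMn [eps _ ^+ 2]expr2 eps_eps.
    by rewrite mul1r.
  rewrite big_split_l !xE hlm eps_il (lam_il td) expr0n mulr0 addr0 mulN1r opprK.
  rewrite lerDr sumr_ge0 // => k _; rewrite xE eps_lshift mul1r.
  by rewrite (lam_rot td) ?eq_li // opprK mulr_ge0 ?sqr_ge0.
have hl2' : h il il ^+ 2 <= M / c ^+ 2 by rewrite ler_pdivlMr // mulrC.
have row_l j : h il j ^+ 2 <= h il il ^+ 2.
  have [->//|jl] := eqVneq j il.
  have E := O_row_lE Oh; rewrite E hlm expr0n addr0.
  have [[k ->]|->|jl'] := ord_split j.
  - rewrite (bigD1 k) //= addrCA lerDl addr_ge0 // sumr_ge0 // => a _.
    exact: sqr_ge0.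
  - rewrite hlm expr0n addr_ge0 // sumr_ge0 // => a _; exact: sqr_ge0.
  - by rewrite jl' eqxx in jl.
have ent i j : h i j ^+ 2 <= 1 + h il il ^+ 2.
  have [->|ne] := eqVneq i il.
    by apply: (le_trans (row_l j)); rewrite lerDr.
  have := O_trmx Oh => /matrixP/(_ j j); rewrite -mulmxA mxE big_split_l.
  rewrite !mulJmx eps_im eps_il ![h^T _ _]mxE.
  under eq_bigr do rewrite mulJmx eps_lshift mul1r mxE -expr2.
  have Jle : J j j <= 1.
    by rewrite IformE !mxE eqxx mulr1n /sgJ; case: ifP => // _; lra.
  move=> E; have := row_l j; rewrite expr2 => rl.
  have S0 : 0 <= \sum_k h (ei k) j ^+ 2 by rewrite sumr_ge0 // => k _; exact: sqr_ge0.
  have := sqr_ge0 (h im j); rewrite expr2 => m0.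
  have [[k ik]|ik|ik] := ord_split i; last by rewrite ik eqxx in ne.
  - have : h (ei k) j ^+ 2 <= \sum_k h (ei k) j ^+ 2.
      by rewrite [leRHS](bigD1 k) //= lerDl sumr_ge0 // => a _; exact: sqr_ge0.
    rewrite ik => hk; lra.
  - by rewrite ik expr2; lra.
move=> i j; have := ent i j; rewrite -real_normK ?num_real //.
by move: (`|_|) => x; have := sqr_ge0 (x - 1); nra.
Qed.

End BoundedConjugators.

(** * Weak properness and failure of properness *)

Import passmx.

Section ProperMoment.
Variables (R : realType) (m : nat) (G : spinGroup R m).
Local Notation mx := 'M[R]_(m + 2).
Local Notation J := (@Iform R m).
Local Notation SO := (@SOe R m).
Local Notation eps := (@sgJ R m).
Local Notation im := (ordm m).
Local Notation il := (ordl m).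
Local Notation v0 := (@nullv R m).
Local Notation H0 := (@H0 R m).
Local Notation ei i := (lshift 2 i).
Local Notation g := (@so_alg R m).
Local Notation p := (@p_alg R m).

Variables (t : 'I_(m + 2) -> R) (tau : 'I_(m + 2) -> 'I_(m + 2)) (r : 'I_(m + 2)).
Hypothesis td : torus_data t tau r.
Hypothesis odd_m : odd m.
Local Notation T := (hm tau (fun=> 0) t).
Local Notation c := (t im).
Local Notation f := (iota_form T).

Lemma iota_form_linear : linear (@iota_form R m).
Proof.
move=> a X Y; apply/lfunP => Z; rewrite add_lfunE scale_lfunE !iotaE.
by rewrite mulmxDl -scalemxAl linearD linearZ /= mulrDr mulrCA.
Qed.

Lemma moment_linearf : linear (@moment R m).
Proof.
move=> a h k; apply/lfunP => Z.
by rewrite add_lfunE scale_lfunE !momentE add_lfunE scale_lfunE.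
Qed.

Lemma eval_linear (U : {vspace mx}) (Z : subvs_of U) :
  linear (fun h : dualsp U => h Z : R^o).
Proof. by move=> a h k; rewrite add_lfunE scale_lfunE. Qed.

Definition rot_gen (i j : 'I_m) : mx := ulblock (delta_mx i j - delta_mx j i).

Lemma ulblock_delta i j : ulblock (delta_mx i j) = delta_mx (ei i) (ei j) :> mx.
Proof.
apply/matrixP => a b; rewrite [RHS]mxE.
have [[k ->]|->|->] := ord_split a; have [[l ->]|->|->] := ord_split b;
  rewrite ?ulblockE ?eq_li ?andbF //.
by rewrite mxE !(inj_eq (@lshift_inj _ _)).
Qed.

Lemma rot_gen_p i j : rot_gen i j \in p.
Proof.
apply/mem_p; split; last by exists 0; rewrite ulblock_v0 scale0r.
by apply: ulblock_so; rewrite linearB /= !trmx_delta addrA subrK subrr.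
Qed.

Lemma H0_p : H0 \in p.
Proof. by apply/mem_p; split; [exact: H0_so|exists 1; rewrite H0_v0 scale1r]. Qed.

Lemma Xn_p alpha : Xn alpha \in p.
Proof. by apply/mem_p; split; [exact: Xn_in_so|exists 0; rewrite Xn_v0 scale0r]. Qed.

Lemma eval_p (Y : mx) Z : Z \in p ->
  moment (iota_form Y) (vsproj p Z) = 2^-1 * \tr (Y *m Z).
Proof. by move=> pZ; rewrite moment_iotaE vsprojK. Qed.

Lemma eval_rot_gen (Y : mx) i j : Y \in g ->
  moment (iota_form Y) (vsproj p (rot_gen i j)) = - Y (ei i) (ei j).
Proof.
move=> gY; rewrite eval_p ?rot_gen_p // /rot_gen.
have -> : ulblock (delta_mx i j - delta_mx j i) =
    delta_mx (ei i) (ei j) - delta_mx (ei j) (ei i) :> mx.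
  by rewrite -!ulblock_delta; exact: linearB.
rewrite mulmxBr linearB /= !mxtrace_delta.
have := so_entry gY (ei i) (ei j); rewrite !eps_lshift mulr1 mul1r => ->.
by field.
Qed.

Lemma eval_H0 (Y : mx) : Y \in g -> moment (iota_form Y) (vsproj p H0) = Y im il.
Proof.
move=> gY; rewrite eval_p ?H0_p // tr_H0.
have := so_entry gY im il; rewrite eps_il eps_im => E.
have -> : Y il im = Y im il by lra.
by field.
Qed.

Lemma eval_Xn (Y : mx) k : Y \in g ->
  moment (iota_form Y) (vsproj p (Xn (delta_mx 0 k))) = (Y *m v0) (ei k) 0.
Proof.
move=> gY; rewrite eval_p ?Xn_p // tr_so_Xn // mulKf ?pnatr_eq0 //.
rewrite (bigD1 k) //= big1 => [|j /negPf jk]; last by rewrite mxE jk andbF mul0r.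
by rewrite [delta_mx _ _ _ _]mxE !eqxx mul1r addr0.
Qed.

Lemma conj_T_so (h : mx) : SO h -> h *m T *m Linv h \in g.
Proof. by move=> Sh; apply: conj_so; [exact: SO_O|exact: (T_so td)]. Qed.

Lemma so_v0_eigen (Y : mx) : Y \in g -> (forall k, (Y *m v0) (ei k) 0 = 0) ->
  Y *m v0 = Y im il *: v0.
Proof.
move=> gY Yk; apply/colP => i; rewrite [RHS]mxE.
have [[k ->]|->|->] := ord_split i; first by rewrite Yk v0_entries mulr0.
  rewrite /nullv mulmxDr mxE !col_ei -/v0 v0_entries mulr1.
  by have := so_entry gY im im; rewrite eps_im; lra.
rewrite /nullv mulmxDr mxE !col_ei -/v0 v0_entries mulr1.
have := so_entry gY il il; have := so_entry gY il im; rewrite eps_im eps_il; lra.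
Qed.

Lemma weakly_proper_T : weakly_proper G f.
Proof.
move=> K cK Ksub; rewrite /fd_compact.
have KE h : K h -> exists x : G, h = moment (iota_form (cov x *m T *m Linv (cov x))).
  by move=> /Ksub[[u /orbit_iota[x ->] <-] _]; exists x.
have bZ (Z : mx) : exists B, forall h, K h -> `|h (vsproj p Z)| <= B.
  exact: (fd_bounded (eval_linear (vsproj p Z)) cK).
have [bd bdP] := choice bZ.
pose B := \sum_i \sum_j `|bd (rot_gen i j)| + `|bd H0| +
  \sum_k `|bd (Xn (delta_mx 0 k))|.
(* The squared length of the restriction to n, which for the form of Y is the squared length of the
   Euclidean part of [Y *m v0]. *)
pose Phi (h : dualsp p) : R := \sum_k h (vsproj p (Xn (delta_mx 0 k))) ^+ 2.
have cPhi : compact (Phi @` K).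
  apply: fd_image cK; rewrite /Phi.
  apply: (@continuous_sumr R _ R^o) => k _ w.
  have ce := @continuous_vecof _ _ R^o _ (eval_linear (vsproj p (Xn (delta_mx 0 k)))).
  apply: (@continuous_comp _ _ _ _ (fun x : R^o => x ^+ 2)); first exact: ce.
  exact: exprn_continuous.
have [d d0 dP] : exists2 d, 0 < d & forall h, K h -> d <= Phi h.
  have [x|d d0 H] := compact_real_pos cPhi; last first.
    by exists d => // h Kh; apply: H; exists h.
  move=> [h Kh <-]; have [y hE] := KE h Kh.
  have gY := conj_T_so (cov_SO y).
  rewrite lt_neqAle sumr_ge0 ?andbT => [|k _]; last exact: sqr_ge0.
  rewrite eq_sym; apply/negP; rewrite psumr_eq0 => [/allP H|k _]; last exact: sqr_ge0.
  have [_ [reg _]] := Ksub h Kh; rewrite hE in reg.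
  apply: (regular_neq0 odd_m gY reg); eexists; apply: so_v0_eigen => // k.
  have := H k; rewrite mem_index_enum => /(_ isT).
  by rewrite sqrf_eq0 hE eval_Xn // => /eqP.
have [M HM] := Yll_bound td B d0.
pose bnd := 2 + M / c ^+ 2.
(* Matrices are coded as row vectors, so that bounding all entries describes a product of
   segments. *)
pose N := ((m + 2) * (m + 2))%N.
pose cT (w : 'rV[R]_N) : mx := vec_mx w *m T *m Linv (vec_mx w).
have c_vec : continuous (fun w : 'rV[R]_N => vec_mx w : mx).
  by apply: continuous_linear_mx => a u v; rewrite linearP.
have c_cT : continuous cT.
  apply: continuous_mulmx.
    by apply: continuous_mulmx => //; exact: continuous_cstf.
  rewrite (_ : (fun w => _) = fun w => J *m (vec_mx w)^T *m J); last first.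
    by apply/funext => w; rewrite LinvE.
  apply: continuous_mulmx; last exact: continuous_cstf.
  by apply: continuous_mulmx; [exact: continuous_cstf|exact: continuous_trmx].
pose rg (u : dualsp g) := rVof (vbasis {:dualsp g}) u.
pose rp (u : dualsp p) := rVof (vbasis {:dualsp p}) u.
have c_rg : continuous (fun w => rg (iota_form (cT w))).
  move=> w; apply: (@continuous_comp _ _ _ cT (fun X => rg (iota_form X))).
    exact: c_cT.
  apply: continuous_linear_mx => a X Y.
  by rewrite iota_form_linear /rg linearP.
have c_rp : continuous (fun w => rp (moment (iota_form (cT w)))).
  move=> w; apply: (@continuous_comp _ _ _ cT (fun X => rp (moment (iota_form X)))).
    exact: c_cT.
  apply: continuous_linear_mx => a X Y.
  by rewrite iota_form_linear moment_linearf /rp linearP.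
pose Kr := [set rp h | h in K].
(* Codes of bounded conjugators in the identity component whose form has its image in [K]: a closed
   subset of a compact box. *)
pose C : set 'rV[R]_N :=
  [set w : 'rV[R]_N | forall i, `[(- bnd), bnd]%classic (w ord0 i)] `&`
  ([set w : 'rV[R]_N | SO (vec_mx w)] `&`
    [set w : 'rV[R]_N | Kr (rp (moment (iota_form (cT w))))]).
have cC : compact C.
  apply: compact_closedI.
    apply: (@rV_compact R^o _ (fun=> `[(- bnd), bnd]%classic)) => i.
    exact: segment_compact.
  apply: closedI.
    by have /continuous_closedP := c_vec; apply; exact: closed_SO.
  have /continuous_closedP := c_rp; apply.
  by apply: compact_closed cK; exact: norm_hausdorff.
have -> : [set rVof (vbasis {:dualsp g}) v |
             v in coadjoint_orbit G f `&` @moment R m @^-1` K] =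
    [set rg (iota_form (cT w)) | w in C].
  apply/seteqP; split=> [_ [u [/orbit_iota[x ->] Ku] <-]|_ [w [_ [Sw Kw]] <-]]; last first.
    have [x xw] := cov_surj G Sw.
    exists (iota_form (cT w)) => //; split.
      by exists x => //; rewrite coad_iota AdE xw.
    by case: Kw => h Kh /(can_inj (@rVK _ _)) E; rewrite /preimage /= -E.
  (* The given conjugator may be arbitrarily large; only its boost-normalised replacement is
     bounded. *)
  have [h [Sh hE hlm]] := boost_normal td (cov_SO x).
  rewrite -hE in Ku *.
  have gY := conj_T_so Sh.
  exists (mxvec h); last by rewrite /cT mxvecK.
  split; last first.
    rewrite /= /cT mxvecK; split => //.
    by exists (moment (iota_form (h *m T *m Linv h))).
  have BZ (Z : mx) := bdP Z _ Ku.
  have pos1 : 0 <= \sum_i \sum_j `|bd (rot_gen i j)|.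
    by apply: sumr_ge0 => i _; apply: sumr_ge0.
  have pos3 : 0 <= \sum_k `|bd (Xn (delta_mx 0 k))| by apply: sumr_ge0.
  have YM : ((h *m T *m Linv h) *m (h *m T *m Linv h)) il il <= M.
    apply: HM => //.
    - move=> i j; have := BZ (rot_gen i j); rewrite eval_rot_gen // normrN => /le_trans.
      apply; apply: (le_trans (ler_norm _)).
      rewrite /B -addrA (bigD1 i) //= (bigD1 j) //= -!addrA lerDl !addr_ge0 ?sumr_ge0 //.
      by move=> k _; apply: sumr_ge0.
    - have := BZ H0; rewrite eval_H0 // => /le_trans; apply.
      by apply: (le_trans (ler_norm _)); rewrite /B; lra.
    - move=> k; have := BZ (Xn (delta_mx 0 k)); rewrite eval_Xn // => /le_trans; apply.
      have le_k : `|bd (Xn (delta_mx 0 k))| <= \sum_k `|bd (Xn (delta_mx 0 k))|.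
        by rewrite [leRHS](bigD1 k) //= lerDl sumr_ge0.
      apply: (le_trans (ler_norm _)); rewrite /B.
      by have := normr_ge0 (bd H0); lra.
    - apply: (le_trans (dP _ Ku)); rewrite /Phi le_eqVlt; apply/orP; left; apply/eqP.
      by apply: eq_bigr => k _; rewrite eval_Xn.
  move=> q; rewrite /= in_itv /= -ler_norml.
  have -> : mxvec h ord0 q = h (enum_val (cast_ord (esym (mxvec_cast _ _)) q)).1
      (enum_val (cast_ord (esym (mxvec_cast _ _)) q)).2.
    by case/mxvec_indexP: q => i j; rewrite mxvecE /mxvec_index cast_ordK enum_rankK.
  exact: (SO_bound td Sh hlm YM).
by apply: continuous_compact => //; exact: continuous_subspaceT.
Qed.

Lemma T_v0 : T *m v0 = c *: v0.
Proof.
apply/colP => i; rewrite T_col [RHS]mxE.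
have [[k ->]|->|->] := ord_split i.
- by have [j ->] := tau_lshift td k; rewrite !v0_entries !mulr0.
- by rewrite (tau_im td) !v0_entries.
- by rewrite (tau_il td) (t_il td) !v0_entries.
Qed.

Lemma r_lshift : exists k : 'I_m, r = ei k.
Proof.
have [[k ->]|E|E] := ord_split r; first by exists k.
  by have := r_im td; rewrite E eqxx.
by have := r_il td; rewrite E eqxx.
Qed.

(** The direction [k] spans ker T and [v0] has eigenvalue [c], so [[X, T] = - c X] for
    [X = Xn (delta_mx 0 k)]. Conjugation by the exponential of [a X] therefore moves T by exactly
    [- c a X]. *)
Lemma orbit_unbounded k (a : R) : r = ei k ->
  coadjoint_orbit G f (iota_form (T - (c * a) *: Xn (delta_mx 0 k))).
Proof.
move=> rk.
have we : emb (delta_mx 0 k) = delta_mx r 0 :> 'cV[R]_(m + 2).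
  apply/colP => i; rewrite [RHS]mxE andbT rk.
  have [[b ->]|->|->] := ord_split i; rewrite ?embE ?eq_li //.
  by rewrite mxE /= (inj_eq (@lshift_inj _ _)).
set X := Xn (delta_mx 0 k).
have Tw : T *m emb (delta_mx 0 k) = 0.
  apply/colP => i; rewrite T_col we !mxE andbT (tau_eqr td).
  by case: eqP => [->|_]; rewrite ?(t_r td) ?mul0r ?mulr0.
have skewT : J *m T = - (T^T *m J).
  have := so_so (T_so td) => /(congr1 (fun M => J *m M *m J)).
  rewrite mulmxDr mulmxDl mulmx0 mul0mx !mulmxA JJ mul1mx -mulmxA JJ mulmx1.
  by move/eqP; rewrite addr_eq0 => /eqP.
have XT : X *m T = T *m X - c *: X.
  have JTr (u : 'cV[R]_(m + 2)) : u^T *m J *m T = - ((T *m u)^T *m J).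
    by rewrite -mulmxA skewT mulmxN trmx_mul mulmxA.
  have XE : X = v0 *m (emb (delta_mx 0 k))^T *m J - emb (delta_mx 0 k) *m v0^T *m J.
    by rewrite /X XnE mulmxBl.
  rewrite XE mulmxBl mulmxBr -![_ *m J *m T]mulmxA.
  have -> : v0 *m (emb (delta_mx 0 k))^T *m (J *m T) = 0.
    by rewrite -mulmxA (mulmxA _^T) JTr Tw trmx0 mul0mx oppr0 mulmx0.
  have -> : emb (delta_mx 0 k) *m v0^T *m (J *m T) =
      - (c *: (emb (delta_mx 0 k) *m v0^T *m J)).
    rewrite -mulmxA (mulmxA _^T) JTr T_v0 mulmxN; congr (- _).
    have -> : (c *: v0)^T = c *: v0^T by exact: linearZ.
    by rewrite -scalemxAl -scalemxAr mulmxA.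
  rewrite !mulmxA T_v0 Tw !mul0mx subr0 sub0r opprK -!scalemxAl.
  by rewrite scalerBr opprB addrC subrK.
have Sn := Nmx_SO (a *: delta_mx 0 k : 'rV[R]_m).
have [x xE] := cov_surj G Sn.
exists x => //; rewrite coad_iota AdE xE; congr iota_form.
have On := SO_O Sn.
suff E : Nmx (a *: delta_mx 0 k) *m T = (T - (c * a) *: X) *m Nmx (a *: delta_mx 0 k).
  by rewrite E -mulmxA mulOV // mulmx1.
have XaE : Xn (a *: delta_mx 0 k : 'rV[R]_m) = a *: X by exact: linearZ.
have X3 : X *m (X *m X) = 0 by exact: Xn3.
have XXT : X *m X *m T = T *m X *m X - (2 * c) *: (X *m X).
  rewrite -mulmxA XT mulmxBr mulmxA XT mulmxBl -scalemxAl -scalemxAr.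
  by rewrite -addrA -opprD -scalerDl mulrDl !mul1r.
have X3' : X *m X *m X = 0 by rewrite -mulmxA.
rewrite /Nmx XaE !(mulmxDl, mulmxDr, mulNmx, mul1mx, mulmx1) -!scalemxAl -!scalemxAr.
rewrite !mulmxA -!scalemxAl X3' XXT XT; clear XT XXT X3 X3' XaE.
move: (T *m X *m X) (X *m X) (T *m X) => A1 A2 A3; move: T X => A4 A5.
by apply/matrixP => i j; rewrite !mxE; field.
Qed.

Lemma not_proper_T : ~ proper_moment G f.
Proof.
move=> H; have [k rk] := r_lshift.
set X := Xn (delta_mx 0 k : 'rV[R]_m).
have cK : fd_compact [set moment f].
  by rewrite /fd_compact image_set1; exact: compact_set1.
(* [X^T] lies in the opposite nilradical and [tr (X X^T) = 4], so evaluation at it is a nonconstant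
   affine function along the line, while the image in the dual of p is constant. *)
have [B HB] := fd_bounded (eval_linear (vsproj g X^T)) (H _ cK).
pose u a := iota_form (T - (c * a) *: X).
have uB a : `|u a (vsproj g X^T)| <= B.
  apply: HB; split; first exact: orbit_unbounded.
  apply/lfunP => Z; rewrite !moment_iotaE mulmxBl -scalemxAl linearB linearZ /=.
  by rewrite tr_Xn_p ?mulr0 ?subr0 //; exact: subvsP.
have gX : X^T \in g by exact: trXn_so.
have trXX : \tr (X *m X^T) = 4.
  rewrite mxtrace_mulC tr_so_Xn // trXn_v0 (bigD1 k) //= big1 => [|j /negPf jk].
    have -> (b : R) (w : 'cV[R]_(m + 2)) i : (b *: w) i 0 = b * w i 0 by rewrite mxE.
    by rewrite embE !mxE !eqxx /= mulr1n; ring.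
  by rewrite mxE jk andbF mul0r.
pose q := 2^-1 * \tr (T *m X^T).
have uE a : u a (vsproj g X^T) = q - 2 * (c * a).
  by rewrite /u iotaE vsprojK // mulmxBl -scalemxAl linearB linearZ /= trXX /q; field.
have c0 := t_im_gt0 td.
(* At this parameter the value is [q - 2 (|q| + |B| + 1)], which is below [- B]. *)
have := uB ((`|q| + `|B| + 1) / c); rewrite uE [c * _]mulrC mulfVK ?gt_eqF //.
have := ler_norm q; have := ler_norm B; have := ler_norm (- q); rewrite normrN.
rewrite ler_norml; lra.
Qed.

End ProperMoment.

(** * The element [t'_a] *)

Section Tprime.
Variables (R : realType) (n : nat) (a : 'I_n -> R).
Hypothesis n2 : (2 <= n)%N.
Hypothesis a_decr : forall i j : 'I_n, (i < j)%N -> (j.+1 < n)%N -> a j < a i.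
Hypothesis a_gt0 : forall i : 'I_n, 0 < a i.

Local Notation m := (2 * n).-1.
Local Notation I := 'I_(m + 2).
Local Notation eps := (@sgJ R m).

(** Extension by 0 to all naturals, so that indices can be computed without bound proofs. *)
Definition aN (k : nat) : R := oapp a 0 (insub k).

Lemma aNE (k : 'I_n) : aN k = a k.
Proof. by rewrite /aN valK. Qed.

Lemma aN_gt0 k : (k < n)%N -> 0 < aN k.
Proof. by move=> kn; rewrite -[k]/(val (Ordinal kn)) aNE. Qed.

Lemma aN_decr k l : (k < l)%N -> (l.+1 < n)%N -> aN l < aN k.
Proof.
move=> kl ln; have ln' : (l < n)%N by exact: ltnW.
have kn : (k < n)%N by exact: ltn_trans ln'.
by rewrite -[k]/(val (Ordinal kn)) -[l]/(val (Ordinal ln')) !aNE; exact: a_decr.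
Qed.

Lemma aN_inj k l : (k.+1 < n)%N -> (l.+1 < n)%N -> aN k = aN l -> k = l.
Proof.
move=> kn ln E; case: (ltngtP k l) => // kl.
  by have := aN_decr kl ln; rewrite E ltxx.
by have := aN_decr kl kn; rewrite E ltxx.
Qed.

Definition tauN (i : nat) : nat :=
  if (i < (2 * n).-2)%N then (if odd i then i.-1 else i.+1)
  else if i == (2 * n).-2 then i else if i == (2 * n).-1 then (2 * n)%N else (2 * n).-1.

Definition tN (i : nat) : R :=
  if (i < (2 * n).-2)%N then (if odd i then - aN i./2 else aN i./2)
  else if i == (2 * n).-2 then 0 else aN n.-1.

(** One case for each kind of coordinate: the two of a rotation block, the zero, the two of the
    hyperbolic block. The indices of the family make a case analysis replace [tauN i] and [tN i] by
    their values. *)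
Inductive index_spec (i : nat) : nat -> R -> Type :=
  | IndexEven q of (q.+1 < n)%N & i = (2 * q)%N : index_spec i (2 * q).+1 (aN q)
  | IndexOdd q of (q.+1 < n)%N & i = (2 * q).+1 : index_spec i (2 * q) (- aN q)
  | IndexZero of i = (2 * n).-2 : index_spec i (2 * n).-2 0
  | IndexM of i = (2 * n).-1 : index_spec i (2 * n) (aN n.-1)
  | IndexL of i = (2 * n)%N : index_spec i (2 * n).-1 (aN n.-1).

Lemma indexP i : (i < m + 2)%N -> index_spec i (tauN i) (tN i).
Proof.
move=> im; rewrite /tauN /tN; case: ltnP => i1.
  have iE := odd_double_half i; rewrite -mul2n in iE; case: (boolP (odd i)) => oi.
    rewrite oi add1n in iE.
    have -> : i.-1 = (2 * i./2)%N by rewrite -[in LHS]iE.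
    by apply: IndexOdd => //; lia.
  rewrite (negPf oi) add0n in iE; rewrite -[in X in index_spec _ X]iE.
  by apply: IndexEven => //; lia.
case: eqP => [->|i2]; first exact: IndexZero.
case: eqP => [->|i3]; first exact: IndexM.
by apply: IndexL; lia.
Qed.

Lemma tauN_lt i : (i < m + 2)%N -> (tauN i < m + 2)%N.
Proof. by move=> im; case: (indexP im) => [q ? ?|q ? ?|?|?|?]; lia. Qed.

Definition tau (i : I) : I := Ordinal (tauN_lt (ltn_ord i)).
Definition tvec (i : I) : R := tN i.

Lemma tprimeE : tprime a = hm tau (fun=> 0) tvec.
Proof.
apply/matrixP => i j; rewrite summxE [RHS]mxE mul0rn add0r -val_eqE /= /tvec.
pose F (k : 'I_n) : R := a k * (if (k.+1 < n)%N
  then ((i == (2 * k)%N :> nat) && (j == (2 * k)%N.+1 :> nat))%:R -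
       ((i == (2 * k)%N.+1 :> nat) && (j == (2 * k)%N :> nat))%:R
  else ((i == (2 * n)%N.-1 :> nat) && (j == (2 * n)%N :> nat))%:R +
       ((i == (2 * n)%N :> nat) && (j == (2 * n)%N.-1 :> nat))%:R).
rewrite (eq_bigr F) => [|k _]; last by rewrite /F mxE; case: ifP => _; rewrite !mxE.
(* A row of the matrix receives entries from a single summand, that of its own block. *)
have sumF (k0 : nat) (b : bool) (x : R) (k0n : (k0 < n)%N) :
    (forall k : 'I_n, F k = if k == k0 :> nat then x *+ b else 0) -> \sum_k F k = x *+ b.
  move=> FE; rewrite (bigD1 (Ordinal k0n)) //= big1 => [|k kk0].
    by rewrite FE eqxx addr0.
  by rewrite FE; move: kk0; rewrite -val_eqE /= => /negPf ->.
case: (indexP (ltn_ord i)) => [q qn iE|q qn iE|iE|iE|iE].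
- apply: (sumF q) => [|k]; first by lia.
  rewrite /F iE; case: (ltnP k.+1 n) => kn.
    have -> : (2 * q == (2 * k).+1)%N = false by lia.
    rewrite subr0; have [kq|kq] := eqVneq (k : nat) q.
      by rewrite kq eqxx -aNE kq mulr_natr.
    have -> : (2 * q == 2 * k)%N = false by lia.
    by rewrite mulr0.
  have -> : (2 * q == (2 * n).-1)%N = false by lia.
  have -> : (2 * q == 2 * n)%N = false by lia.
  have -> : (k == q :> nat) = false by lia.
  by rewrite addr0 mulr0.
- apply: (sumF q) => [|k]; first by lia.
  rewrite /F iE; case: (ltnP k.+1 n) => kn.
    have -> : ((2 * q).+1 == 2 * k)%N = false by lia.
    rewrite sub0r; have [kq|kq] := eqVneq (k : nat) q.
      by rewrite kq eqxx -aNE kq mulrN mulNrn mulr_natr.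
    have -> : ((2 * q).+1 == (2 * k).+1)%N = false by lia.
    by rewrite oppr0 mulr0.
  have -> : ((2 * q).+1 == (2 * n).-1)%N = false by lia.
  have -> : ((2 * q).+1 == 2 * n)%N = false by lia.
  have -> : (k == q :> nat) = false by lia.
  by rewrite addr0 mulr0.
- rewrite mul0rn big1 // => k _; rewrite /F iE; case: (ltnP k.+1 n) => kn.
    have -> : ((2 * n).-2 == 2 * k)%N = false by lia.
    have -> : ((2 * n).-2 == (2 * k).+1)%N = false by lia.
    by rewrite subr0 mulr0.
  have -> : ((2 * n).-2 == (2 * n).-1)%N = false by lia.
  have -> : ((2 * n).-2 == 2 * n)%N = false by lia.
  by rewrite addr0 mulr0.
- apply: (sumF n.-1) => [|k]; first by lia.
  rewrite /F iE eqxx; case: (ltnP k.+1 n) => kn.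
    have -> : ((2 * n).-1 == 2 * k)%N = false by lia.
    have -> : ((2 * n).-1 == (2 * k).+1)%N = false by lia.
    have -> : (k == n.-1 :> nat) = false by lia.
    by rewrite subr0 mulr0.
  have kE : k = n.-1 :> nat by have := ltn_ord k; lia.
  have -> : ((2 * n).-1 == 2 * n)%N = false by lia.
  by rewrite kE eqxx addr0 -aNE kE mulr_natr.
- apply: (sumF n.-1) => [|k]; first by lia.
  rewrite /F iE eqxx; case: (ltnP k.+1 n) => kn.
    have -> : (2 * n == 2 * k)%N = false by lia.
    have -> : (2 * n == (2 * k).+1)%N = false by lia.
    have -> : (k == n.-1 :> nat) = false by lia.
    by rewrite subr0 mulr0.
  have kE : k = n.-1 :> nat by have := ltn_ord k; lia.
  have -> : (2 * n == (2 * n).-1)%N = false by lia.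
  by rewrite kE eqxx add0r -aNE kE mulr_natr.
Qed.

Lemma tauNK i : (i < m + 2)%N -> tauN (tauN i) = i.
Proof.
move=> im; have := tauN_lt im.
case: (indexP im) => [q qn iE|q qn iE|iE|iE|iE] im';
  case: (indexP im') => [q' ? ?|q' ? ?|?|?|?]; lia.
Qed.

Lemma tN_tauN i : (i < (2 * n).-1)%N -> tN (tauN i) = - tN i.
Proof.
move=> i1; have im : (i < m + 2)%N by lia.
have := tauN_lt im; case: (indexP im) => [q qn iE|q qn iE|iE|iE|iE] im'.
- by case: (indexP im') => [q' ? ?|q' ? ?|?|?|?]; [exfalso; lia|congr (- aN _); lia|..];
    exfalso; lia.
- by rewrite opprK; case: (indexP im') => [q' ? ?|q' ? ?|?|?|?]; [congr aN; lia|..];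
    exfalso; lia.
- by rewrite oppr0; case: (indexP im') => [q' ? ?|q' ? ?|//|?|?]; exfalso; lia.
- by exfalso; lia.
- by exfalso; lia.
Qed.

Lemma tN_tauN_hyp i : (i < m + 2)%N -> ((2 * n).-1 <= i)%N -> tN (tauN i) = tN i.
Proof.
move=> im i1.
have := tauN_lt im; case: (indexP im) => [q qn iE|q qn iE|iE|iE|iE] im'.
- by exfalso; lia.
- by exfalso; lia.
- by exfalso; lia.
- by case: (indexP im') => [q' ? ?|q' ? ?|?|//|//]; exfalso; lia.
- by case: (indexP im') => [q' ? ?|q' ? ?|?|//|//]; exfalso; lia.
Qed.

Lemma tN_sqr i : (i < m + 2)%N -> tN i * tN (tauN i) =
  if (i < (2 * n).-1)%N then - tN i ^+ 2 else aN n.-1 ^+ 2.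
Proof.
move=> im; case: ltnP => i1; first by rewrite tN_tauN // mulrN.
rewrite tN_tauN_hyp //.
by case: (indexP im) => [q qn iE|q qn iE|iE|//|//]; exfalso; lia.
Qed.

Lemma r_lt : ((2 * n).-2 < m + 2)%N. Proof. by lia. Qed.

Lemma eps_rot (i : I) : (i < (2 * n).-1)%N -> eps i = 1.
Proof.
by move=> i1; rewrite /sgJ -val_eqE /=; case: eqP => // iE; exfalso; lia.
Qed.

Lemma eps_hyp (i : I) : ((2 * n).-1 <= i)%N -> eps (tau i) = - eps i.
Proof.
move=> i1; rewrite /sgJ -!val_eqE /=.
by case: (indexP (ltn_ord i)) => [q qn iE|q qn iE|iE|iE|iE];
  case: ifP => /eqP E1; case: ifP => /eqP E2; rewrite ?opprK //; exfalso; lia.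
Qed.

(** The products are [- a_q^2] on rotation blocks, 0 on the zero coordinate and [a_n^2] on the
    hyperbolic block. The sign separates the last from the others even if [a_n] equals some [a_q];
    strict decrease and positivity separate the rest. *)
Lemma tN_inj i j : (i < m + 2)%N -> (j < m + 2)%N ->
  tN i * tN (tauN i) = tN j * tN (tauN j) -> j = i \/ j = tauN i.
Proof.
have an : 0 < aN n.-1 by apply: aN_gt0; lia.
have hyp0 (x : R) : - x ^+ 2 != aN n.-1 ^+ 2.
  by rewrite lt_eqF // (@le_lt_trans _ _ 0) ?oppr_le0 ?sqr_ge0 ?exprn_gt0.
move=> im jm; rewrite !tN_sqr //; case: ltnP => i1; case: ltnP => j1; first last.
- by move=> _; case: (indexP im) => *; lia.
- by move/eqP; rewrite eq_sym (negPf (hyp0 _)).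
- by move/eqP; rewrite (negPf (hyp0 _)).
move/oppr_inj/eqP; rewrite eqf_sqr.
have pos q : (q.+1 < n)%N -> 0 < aN q by move=> qn; apply: aN_gt0; lia.
case: (indexP im) => [q qn iE|q qn iE|iE|iE|iE];
  case: (indexP jm) => [q' qn' jE|q' qn' jE|jE|jE|jE] E; try by exfalso; lia.
- have E' : aN q = aN q'.
    by have := pos _ qn; have := pos _ qn'; case/orP: E => /eqP; lra.
  by have := aN_inj qn qn' E'; lia.
- have E' : aN q = aN q'.
    by have := pos _ qn; have := pos _ qn'; case/orP: E => /eqP; lra.
  by have := aN_inj qn qn' E'; lia.
- by exfalso; have := pos _ qn; case/orP: E => /eqP; lra.
- have E' : aN q = aN q'.
    by have := pos _ qn; have := pos _ qn'; case/orP: E => /eqP; lra.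
  by have := aN_inj qn qn' E'; lia.
- have E' : aN q = aN q'.
    by have := pos _ qn; have := pos _ qn'; case/orP: E => /eqP; lra.
  by have := aN_inj qn qn' E'; lia.
- by exfalso; have := pos _ qn; case/orP: E => /eqP; lra.
- by exfalso; have := pos _ qn'; case/orP: E => /eqP; lra.
- by exfalso; have := pos _ qn'; case/orP: E => /eqP; lra.
- by left; lia.
Qed.

Definition rord : I := Ordinal r_lt.

Lemma torus_data_tprime : torus_data tvec tau rord.
Proof.
have val_tau i : tau i = tauN i :> nat by [].
split.
- by move=> i; apply/val_inj; exact: tauNK.
- apply/val_inj; change (tauN (ordm m) = ordl m :> nat).
  by case: (indexP (ltn_ord (ordm m)))
    => [q qn /= iE|q qn /= iE|/= iE|/= iE|/= iE] /=; lia.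
- apply/val_inj; change (tauN (2 * n).-2 = (2 * n).-2).
  by case: (indexP r_lt) => [q qn iE|q qn iE|iE|iE|iE]; lia.
- move=> i /(congr1 val) /= E; apply/val_inj => /=; move: E.
  by case: (indexP (ltn_ord i)) => [q qn iE|q qn iE|iE|iE|iE]; lia.
- by rewrite /tvec; case: (indexP r_lt) => [q qn /= iE|q qn /= iE|//|/= iE|/= iE];
    exfalso; lia.
- move=> i ir; rewrite /tvec.
  have ir' : (i : nat) <> (2 * n).-2 by move=> E; case/eqP: ir; exact/val_inj.
  by case: (indexP (ltn_ord i)) => [q qn iE|q qn iE|iE|iE|iE] //;
    rewrite ?oppr_eq0 gt_eqF // aN_gt0 //; lia.
- move=> i; rewrite /tvec val_tau; have [i1|i1] := ltnP i (2 * n).-1.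
    rewrite tN_tauN // !eps_rot ?mulr1 //= .
    by case: (indexP (ltn_ord i)) => [q qn iE|q qn iE|iE|iE|iE]; lia.
  by rewrite tN_tauN_hyp // eps_hyp // mulrN.
- move=> i j; rewrite /tvec !val_tau => /(tN_inj (ltn_ord i) (ltn_ord j))[] E.
    by left; exact/val_inj.
  by right; exact/val_inj.
- rewrite /tvec; case: (indexP (ltn_ord (ordm m))) => [q qn /= iE|q qn /= iE|/= iE|_|_].
  + by exfalso; lia.
  + by exfalso; lia.
  + by exfalso; lia.
  + by apply: aN_gt0; lia.
  + by apply: aN_gt0; lia.
Qed.

End Tprime.

Theorem proposition5p11 (R : realType) (n : nat) (hn : (2 <= n)%N)
    (G : spinGroup R (2 * n).-1) (a : 'I_n -> R)
    (a_decr : forall i j : 'I_n, (i < j)%N -> (j.+1 < n)%N -> a j < a i)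
    (a_gt0 : forall i : 'I_n, 0 < a i) :
  let f := iota_form (tprime a) in
  [/\ forall x : G, exists o, reduced_space G f (moment (coad x f)) = [set o],
      weakly_proper G f
    & ~ proper_moment G f].
Proof.
have td := torus_data_tprime hn a_decr a_gt0.
have odd_m : odd (2 * n).-1 by lia.
rewrite /= (tprimeE a hn); split.
- exact: reduced_singleton td.
- exact: weakly_proper_T td odd_m.
- exact: not_proper_T td.
Qed.
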